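(* Let $n$ be a positive integer. The proper finitely generated subdirectly irreducible members of $\mathbb{V}(\mathbf{F}_n(\mathbb{Z}))$ are exactly the algebras isomorphic to an algebra of the form $\mathbf{H}\overrightarrow{\times}\mathbf{F}_k(\mathbb{Z})$, where $\mathbf{H}$ is a finitely generated totally ordered abelian $\ell$-group and $k\mid n$. Also, these are precisely the proper finitely generated finitely subdirectly irreducible members of $\mathbb{V}(\mathbf{F}_n(\mathbb{Z}))$.
   Context: An $\ell$-pregroup is an algebra $(A,\wedge,\vee,\cdot,1,{}^{\ell},{}^{r})$ such that $(A,\wedge,\vee)$ is a lattice, $(A,\cdot,1)$ is a monoid, multiplication preserves the lattice order, and $a^{\ell}a\le 1\le aa^{\ell}$ and $aa^{r}\le 1\le a^{r}a$ for all $a\in A$. Write $x^{\ell^k}$, $x^{r^k}$ for the $k$-fold application of ${}^\ell$, ${}^r$. The $\ell$-pregroups satisfying $x^\ell\approx x^r$ are exactly the lattice-ordered groups ($\ell$-groups), with $x^\ell=x^r=x^{-1}$; an $\ell$-pregroup is proper if it is not an $\ell$-group. An algebra is subdirectly irreducible if its trivial congruence is completely meet-irreducible in its congruence lattice, and finitely subdirectly irreducible if its trivial congruence is meet-irreducible. For a totally ordered $\ell$-group $\mathbf{H}$ and an $\ell$-pregroup $\mathbf{L}$, the lexicographic product $\mathbf{H}\overrightarrow{\times}\mathbf{L}$ is the $\ell$-pregroup on $H\times L$ with coordinatewise $\cdot$, ${}^\ell$, ${}^r$, unit $(1,1)$, and lattice order given by $(h_1,a_1)\le(h_2,a_2)$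 iff $h_1<h_2$ or ($h_1=h_2$ and $a_1\le a_2$). $\mathbf{F}(\mathbb{Z})$ is the $\ell$-pregroup of all order-preserving maps $f\colon\mathbb{Z}\to\mathbb{Z}$ such that $f^{-1}[\{x\}]$ is finite for every $x\in\mathbb{Z}$, with composition as multiplication, the identity map as $1$, the pointwise order, and $f^{\ell}(q)=\min\{p: q\le f(p)\}$, $f^{r}(q)=\max\{p: f(p)\le q\}$. For a positive integer $n$, $\mathbf{F}_n(\mathbb{Z})$ is the subalgebra of all $f$ with $f^{\ell^n}=f^{r^n}$; equivalently, all $f\in \mathbf{F}(\mathbb{Z})$ with $f(x+n)=f(x)+n$ for all $x\in\mathbb{Z}$. $\mathbb{V}(\mathbf{A})$ denotes the variety generated by the algebra $\mathbf{A}$.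
   Formalization: The divisor k = 1 is excluded (the formal claim requires k | n with k ≥ 2): F_1(Z) consists of the translations of Z, so H ⃗× F_1(Z) is an ℓ-group and never proper, and the statement as written fails for k = 1. *)

(* Defs.v *)
From HB Require Import structures.
From mathcomp Require Import all_boot all_order all_algebra.
From mathcomp Require Import boolp classical_sets functions cardinality.
From mathcomp Require Import zify lra.

Set Implicit Arguments.
Unset Strict Implicit.
Unset Printing Implicit Defensive.

Import Order.TTheory.

Local Open Scope order_scope.
Local Open Scope group_scope.

(* The carriers are choice types; this is no restriction, since boolp makes
   every type a choice type. *)
HB.mixin Record isLpregroup d T of Order.Lattice d T & Monoid T := {
  ladj : T -> T;
  radj : T -> T;
  le_mulg_subproof : forall x y z t : T, x <= y -> z <= t -> x * z <= y * t;
  ladj_mulg_le1_subproof : forall x : T, ladj x * x <= (1 : T);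
  mulg_ladj_ge1_subproof : forall x : T, (1 : T) <= x * ladj x;
  mulg_radj_le1_subproof : forall x : T, x * radj x <= (1 : T);
  radj_mulg_ge1_subproof : forall x : T, (1 : T) <= radj x * x
}.

#[short(type="lpregroupType")]
HB.structure Definition Lpregroup d :=
  { T of Order.Lattice d T & Monoid T & isLpregroup d T }.

(* An l-group is an l-pregroup with x^l = x^r; both are then inverses of x, see
   lgroup_mulgV and lgroup_mulVg. *)
HB.mixin Record Lpregroup_isLgroup d T of Lpregroup d T := {
  ladjE : forall x : T, ladj x = radj x
}.

#[short(type="lgroupType")]
HB.structure Definition Lgroup d :=
  { T of Lpregroup d T & Lpregroup_isLgroup d T }.

#[short(type="orderedLgroupType")]
HB.structure Definition OrderedLgroup d :=
  { T of Lgroup d T & Order.Total d T }.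

Definition lp_proper d (A : lpregroupType d) := ~ (forall x : A, ladj x = radj x).

Definition abelian_lgroup d (H : lgroupType d) := forall x y : H, commute x y.

Definition lp_morphism d (A : lpregroupType d) d' (B : lpregroupType d')
    (f : A -> B) :=
  [/\ {morph f : x y / x `&` y}, {morph f : x y / x `|` y},
      {morph f : x y / x * y} & f 1 = 1] /\
  {morph f : x / ladj x} /\ {morph f : x / radj x}.

Definition isomorphic d (A : lpregroupType d) d' (B : lpregroupType d') :=
  exists f : A -> B, bijective f /\ lp_morphism f.

Definition subuniverse d (A : lpregroupType d) (S : set A) :=
  [/\ forall x y, S x -> S y -> S (x `&` y),
      forall x y, S x -> S y -> S (x `|` y),
      forall x y, S x -> S y -> S (x * y) & S 1] /\
  (forall x, S x -> S (ladj x)) /\ (forall x, S x -> S (radj x)).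

Definition finitely_generated d (A : lpregroupType d) :=
  exists s : seq A, forall S : set A,
    subuniverse S -> (forall x, x \in s -> S x) -> forall x, S x.

Definition congruence d (A : lpregroupType d) (R : A -> A -> Prop) :=
  [/\ forall x, R x x, forall x y, R x y -> R y x
    & forall x y z, R x y -> R y z -> R x z] /\
  [/\ forall x x' y y', R x x' -> R y y' -> R (x `&` y) (x' `&` y'),
      forall x x' y y', R x x' -> R y y' -> R (x `|` y) (x' `|` y'),
      forall x x' y y', R x x' -> R y y' -> R (x * y) (x' * y'),
      forall x x', R x x' -> R (ladj x) (ladj x')
    & forall x x', R x x' -> R (radj x) (radj x')].

(* Meets in the congruence lattice are intersections.  The set C may be empty,
   in which case its meet is the total congruence; so the one-element algebra
   is not subdirectly irreducible. *)
Definition subdirectly_irreducible d (A : lpregroupType d) :=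
  forall C : set (A -> A -> Prop),
    (forall R, C R -> congruence R) ->
    (fun x y => forall R, C R -> R x y) = eq -> C eq.

Definition finitely_subdirectly_irreducible d (A : lpregroupType d) :=
  forall R1 R2 : A -> A -> Prop,
    congruence R1 -> congruence R2 ->
    (fun x y => R1 x y /\ R2 x y) = eq -> R1 = eq \/ R2 = eq.

Inductive lterm :=
  | LVar of nat
  | LOne
  | LMeet of lterm & lterm
  | LJoin of lterm & lterm
  | LMul of lterm & lterm
  | LLadj of lterm
  | LRadj of lterm.

Fixpoint leval d (A : lpregroupType d) (v : nat -> A) (t : lterm) : A :=
  match t with
  | LVar i => v i
  | LOne => 1
  | LMeet t u => leval v t `&` leval v u
  | LJoin t u => leval v t `|` leval v u
  | LMul t u => leval v t * leval v u
  | LLadj t => ladj (leval v t)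
  | LRadj t => radj (leval v t)
  end.

Definition satisfies d (A : lpregroupType d) (E : set (lterm * lterm)) :=
  forall e, E e -> forall v : nat -> A, leval v e.1 = leval v e.2.

(* A variety is an equational class, so A lies in the variety generated by B
   when it lies in every equational class that contains B. *)
Definition in_variety_of d (A : lpregroupType d) d' (B : lpregroupType d') :=
  forall E : set (lterm * lterm), satisfies B E -> satisfies A E.

Section LpregroupTheory.
Variables (d : Order.disp_t) (A : lpregroupType d).
Implicit Types x y z : A.

(* mul1g, mulg1 and mulgA with their operations in the l-pregroup A *)
Lemma lp_mul1g x : 1 * x = x. Proof. exact: mul1g. Qed.
Lemma lp_mulg1 x : x * 1 = x. Proof. exact: mulg1. Qed.
Lemma lp_mulgA x y z : x * (y * z) = x * y * z. Proof. exact: mulgA. Qed.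

Lemma le_mulg x y z t : x <= y -> z <= t -> x * z <= y * t.
Proof. exact: (@le_mulg_subproof d A). Qed.

Lemma ladj_mulg_le1 x : ladj x * x <= (1 : A).
Proof. exact: (@ladj_mulg_le1_subproof d A). Qed.

Lemma mulg_ladj_ge1 x : (1 : A) <= x * ladj x.
Proof. exact: (@mulg_ladj_ge1_subproof d A). Qed.

Lemma mulg_radj_le1 x : x * radj x <= (1 : A).
Proof. exact: (@mulg_radj_le1_subproof d A). Qed.

Lemma radj_mulg_ge1 x : (1 : A) <= radj x * x.
Proof. exact: (@radj_mulg_ge1_subproof d A). Qed.

Lemma radj_uniq x y : x * y <= (1 : A) -> (1 : A) <= y * x -> y = radj x.
Proof.
move=> xy yx; apply: le_anti; apply/andP; split.
- apply: (@le_trans _ _ (radj x * x * y)).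
    by rewrite -{1}[y]lp_mul1g; apply: le_mulg => //; apply: radj_mulg_ge1.
  by rewrite -lp_mulgA -{2}[radj x]lp_mulg1; apply: le_mulg.
- apply: (@le_trans _ _ (y * x * radj x)).
    by rewrite -{1}[radj x]lp_mul1g; apply: le_mulg.
  by rewrite -lp_mulgA -{2}[y]lp_mulg1; apply: le_mulg => //; apply: mulg_radj_le1.
Qed.

Lemma ladj_uniq x y : y * x <= (1 : A) -> (1 : A) <= x * y -> y = ladj x.
Proof.
move=> yx xy; apply: le_anti; apply/andP; split.
- apply: (@le_trans _ _ (y * (x * ladj x))).
    by rewrite -{1}[y]lp_mulg1; apply: le_mulg => //; apply: mulg_ladj_ge1.
  by rewrite lp_mulgA -{2}[ladj x]lp_mul1g; apply: le_mulg.
- apply: (@le_trans _ _ (ladj x * (x * y))).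
    by rewrite -{1}[ladj x]lp_mulg1; apply: le_mulg.
  by rewrite lp_mulgA -{2}[y]lp_mul1g; apply: le_mulg => //; apply: ladj_mulg_le1.
Qed.

Lemma ladjK : cancel (@ladj d A) (@radj d A).
Proof.
by move=> x; rewrite -(@radj_uniq (ladj x) x) ?ladj_mulg_le1 ?mulg_ladj_ge1.
Qed.

Lemma radjK : cancel (@radj d A) (@ladj d A).
Proof.
by move=> x; rewrite -(@ladj_uniq (radj x) x) ?mulg_radj_le1 ?radj_mulg_ge1.
Qed.

Lemma radj1 : radj 1 = 1 :> A.
Proof. by rewrite -(@radj_uniq 1 1) ?lp_mulg1. Qed.

Lemma ladj1 : ladj 1 = 1 :> A.
Proof. by rewrite -(@ladj_uniq 1 1) ?lp_mulg1. Qed.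

Lemma le_radj x y : x <= y -> radj y <= radj x.
Proof.
move=> xy; apply: (@le_trans _ _ (radj x * x * radj y)).
  by rewrite -{1}[radj y]lp_mul1g; apply: le_mulg => //; apply: radj_mulg_ge1.
rewrite -lp_mulgA -{2}[radj x]lp_mulg1; apply: le_mulg => //.
by apply: le_trans (mulg_radj_le1 y); apply: le_mulg.
Qed.

Lemma le_ladj x y : x <= y -> ladj y <= ladj x.
Proof.
move=> xy; apply: (@le_trans _ _ (ladj y * (x * ladj x))).
  by rewrite -{1}[ladj y]lp_mulg1; apply: le_mulg => //; apply: mulg_ladj_ge1.
rewrite lp_mulgA -{2}[ladj x]lp_mul1g; apply: le_mulg => //.
by apply: le_trans (ladj_mulg_le1 y); apply: le_mulg.
Qed.

Lemma radjM x y : radj (x * y) = radj y * radj x.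
Proof.
apply/esym/radj_uniq.
- rewrite -lp_mulgA [y * _]lp_mulgA; apply: le_trans (mulg_radj_le1 x).
  rewrite -{2}[radj x]lp_mul1g; apply: le_mulg => //; apply: le_mulg => //.
  exact: mulg_radj_le1.
- rewrite -lp_mulgA [radj x * _]lp_mulgA; apply: le_trans (radj_mulg_ge1 y) _.
  rewrite -{2}[y]lp_mul1g; apply: le_mulg => //; apply: le_mulg => //.
  exact: radj_mulg_ge1.
Qed.

Lemma ladjM x y : ladj (x * y) = ladj y * ladj x.
Proof.
by apply: (can_inj radjK); rewrite ladjK radjM !ladjK.
Qed.

Lemma radjI x y : radj (x `&` y) = radj x `|` radj y.
Proof.
apply: le_anti; rewrite leUx !le_radj ?leIl ?leIr //= andbT.
rewrite -[leRHS]ladjK; apply: le_radj; rewrite lexI.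
by rewrite -{2}[x]radjK -{3}[y]radjK !le_ladj ?leUl ?leUr.
Qed.

Lemma ladjI x y : ladj (x `&` y) = ladj x `|` ladj y.
Proof.
apply: le_anti; rewrite leUx !le_ladj ?leIl ?leIr //= andbT.
rewrite -[leRHS]radjK; apply: le_ladj; rewrite lexI.
by rewrite -{2}[x]ladjK -{3}[y]ladjK !le_radj ?leUl ?leUr.
Qed.

Lemma radjU x y : radj (x `|` y) = radj x `&` radj y.
Proof. by apply: (can_inj ladjK); rewrite ladjI !radjK. Qed.

Lemma ladjU x y : ladj (x `|` y) = ladj x `&` ladj y.
Proof. by apply: (can_inj radjK); rewrite radjI !ladjK. Qed.

Section Iter.
Variable f : A -> A.

Lemma iter_adjM n x y : {morph f : x y / x * y >-> y * x} ->
  iter n f (x * y) = if odd n then iter n f y * iter n f x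
                     else iter n f x * iter n f y.
Proof. by move=> fM; elim: n => //= n ->; case: (odd n); rewrite fM. Qed.

Lemma iter_adjI n x y : {morph f : x y / x `&` y >-> x `|` y} ->
  {morph f : x y / x `|` y >-> x `&` y} ->
  iter n f (x `&` y) = if odd n then iter n f x `|` iter n f y
                       else iter n f x `&` iter n f y.
Proof.
by move=> fI fU; elim: n => //= n ->; case: (odd n); rewrite ?fI ?fU.
Qed.

Lemma iter_adjU n x y : {morph f : x y / x `&` y >-> x `|` y} ->
  {morph f : x y / x `|` y >-> x `&` y} ->
  iter n f (x `|` y) = if odd n then iter n f x `&` iter n f y
                       else iter n f x `|` iter n f y.
Proof.
by move=> fI fU; elim: n => //= n ->; case: (odd n); rewrite ?fI ?fU.
Qed.

End Iter.

(* The n-periodic elements of A: x^(l^n) = x^(r^n) *)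
Definition periodic n : {pred A} :=
  [pred x : A | iter n (@ladj d A) x == iter n (@radj d A) x].

Lemma periodic_meet n : {in periodic n &, forall x y, x `&` y \in periodic n}.
Proof.
move=> x y /eqP xP /eqP yP; apply/eqP.
rewrite !iter_adjI ?xP ?yP // => ? ?;
by rewrite ?(ladjI, ladjU, radjI, radjU).
Qed.

Lemma periodic_join n : {in periodic n &, forall x y, x `|` y \in periodic n}.
Proof.
move=> x y /eqP xP /eqP yP; apply/eqP.
rewrite !iter_adjU ?xP ?yP // => ? ?;
by rewrite ?(ladjI, ladjU, radjI, radjU).
Qed.

Lemma periodic_monoid n : umagma_closed (periodic n).
Proof.
split.
  by apply/eqP; rewrite !iter_fix ?ladj1 ?radj1.
move=> x y /eqP xP /eqP yP; apply/eqP.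
by rewrite !iter_adjM ?xP ?yP // => ? ?; rewrite ?(ladjM, radjM).
Qed.

Lemma periodic_ladj n x : x \in periodic n -> ladj x \in periodic n.
Proof.
move=> /eqP xP; apply/eqP; rewrite -iterSr iterS xP.
by elim: n {xP} => //= n <-; rewrite ladjK radjK.
Qed.

Lemma periodic_radj n x : x \in periodic n -> radj x \in periodic n.
Proof.
move=> /eqP xP; apply/eqP; rewrite -[RHS]iterSr iterS -xP.
by elim: n {xP} => //= n ->; rewrite ladjK radjK.
Qed.

End LpregroupTheory.

Record periodic_sub n d (A : lpregroupType d) := PeriodicSub {
  periodic_val :> A;
  _ : periodic_val \in @periodic d A n
}.

HB.instance Definition _ n d (A : lpregroupType d) :=
  [isSub for @periodic_val n d A].
HB.instance Definition _ n d (A : lpregroupType d) :=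
  [Choice of @periodic_sub n d A by <:].
HB.instance Definition _ n d (A : lpregroupType d) :=
  Order.SubChoice_isSubLattice.Build d A (@periodic d A n) d (@periodic_sub n d A)
    (@periodic_meet d A n) (@periodic_join d A n).
HB.instance Definition _ n d (A : lpregroupType d) :=
  SubChoice_isSubMonoid.Build A (@periodic d A n) (@periodic_sub n d A)
    (@periodic_monoid d A n).

Definition periodic_sub_ladj n d (A : lpregroupType d)
    (x : @periodic_sub n d A) : @periodic_sub n d A :=
  PeriodicSub (periodic_ladj (valP x)).
Definition periodic_sub_radj n d (A : lpregroupType d)
    (x : @periodic_sub n d A) : @periodic_sub n d A :=
  PeriodicSub (periodic_radj (valP x)).

Section PeriodicSub.
Variables (n : nat) (d : Order.disp_t) (A : lpregroupType d).
Implicit Types x y z t : @periodic_sub n d A.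

Fact periodic_sub_le_mulg x y z t : x <= y -> z <= t -> x * z <= y * t.
Proof. by rewrite -!Order.le_val; apply: le_mulg. Qed.

Fact periodic_sub_ladj_mulg_le1 x :
  periodic_sub_ladj x * x <= (1 : @periodic_sub n d A).
Proof. by rewrite -Order.le_val; apply: ladj_mulg_le1. Qed.

Fact periodic_sub_mulg_ladj_ge1 x :
  (1 : @periodic_sub n d A) <= x * periodic_sub_ladj x.
Proof. by rewrite -Order.le_val; apply: mulg_ladj_ge1. Qed.

Fact periodic_sub_mulg_radj_le1 x :
  x * periodic_sub_radj x <= (1 : @periodic_sub n d A).
Proof. by rewrite -Order.le_val; apply: mulg_radj_le1. Qed.

Fact periodic_sub_radj_mulg_ge1 x :
  (1 : @periodic_sub n d A) <= periodic_sub_radj x * x.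
Proof. by rewrite -Order.le_val; apply: radj_mulg_ge1. Qed.

HB.instance Definition _ := isLpregroup.Build d (@periodic_sub n d A)
  periodic_sub_le_mulg periodic_sub_ladj_mulg_le1 periodic_sub_mulg_ladj_ge1
  periodic_sub_mulg_radj_le1 periodic_sub_radj_mulg_ge1.

End PeriodicSub.

Definition lexprod dH (H : orderedLgroupType dH) d (A : lpregroupType d) : Type :=
  (H * A)%type.

Section LexProd.
Variables (dH : Order.disp_t) (H : orderedLgroupType dH).
Variables (d : Order.disp_t) (A : lpregroupType d).

Local Notation HA := (@lexprod dH H d A).
Implicit Types x y z t : HA.

HB.instance Definition _ := Choice.copy HA (H * A)%type.

Definition lexprod_le x y := (x.1 < y.1) || ((x.1 == y.1) && (x.2 <= y.2)).

Fact lexprod_le_refl : reflexive lexprod_le.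
Proof. by move=> x; rewrite /lexprod_le eqxx lexx orbT. Qed.

Fact lexprod_le_anti : antisymmetric lexprod_le.
Proof.
move=> [x1 x2] [y1 y2]; rewrite /lexprod_le /=.
case: (ltgtP x1 y1) => //= -> /andP[? ?]; congr (_, _).
by apply: le_anti; apply/andP.
Qed.

Fact lexprod_le_trans : transitive lexprod_le.
Proof.
move=> [y1 y2] [x1 x2] [z1 z2]; rewrite /lexprod_le /=.
case/orP => [xy|/andP[/eqP-> xy]]; case/orP => [yz|/andP[/eqP<- yz]].
- by rewrite (lt_trans xy yz).
- by rewrite xy.
- by rewrite yz.
- by rewrite eqxx (le_trans xy yz) orbT.
Qed.

HB.instance Definition _ := Order.Le_isPOrder.Build d HA
  lexprod_le_refl lexprod_le_anti lexprod_le_trans.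

Lemma lexprod_leE x y :
  (x <= y) = (x.1 < y.1) || ((x.1 == y.1) && (x.2 <= y.2)).
Proof. by []. Qed.

Definition lexprod_meet x y : HA :=
  if x.1 < y.1 then x else if y.1 < x.1 then y else (x.1, x.2 `&` y.2).

Definition lexprod_join x y : HA :=
  if x.1 < y.1 then y else if y.1 < x.1 then x else (x.1, x.2 `|` y.2).

Fact lexprod_meetP x y z :
  (x <= lexprod_meet y z) = (x <= y) && (x <= z).
Proof.
case: x y z => [x1 x2] [y1 y2] [z1 z2].
rewrite /lexprod_meet; case: (ltgtP y1 z1) => /= [yz|zy|<-].
- rewrite !lexprod_leE /=; case: (ltgtP x1 y1) => [xy|//|->] /=.
    by rewrite (lt_trans xy yz).
  by rewrite yz andbT.
- rewrite !lexprod_leE /=; case: (ltgtP x1 z1) => [xz|/=|->] /=.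
  + by rewrite (lt_trans xz zy).
  + by rewrite andbF.
  + by rewrite zy.
- by rewrite !lexprod_leE /=; case: (ltgtP x1 y1) => //= _; rewrite lexI.
Qed.

Fact lexprod_joinP x y z :
  (lexprod_join x y <= z) = (x <= z) && (y <= z).
Proof.
case: x y z => [x1 x2] [y1 y2] [z1 z2].
rewrite /lexprod_join; case: (ltgtP x1 y1) => /= [xy|yx|<-].
- rewrite !lexprod_leE /=; case: (ltgtP y1 z1) => [yz|/=|<-] /=.
  + by rewrite (lt_trans xy yz).
  + by rewrite andbF.
  + by rewrite xy.
- rewrite !lexprod_leE /=; case: (ltgtP x1 z1) => [xz|//|<-] /=.
    by rewrite (lt_trans yx xz).
  by rewrite yx andbT.
- by rewrite !lexprod_leE /=; case: (ltgtP x1 z1) => //= _; rewrite leUx.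
Qed.

HB.instance Definition _ := Order.POrder_MeetJoin_isLattice.Build d HA
  lexprod_meetP lexprod_joinP.

Definition lexprod_one : HA := (1, 1).
Definition lexprod_mul x y : HA := (x.1 * y.1, x.2 * y.2).
Definition lexprod_ladj x : HA := (ladj x.1, ladj x.2).
Definition lexprod_radj x : HA := (radj x.1, radj x.2).

Fact lexprod_mulA : associative lexprod_mul.
Proof. by move=> x y z; congr (_, _); rewrite /= lp_mulgA. Qed.

Fact lexprod_mul1 : left_id lexprod_one lexprod_mul.
Proof. by move=> [x y]; congr (_, _); rewrite /= lp_mul1g. Qed.

Fact lexprod_mulr1 : right_id lexprod_one lexprod_mul.
Proof. by move=> [x y]; congr (_, _); rewrite /= lp_mulg1. Qed.

HB.instance Definition _ := isMonoid.Build HA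
  lexprod_mulA lexprod_mul1 lexprod_mulr1.

Lemma lgroup_mulgV (h : H) : h * ladj h = 1.
Proof.
by apply: le_anti; rewrite mulg_ladj_ge1 andbT ladjE mulg_radj_le1.
Qed.

Lemma lgroup_mulVg (h : H) : ladj h * h = 1.
Proof.
by apply: le_anti; rewrite ladj_mulg_le1 ladjE radj_mulg_ge1.
Qed.

Lemma lgroup_mulgK (h k : H) : h * k * ladj k = h.
Proof. by rewrite -lp_mulgA lgroup_mulgV lp_mulg1. Qed.

Lemma lgroup_mulKg (h k : H) : ladj h * (h * k) = k.
Proof. by rewrite lp_mulgA lgroup_mulVg lp_mul1g. Qed.

Lemma lgroup_lt_mulg (h h' k k' : H) : h < h' -> k <= k' -> h * k < h' * k'.
Proof.
move=> hh kk; rewrite lt_neqAle le_mulg ?(ltW hh) // andbT.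
apply/eqP => e; have: h' <= h; last by rewrite leNgt hh.
by rewrite -(lgroup_mulgK h k') -(lgroup_mulgK h' k') -e !le_mulg.
Qed.

Lemma lgroup_le_lt_mulg (h h' k k' : H) : h <= h' -> k < k' -> h * k < h' * k'.
Proof.
move=> hh kk; rewrite lt_neqAle le_mulg ?(ltW kk) // andbT.
apply/eqP => e; have: k' <= k; last by rewrite leNgt kk.
by rewrite -(lgroup_mulKg h k) -(lgroup_mulKg h k') e !le_mulg.
Qed.

Fact lexprod_le_mulg x y z t : x <= y -> z <= t -> x * z <= y * t.
Proof.
rewrite !lexprod_leE /=.
case/orP => [xy|/andP[/eqP exy xy]]; case/orP => [zt|/andP[/eqP ezt zt]].
- by rewrite lgroup_lt_mulg // ltW.
- by rewrite ezt lgroup_lt_mulg.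
- by rewrite exy lgroup_le_lt_mulg.
- by rewrite exy ezt eqxx le_mulg ?orbT.
Qed.

Fact lexprod_ladj_mulg_le1 x : lexprod_ladj x * x <= (1 : HA).
Proof. by rewrite lexprod_leE /= lgroup_mulVg eqxx ladj_mulg_le1 orbT. Qed.

Fact lexprod_mulg_ladj_ge1 x : (1 : HA) <= x * lexprod_ladj x.
Proof. by rewrite lexprod_leE /= lgroup_mulgV eqxx mulg_ladj_ge1 orbT. Qed.

Fact lexprod_mulg_radj_le1 x : x * lexprod_radj x <= (1 : HA).
Proof.
by rewrite lexprod_leE /= -ladjE lgroup_mulgV eqxx mulg_radj_le1 orbT.
Qed.

Fact lexprod_radj_mulg_ge1 x : (1 : HA) <= lexprod_radj x * x.
Proof.
by rewrite lexprod_leE /= -ladjE lgroup_mulVg eqxx radj_mulg_ge1 orbT.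
Qed.

HB.instance Definition _ := isLpregroup.Build d HA
  lexprod_le_mulg lexprod_ladj_mulg_le1 lexprod_mulg_ladj_ge1
  lexprod_mulg_radj_le1 lexprod_radj_mulg_ge1.

End LexProd.

Record FZ := MkFZ {
  FZ_fun :> int -> int;
  FZ_homo : {homo FZ_fun : p q / p <= q};
  FZ_fin : forall q : int, finite_set (FZ_fun @^-1` [set q]%classic)
}.

HB.instance Definition _ := gen_eqMixin FZ.
HB.instance Definition _ := gen_choiceMixin FZ.

Lemma FZ_ext (f g : FZ) : f =1 g -> f = g.
Proof.
case: f g => [f f1 f2] [g g1 g2] /= /funext fg.
rewrite fg in f1 f2 *; congr MkFZ; exact: Prop_irrelevance.
Qed.

Section IntegerMaps.
Local Open Scope ring_scope.

(* Finite fibres amount to being unbounded in both directions. *)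
Lemma finite_int_seg (p0 p1 : int) :
  finite_set [set p : int | p0 <= p <= p1]%classic.
Proof.
apply: (@sub_finite_set _ _
  ((fun i : nat => p0 + i%:Z)%R @` `I_(`|p1 - p0|%N.+1))%classic); last first.
  exact/finite_image/finite_II.
move=> p /= /andP[p0p pp1]; exists `|p - p0|%N => /=; first by lia.
by lia.
Qed.

Lemma unbounded_fin (f : int -> int) : {homo f : p q / p <= q} ->
  (forall q, exists p, q <= f p) -> (forall q, exists p, f p <= q) ->
  forall q, finite_set (f @^-1` [set q])%classic.
Proof.
move=> fh fu fl q.
have [p1 p1P] := fu (q + 1)%R; have [p0 p0P] := fl (q - 1)%R.
apply: sub_finite_set (finite_int_seg p0 p1) => p /= fpq; apply/andP; split.
- case: (leP p0 p) => // /ltW /fh; lia.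
- case: (leP p p1) => // /ltW /fh; lia.
Qed.

Lemma finite_int_bounded (A : set int) : finite_set A ->
  exists n : nat, forall p : int, A p -> (`|p| <= n)%N.
Proof.
move=> /finite_seqP[s ->]; exists (\max_(p <- s) `|p|)%N => p /= ps.
exact: (@leq_bigmax_seq _ s xpredT (fun p : int => `|p|%N)).
Qed.

Lemma FZ_unbounded_above (f : FZ) (q : int) : exists p, q <= f p.
Proof.
have step p : exists2 p', p <= p' & f p + 1 <= f p'.
  have [n nP] := finite_int_bounded (@FZ_fin f (f p)).
  have pp : p <= p + (n + `|p| + 1)%N%:Z by lia.
  exists (p + (n + `|p| + 1)%N%:Z)%R => //.
  have := FZ_homo f pp; rewrite le_eqVlt => /orP[/eqP e|]; last by lia.
  have := nP (p + (n + `|p| + 1)%N%:Z)%R (esym e); lia.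
have up m : exists p, f 0%R + m%:Z <= f p.
  elim: m => [|m [p pP]]; first by exists 0%R; lia.
  by have [p' _ p'P] := step p; exists p'; lia.
by have [p pP] := up `|q - f 0%R|%N; exists p; lia.
Qed.

Lemma FZ_unbounded_below (f : FZ) (q : int) : exists p, f p <= q.
Proof.
have step p : exists2 p', p' <= p & f p' <= f p - 1.
  have [n nP] := finite_int_bounded (@FZ_fin f (f p)).
  have pp : p - (n + `|p| + 1)%N%:Z <= p by lia.
  exists (p - (n + `|p| + 1)%N%:Z)%R => //.
  have := FZ_homo f pp; rewrite le_eqVlt => /orP[/eqP e|]; last by lia.
  have := nP (p - (n + `|p| + 1)%N%:Z)%R e; lia.
have up m : exists p, f p <= f 0%R - m%:Z.
  elim: m => [|m [p pP]]; first by exists 0%R; lia.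
  by have [p' _ p'P] := step p; exists p'; lia.
by have [p pP] := up `|q - f 0%R|%N; exists p; lia.
Qed.

Lemma int_min_ex (A : set int) (p0 p1 : int) :
  A p1 -> (forall p, A p -> p0 <= p) -> exists p, A p /\ lbound A p.
Proof.
move=> Ap1 lb.
have ex : exists n : nat, `[< A (p0 + n%:Z)%R >].
  exists `|p1 - p0|%N; apply/asboolP; suff -> : (p0 + `|p1 - p0|%N)%R = p1 by [].
  by have := lb _ Ap1; lia.
case: (ex_minnP ex) => m /asboolP mP mmin; exists (p0 + m%:Z)%R; split=> // p Ap.
have := lb _ Ap; have /mmin : `[< A (p0 + `|p - p0|%N)%R >]; last by lia.
apply/asboolP; suff -> : (p0 + `|p - p0|%N)%R = p by [].
by have := lb _ Ap; lia.
Qed.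

Lemma int_max_ex (A : set int) (p0 p1 : int) :
  A p1 -> (forall p, A p -> p <= p0) -> exists p, A p /\ ubound A p.
Proof.
move=> Ap1 ub.
have [|p Ap|p [Ap pP]] :=
  @int_min_ex [set p | A (- p)%R]%classic (- p0)%R (- p1)%R.
- by rewrite /= GRing.opprK.
- by have := ub _ Ap; lia.
- exists (- p)%R; split=> // q Aq.
  have /pP : A (- - q)%R by rewrite GRing.opprK.
  by lia.
Qed.

(* Both default to 0 when the extremum does not exist; FZ_ladjP and FZ_radjP
   show that it exists for the sets used below. *)
Definition int_min (A : set int) : int := xget 0%R (A `&` lbound A)%classic.
Definition int_max (A : set int) : int := xget 0%R (A `&` ubound A)%classic.

Definition FZ_ladj_fun (f : FZ) (q : int) : int :=
  int_min [set p | q <= f p]%classic.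
Definition FZ_radj_fun (f : FZ) (q : int) : int :=
  int_max [set p | f p <= q]%classic.

Lemma FZ_ladjP (f : FZ) p q : (FZ_ladj_fun f q <= p) = (q <= f p).
Proof.
have [p1 p1P] := FZ_unbounded_above f q.
have [p0 p0P] := FZ_unbounded_below f (q - 1)%R.
have ex : exists p, ([set p | q <= f p] `&` lbound [set p | q <= f p])%classic p.
  apply: (@int_min_ex _ p0 p1) => //= p' p'P.
  by case: (leP p0 p') => // /ltW /(FZ_homo f); lia.
have [/= le_q lb] := xgetPex 0%R ex.
by apply/idP/idP => [/(FZ_homo f)|/lb//]; apply: le_trans.
Qed.

Lemma FZ_radjP (f : FZ) p q : (p <= FZ_radj_fun f q) = (f p <= q).
Proof.
have [p1 p1P] := FZ_unbounded_above f (q + 1)%R.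
have [p0 p0P] := FZ_unbounded_below f q.
have ex : exists p, ([set p | f p <= q] `&` ubound [set p | f p <= q])%classic p.
  apply: (@int_max_ex _ p1 p0) => //= p' p'P.
  by case: (leP p' p1) => // /ltW /(FZ_homo f); lia.
have [/= le_q ub] := xgetPex 0%R ex.
by apply/idP/idP => [/(FZ_homo f)/le_trans|/ub//]; apply.
Qed.

End IntegerMaps.

Fact FZ_id_fin q : finite_set ((@id int) @^-1` [set q])%classic.
Proof. exact: (finite_set1 q). Qed.

Definition FZ_one : FZ := @MkFZ id (fun p q pq => pq) FZ_id_fin.

Section FZOps.
Variables f g : FZ.

Fact FZ_mul_homo : {homo f \o g : p q / p <= q}.
Proof. by move=> p q pq; apply/FZ_homo/FZ_homo. Qed.

Fact FZ_mul_fin q : finite_set ((f \o g) @^-1` [set q])%classic.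
Proof.
apply: (unbounded_fin FZ_mul_homo) => {}q /=.
- have [p pP] := FZ_unbounded_above f q.
  have [p' p'P] := FZ_unbounded_above g p.
  by exists p'; apply: le_trans pP (FZ_homo f p'P).
- have [p pP] := FZ_unbounded_below f q.
  have [p' p'P] := FZ_unbounded_below g p.
  by exists p'; apply: le_trans (FZ_homo f p'P) pP.
Qed.

Definition FZ_mul : FZ := MkFZ FZ_mul_homo FZ_mul_fin.

Fact FZ_meet_homo : {homo (fun p => f p `&` g p) : p q / p <= q}.
Proof. by move=> p q pq; rewrite leI2 ?FZ_homo. Qed.

Fact FZ_meet_fin q : finite_set ((fun p => (f p `&` g p)%O) @^-1` [set q])%classic.
Proof.
apply: (unbounded_fin FZ_meet_homo) => {}q /=.
- have [p pP] := FZ_unbounded_above f q.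
  have [p' p'P] := FZ_unbounded_above g q.
  exists (p `|` p'); rewrite lexI (le_trans pP) ?FZ_homo ?leUl //=.
  by rewrite (le_trans p'P) ?FZ_homo ?leUr.
- have [p pP] := FZ_unbounded_below f q.
  by exists p; rewrite (le_trans _ pP) ?leIl.
Qed.

Definition FZ_meet : FZ := MkFZ FZ_meet_homo FZ_meet_fin.

Fact FZ_join_homo : {homo (fun p => f p `|` g p) : p q / p <= q}.
Proof. by move=> p q pq; rewrite leU2 ?FZ_homo. Qed.

Fact FZ_join_fin q : finite_set ((fun p => (f p `|` g p)%O) @^-1` [set q])%classic.
Proof.
apply: (unbounded_fin FZ_join_homo) => {}q /=.
- have [p pP] := FZ_unbounded_above f q.
  by exists p; rewrite (le_trans pP) ?leUl.
- have [p pP] := FZ_unbounded_below f q.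
  have [p' p'P] := FZ_unbounded_below g q.
  exists (p `&` p'); rewrite leUx (le_trans _ pP) ?FZ_homo ?leIl //=.
  by rewrite (le_trans _ p'P) ?FZ_homo ?leIr.
Qed.

Definition FZ_join : FZ := MkFZ FZ_join_homo FZ_join_fin.

Fact FZ_ladj_homo : {homo FZ_ladj_fun f : p q / p <= q}.
Proof.
by move=> p q pq; rewrite FZ_ladjP (le_trans pq) // -FZ_ladjP.
Qed.

Fact FZ_ladj_fin q : finite_set (FZ_ladj_fun f @^-1` [set q])%classic.
Proof.
apply: (unbounded_fin FZ_ladj_homo) => {}q.
- exists (f q + 1)%R.
  have fq : f (q - 1)%R <= f q by apply: FZ_homo; lia.
  by have := FZ_ladjP f (q - 1)%R (f q + 1)%R; lia.
- by exists (f q); rewrite FZ_ladjP.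
Qed.

Definition FZ_ladj : FZ := MkFZ FZ_ladj_homo FZ_ladj_fin.

Fact FZ_radj_homo : {homo FZ_radj_fun f : p q / p <= q}.
Proof.
by move=> p q pq; rewrite FZ_radjP (le_trans _ pq) // -FZ_radjP.
Qed.

Fact FZ_radj_fin q : finite_set (FZ_radj_fun f @^-1` [set q])%classic.
Proof.
apply: (unbounded_fin FZ_radj_homo) => {}q.
- by exists (f q); rewrite FZ_radjP.
- exists (f q - 1)%R.
  have fq : f q <= f (q + 1)%R by apply: FZ_homo; lia.
  by have := FZ_radjP f (q + 1)%R (f q - 1)%R; lia.
Qed.

Definition FZ_radj : FZ := MkFZ FZ_radj_homo FZ_radj_fin.

End FZOps.

Definition FZ_le (f g : FZ) : bool := `[< forall p, f p <= g p >].

Fact FZ_le_refl : reflexive FZ_le.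
Proof. by move=> f; apply/asboolP. Qed.

Fact FZ_le_anti : antisymmetric FZ_le.
Proof.
move=> f g /andP[/asboolP fg /asboolP gf]; apply: FZ_ext => p.
by apply: le_anti; rewrite fg gf.
Qed.

Fact FZ_le_trans : transitive FZ_le.
Proof.
move=> g f h /asboolP fg /asboolP gh; apply/asboolP => p.
exact: le_trans (fg p) (gh p).
Qed.

Fact FZ_display : Order.disp_t. Proof. exact: Order.Disp tt tt. Qed.

HB.instance Definition _ := Order.Le_isPOrder.Build FZ_display FZ
  FZ_le_refl FZ_le_anti FZ_le_trans.

Lemma FZ_leP (f g : FZ) : reflect (forall p, f p <= g p) (f <= g).
Proof. exact: asboolP. Qed.

Fact FZ_meetP (f g h : FZ) : (f <= FZ_meet g h) = (f <= g) && (f <= h).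
Proof.
apply/FZ_leP/andP => [fgh|[/FZ_leP fg /FZ_leP fh] p].
  by split; apply/FZ_leP => p; have := fgh p; rewrite /= lexI => /andP[].
by rewrite /= lexI fg fh.
Qed.

Fact FZ_joinP (f g h : FZ) : (FZ_join f g <= h) = (f <= h) && (g <= h).
Proof.
apply/FZ_leP/andP => [fgh|[/FZ_leP fg /FZ_leP fh] p].
  by split; apply/FZ_leP => p; have := fgh p; rewrite /= leUx => /andP[].
by rewrite /= leUx fg fh.
Qed.

HB.instance Definition _ := Order.POrder_MeetJoin_isLattice.Build FZ_display FZ
  FZ_meetP FZ_joinP.

Fact FZ_mulA : associative FZ_mul.
Proof. by move=> f g h; apply: FZ_ext. Qed.

Fact FZ_mul1 : left_id FZ_one FZ_mul.
Proof. by move=> f; apply: FZ_ext. Qed.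

Fact FZ_mulr1 : right_id FZ_one FZ_mul.
Proof. by move=> f; apply: FZ_ext. Qed.

HB.instance Definition _ := isMonoid.Build FZ FZ_mulA FZ_mul1 FZ_mulr1.

Fact FZ_le_mulg (f g h k : FZ) : f <= g -> h <= k -> f * h <= g * k.
Proof.
move=> /FZ_leP fg /FZ_leP hk; apply/FZ_leP => p /=.
exact: le_trans (fg _) (FZ_homo g (hk p)).
Qed.

Fact FZ_ladj_mulg_le1 (f : FZ) : FZ_ladj f * f <= (1 : FZ).
Proof. by apply/FZ_leP => p /=; rewrite FZ_ladjP. Qed.

Fact FZ_mulg_ladj_ge1 (f : FZ) : (1 : FZ) <= f * FZ_ladj f.
Proof. by apply/FZ_leP => p /=; rewrite -FZ_ladjP. Qed.

Fact FZ_mulg_radj_le1 (f : FZ) : f * FZ_radj f <= (1 : FZ).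
Proof. by apply/FZ_leP => p /=; rewrite -FZ_radjP. Qed.

Fact FZ_radj_mulg_ge1 (f : FZ) : (1 : FZ) <= FZ_radj f * f.
Proof. by apply/FZ_leP => p /=; rewrite FZ_radjP. Qed.

HB.instance Definition _ := isLpregroup.Build FZ_display FZ
  FZ_le_mulg FZ_ladj_mulg_le1 FZ_mulg_ladj_ge1
  FZ_mulg_radj_le1 FZ_radj_mulg_ge1.

Definition FnZ (n : nat) : lpregroupType FZ_display := @periodic_sub n _ FZ.

(* Main.v *)
Require Import Defs.
From HB Require Import structures.
From mathcomp Require Import all_boot all_order all_algebra.
From mathcomp Require Import boolp classical_sets functions cardinality.
From mathcomp Require Import zify ring lra.

Set Implicit Arguments.
Unset Strict Implicit.
Unset Printing Implicit Defensive.

Import Order.TTheory GRing.Theory.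

Local Open Scope order_scope.
Local Open Scope group_scope.

(** An algebra A of the variety generated by F_n(Z) satisfies x^(l^2n) = x, so
    the join [hull n x] of the orbit of x under [ll] : x |-> x^ll is the least
    invertible element, or unit, above x; in F_n(Z) it is the translation by the
    largest displacement of x.  An inequality x <= y amounts to the triviality
    of the unit 1 \/ hull (y^l x), so statements about F_n(Z) become equations
    between units.

    The n-th power c of a unit is central, and if c >= 1 the relation x <= y c^m
    and y <= x c^m for some m is a congruence.  Units whose meet is 1 yield
    congruences that intersect trivially; hence if A is finitely subdirectly
    irreducible its units form a chain ([fsi_total]).  If moreover A is proper,
    every finite system of equalities and inequations that holds in A is realized in F_n(Z),
    a fixed unit s of A being realized by the shift q |-> q + 1
    ([local_terms], [proper_fsi_local]): otherwise one single equation would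
    hold in F_n(Z) and fail in A.  So A satisfies the universal statements that
    hold in F_n(Z) with the shift as a constant.

    A then is analysed as a subalgebra of F_n(Z) would be.  Among the
    inflationary elements with a fixed point, some element e jumps farthest, by
    k - 1 say; it may be taken to round up to a coset of kZ ([ceiling_ex]), and
    the maximality of k forces every element to commute with s^k
    ([period_comm]).  Evaluating at the points of the coset makes A act
    faithfully on its chain G of units ([act], [act_faithful]).  G is finitely
    generated because A is ([units_generated]) and torsion free modulo s, hence
    splits as a product of the powers of s and a finitely generated chain H of
    units that commute with e ([central_complement]).  Reading the images of
    the powers of s in these coordinates gives an element of H and a map in
    F_k(Z), and this is an isomorphism ([decompose_isomorphic]).

    Conversely, in H x F_k(Z) with k > 1 the pair (1, shift) is the least unit
    above 1, and every nontrivial congruence identifies it with 1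
    ([congruence_least]).  This algebra is generated by H, the shift and the
    rounding to kZ ([lexprod_generated]).  It satisfies the equations of F_k(Z)
    because the value of a term depends on finitely many comparisons between
    integer combinations of elements of H; by Fourier-Motzkin elimination
    ([sign_match_int]) integers satisfy the same comparisons, and replacing the
    elements of H by the translations by large multiples of these integers
    turns a failure in H x F_k(Z) into one in F_k(Z) ([lexprod_equation]).
    Finally F_k(Z) embeds in F_n(Z) when k divides n. *)

(** * Residuation and units *)

Section Residuation.
Variables (d : Order.disp_t) (A : lpregroupType d).
Implicit Types x y z g h : A.

(** The adjoints of x make both translations by x residuated, whence these
    preserve meets and joins. *)
Lemma le_mul_ladj x y z : (y <= x * z) = (ladj x * y <= z).
Proof.
apply/idP/idP => h.
- apply: (@le_trans _ _ (ladj x * (x * z))); first exact: le_mulg.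
  by rewrite lp_mulgA -{2}[z]lp_mul1g le_mulg ?ladj_mulg_le1.
- apply: (@le_trans _ _ (x * (ladj x * y))); last exact: le_mulg.
  by rewrite lp_mulgA -{1}[y]lp_mul1g le_mulg ?mulg_ladj_ge1.
Qed.

Lemma mul_le_radj x y z : (x * z <= y) = (z <= radj x * y).
Proof. by rewrite -{1}[x]radjK -le_mul_ladj. Qed.

Lemma mul_le_ladj x y z : (z * x <= y) = (z <= y * ladj x).
Proof.
apply/idP/idP => h.
- apply: (@le_trans _ _ (z * x * ladj x)); last exact: le_mulg.
  by rewrite -lp_mulgA -{1}[z]lp_mulg1 le_mulg ?mulg_ladj_ge1.
- apply: (@le_trans _ _ (y * ladj x * x)); first exact: le_mulg.
  by rewrite -lp_mulgA -{2}[y]lp_mulg1 le_mulg ?ladj_mulg_le1.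
Qed.

Lemma lp_mulgI x y z : x * (y `&` z) = x * y `&` x * z.
Proof.
apply: le_anti; rewrite lexI !le_mulg ?leIl ?leIr //=.
by rewrite le_mul_ladj lexI -!le_mul_ladj leIl leIr.
Qed.

Lemma lp_mulIg x y z : (y `&` z) * x = y * x `&` z * x.
Proof.
apply: le_anti; rewrite lexI !le_mulg ?leIl ?leIr //=.
by rewrite -[x]radjK -mul_le_ladj lexI !mul_le_ladj leIl leIr.
Qed.

Lemma lp_mulgU x y z : x * (y `|` z) = x * y `|` x * z.
Proof.
apply: le_anti; rewrite leUx !le_mulg ?leUl ?leUr //= andbT.
by rewrite mul_le_radj leUx -!mul_le_radj leUl leUr.
Qed.

Lemma lp_mulUg x y z : (y `|` z) * x = y * x `|` z * x.
Proof.
apply: le_anti; rewrite leUx !le_mulg ?leUl ?leUr //= andbT.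
by rewrite mul_le_ladj leUx -!mul_le_ladj leUl leUr.
Qed.

Lemma le_ladj1 x y : (ladj x * y <= 1) = (y <= x).
Proof. by rewrite -le_mul_ladj lp_mulg1. Qed.

End Residuation.

(** Locked, lest the unifier unfold powers when it looks for a product. *)
HB.lock Definition pw d (A : lpregroupType d) (x : A) i :=
  iter i (fun y => x * y) 1.

Section Units.
Variables (d : Order.disp_t) (A : lpregroupType d).
Implicit Types x y z g h : A.

(** Then ladj g is a two-sided inverse of g; conversely an inverse is both
    adjoints. *)
Definition lp_unit g := ladj g = radj g.

(** On maps of the integers this is conjugation by the shift q |-> q + 1. *)
Definition ll x := ladj (ladj x).

Lemma llU : {morph ll : x y / x `|` y}.
Proof. by move=> x y; rewrite /ll ladjU ladjI. Qed.
Lemma le_ll x y : x <= y -> ll x <= ll y.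
Proof. by move=> xy; do 2!apply: le_ladj. Qed.

Lemma unit_ll g : lp_unit g <-> ll g = g.
Proof.
split=> [gu|h]; first by rewrite /ll gu radjK.
by rewrite /lp_unit -{2}h /ll ladjK.
Qed.

Lemma unit1 : lp_unit 1.
Proof. by rewrite /lp_unit ladj1 radj1. Qed.

Lemma unitM g h : lp_unit g -> lp_unit h -> lp_unit (g * h).
Proof. by rewrite /lp_unit ladjM radjM => -> ->. Qed.

Lemma unitI g h : lp_unit g -> lp_unit h -> lp_unit (g `&` h).
Proof. by rewrite /lp_unit ladjI radjI => -> ->. Qed.

Lemma unitU g h : lp_unit g -> lp_unit h -> lp_unit (g `|` h).
Proof. by rewrite /lp_unit ladjU radjU => -> ->. Qed.

Lemma unit_ladj g : lp_unit g -> lp_unit (ladj g).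
Proof. by rewrite /lp_unit => gu; rewrite ladjK gu radjK. Qed.

Lemma unit_mulgV g : lp_unit g -> g * ladj g = 1.
Proof.
move=> gu; apply: le_anti; rewrite mulg_ladj_ge1 andbT gu.
exact: mulg_radj_le1.
Qed.

Lemma unit_mulVg g : lp_unit g -> ladj g * g = 1.
Proof.
move=> gu; apply: le_anti; rewrite ladj_mulg_le1 {1}gu.
exact: radj_mulg_ge1.
Qed.

Lemma unit_mulgK g x : lp_unit g -> x * g * ladj g = x.
Proof. by move=> gu; rewrite -lp_mulgA unit_mulgV ?lp_mulg1. Qed.

Lemma unit_mulgKV g x : lp_unit g -> x * ladj g * g = x.
Proof. by move=> gu; rewrite -lp_mulgA unit_mulVg ?lp_mulg1. Qed.

Lemma unit_mulKg g x : lp_unit g -> ladj g * (g * x) = x.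
Proof. by move=> gu; rewrite lp_mulgA unit_mulVg ?lp_mul1g. Qed.

Lemma unit_le2l g x y : lp_unit g -> (g * x <= g * y) = (x <= y).
Proof.
move=> gu; apply/idP/idP => h; last exact: le_mulg.
by rewrite -[x](unit_mulKg _ gu) -[y](unit_mulKg _ gu) le_mulg.
Qed.

Lemma unit_le2r g x y : lp_unit g -> (x * g <= y * g) = (x <= y).
Proof.
move=> gu; apply/idP/idP => h; last exact: le_mulg.
by rewrite -[x](unit_mulgK _ gu) -[y](unit_mulgK _ gu) le_mulg.
Qed.

Lemma unit_mulV_le1 g x : lp_unit g -> (x * ladj g <= 1) = (x <= g).
Proof.
by move=> gu; rewrite -(unit_le2r x g (unit_ladj gu)) unit_mulgV.
Qed.

Lemma pw0 x : pw x 0 = 1. Proof. by rewrite unlock. Qed.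
Lemma pwS x i : pw x i.+1 = x * pw x i. Proof. by rewrite unlock. Qed.
Lemma pw1 x : pw x 1 = x. Proof. by rewrite pwS pw0 lp_mulg1. Qed.

Lemma pwD x i j : pw x (i + j) = pw x i * pw x j.
Proof. by elim: i => [|i IH]; rewrite ?pw0 ?lp_mul1g // addSn !pwS IH lp_mulgA. Qed.

Lemma pwSr x i : pw x i.+1 = pw x i * x.
Proof. by rewrite -addn1 pwD pw1. Qed.

Lemma pwM x i j : pw x (i * j) = pw (pw x i) j.
Proof. by elim: j => [|j IH]; rewrite ?muln0 ?pw0 // mulnS pwD pwS IH. Qed.

Lemma pw_comm x y i : x * y = y * x -> pw x i * y = y * pw x i.
Proof.
move=> c; elim: i => [|i IH]; first by rewrite pw0 lp_mul1g lp_mulg1.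
by rewrite pwS -lp_mulgA IH !lp_mulgA c.
Qed.

Lemma unit_pw x i : lp_unit x -> lp_unit (pw x i).
Proof. by move=> xu; elim: i => [|i IH]; rewrite ?pw0 ?pwS; [exact: unit1 | exact: unitM]. Qed.

Lemma pw_ge1 x i : 1 <= x -> 1 <= pw x i.
Proof.
by move=> x1; elim: i => [|i IH]; rewrite ?pw0 ?pwS // -[1]lp_mul1g le_mulg.
Qed.

Lemma le_pw x i j : 1 <= x -> (i <= j)%N -> pw x i <= pw x j.
Proof.
move=> x1 /subnK <-; rewrite pwD -{1}[pw x i]lp_mul1g le_mulg //.
exact: pw_ge1.
Qed.

(** The join of the iterates ll^j x for j <= m: if ll^n is the identity, then
    hull n x is the least unit above x. *)
Fixpoint hull m x := if m is m'.+1 then hull m' x `|` ll (hull m' x) else x.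

Lemma hull_ge m x : x <= hull m x.
Proof. by elim: m => //= m IH; rewrite lexU2 // IH. Qed.

Lemma hull_mono m x y : x <= y -> hull m x <= hull m y.
Proof. by move=> xy; elim: m => //= m IH; rewrite leU2 // le_ll. Qed.

Lemma hull_ll m x : hull m (ll x) = ll (hull m x).
Proof. by elim: m => //= m ->; rewrite llU. Qed.

Lemma hull_lub m x y : (forall j, (j <= m)%N -> iter j ll x <= y) -> hull m x <= y.
Proof.
elim: m x => [|m IH] x h /=; first exact: (h 0%N).
rewrite leUx IH => [|j jm]; last by apply: h; apply: leqW.
rewrite -hull_ll IH // => j jm.
by rewrite -iterSr; apply: h.
Qed.

Lemma hull_orbit m x j : (j <= m)%N -> iter j ll x <= hull m x.
Proof.
elim: m j => [|m IH] j; first by rewrite leqn0 => /eqP->.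
rewrite leq_eqVlt ltnS => /orP[/eqP->|jm] /=.
  by rewrite lexU2 // le_ll ?IH ?orbT.
by rewrite lexU2 // IH.
Qed.

Lemma hull_le_unit m x g : lp_unit g -> x <= g -> hull m x <= g.
Proof.
move=> gu xg; elim: m => //= m IH; rewrite leUx IH /=.
by rewrite -[g](unit_ll g).1 // le_ll.
Qed.

Lemma hull_unitE m g : lp_unit g -> hull m g = g.
Proof. by move=> gu; apply: le_anti; rewrite hull_ge hull_le_unit. Qed.

End Units.

Arguments lp_unit {d A} g.
Arguments ll {d A} x : simpl never.

Section Periodic.
Variables (n : nat) (n_gt0 : (0 < n)%N).
Variables (d : Order.disp_t) (A : lpregroupType d).
Hypothesis per : forall x : A, iter n ll x = x.
Implicit Types x y z g h : A.

(** Applying ll only permutes the orbit of x, so it fixes its join. *)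
Lemma unit_hull x : lp_unit (hull n x).
Proof.
have step y : hull n (ll y) <= hull n y.
  apply: hull_lub => j; rewrite leq_eqVlt -iterSr => /orP[/eqP->|].
    by rewrite iterS per; apply: (@hull_orbit _ _ n y 1).
  exact: hull_orbit.
apply/unit_ll; apply: le_anti; rewrite -hull_ll step /=.
have down m y : hull n (iter m ll y) <= hull n y.
  by elim: m => //= m; apply: le_trans (step _).
have e : iter n ll x = iter n.-1 ll (ll x) by rewrite -iterSr prednK.
by rewrite -{1}[x]per e; apply: down.
Qed.

Lemma hull_leE x g : lp_unit g -> (hull n x <= g) = (x <= g).
Proof.
move=> gu; apply/idP/idP; last exact: hull_le_unit.
by apply: le_trans; apply: hull_ge.
Qed.

End Periodic.

(** * Periodic maps of the integers *)

Section FZFacts.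
Implicit Types (f g : FZ) (p q : int).

(** q <= f^l p fails exactly for the p up to f (q - 1), so f (q - 1) + 1 is the
    least p for which it holds. *)
Lemma FZ_ll f q : ll f q = (f (q - 1) + 1)%R.
Proof.
have L (g : FZ) p r : (FZ_ladj g r <= p) = (r <= g p) by apply: FZ_ladjP.
apply: le_anti; apply/andP; split.
- rewrite (L (FZ_ladj f)) leNgt; apply/negP => h.
  have : FZ_ladj f (f (q - 1) + 1)%R <= (q - 1)%R by lia.
  by rewrite L; lia.
- have h : q <= FZ_ladj f (ll f q) by rewrite -L.
  rewrite leNgt; apply/negP => h2.
  have : FZ_ladj f (ll f q) <= (q - 1)%R by rewrite L; lia.
  by lia.
Qed.

Lemma FZ_iter_ll m f q : iter m ll f q = (f (q - m%:Z) + m%:Z)%R.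
Proof.
elim: m q => [|m IH] q; first by rewrite subr0 addr0.
rewrite iterS FZ_ll IH; have -> : (q - 1 - m%:Z)%R = (q - m.+1%:Z)%R by lia.
by lia.
Qed.

Lemma iter_lr_ll d (B : lpregroupType d) m (x : B) :
  (iter m (@ladj d B) x = iter m (@radj d B) x) <-> iter m ll x = x.
Proof.
have e : iter m ll x = iter m (@ladj d B) (iter m (@ladj d B) x).
  elim: m => //= m IH; rewrite IH /ll.
  by rewrite -iterSr.
have k y : iter m (@ladj d B) (iter m (@radj d B) y) = y.
  by elim: m y {e} => // m IH y; rewrite iterSr [iter _ (@radj _ _) _]iterS radjK.
have k' y : iter m (@radj d B) (iter m (@ladj d B) y) = y.
  by elim: m y {e k} => // m IH y; rewrite iterSr [iter _ (@ladj _ _) _]iterS ladjK.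
by rewrite e; split=> [->//|h]; rewrite -[LHS]k' h.
Qed.

Lemma FZ_periodicP n f :
  (f \in @periodic _ FZ n) <-> forall q, f (q + n%:Z)%R = (f q + n%:Z)%R.
Proof.
split=> [/eqP/iter_lr_ll h q|h].
  by rewrite -{1}h FZ_iter_ll; have -> : (q + n%:Z - n%:Z)%R = q by lia.
apply/eqP/iter_lr_ll/FZ_ext => q; rewrite FZ_iter_ll -h.
by congr (f _); lia.
Qed.

End FZFacts.

Section IntFunctions.

Lemma per_mul (h : int -> int) (k : int) :
  (forall q, h (q + k)%R = (h q + k)%R) ->
  forall (m q : int), h (q + m * k)%R = (h q + m * k)%R.
Proof.
move=> hk.
have nat_case (i : nat) r : h (r + i%:Z * k)%R = (h r + i%:Z * k)%R.
  elim: i r => [|i IH] r; first by rewrite mul0r !addr0.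
  have -> : (r + i.+1%:Z * k = (r + i%:Z * k) + k)%R by lia.
  by rewrite hk IH; lia.
move=> m q; case: (leP 0%R m) => m0.
  by rewrite (_ : m = (`|m|%N)%:Z)%R ?nat_case; lia.
have := nat_case `|m|%N (q + m * k)%R.
have -> : (q + m * k + `|m|%N%:Z * k)%R = q by nia.
by nia.
Qed.

Lemma int_ceil (k : nat) (p q : int) : (0 < k)%N ->
  exists m : int, (p + (m - 1) * k%:Z < q)%R /\ (q <= p + m * k%:Z)%R.
Proof.
move=> k0; exists (((q - p - 1)%R %/ k%:Z)%Z + 1)%R.
have := divz_eq (q - p - 1)%R (k%:Z)%R.
have k0' : (k%:Z != 0)%R by lia.
have := modz_ge0 (q - p - 1)%R k0'.
have k0'' : (0 < k%:Z)%R by lia.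
have := ltz_pmod (q - p - 1)%R k0''.
by move: (_ %/ _)%Z (_ %% _)%Z => a b; lia.
Qed.

Lemma int_floor (k : nat) (p q : int) : (0 < k)%N ->
  exists m : int, (p + m * k%:Z <= q)%R /\ (q < p + (m + 1) * k%:Z)%R.
Proof.
move=> k0; have [m [h1 h2]] := @int_ceil k p (q + 1)%R k0; exists (m - 1)%R; lia.
Qed.

End IntFunctions.

Section FnFacts.
Variable n : nat.
Implicit Types (f g : FnZ n) (p q : int).

Definition app f q : int := FZ_fun (periodic_val f) q.

Lemma app_ext f g : app f =1 app g -> f = g.
Proof. by move=> h; apply: val_inj; apply: FZ_ext. Qed.

Lemma app_leP f g : reflect (forall q, app f q <= app g q) (f <= g).
Proof. exact: FZ_leP. Qed.

Lemma appM f g q : app (f * g) q = app f (app g q). Proof. by []. Qed.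
Lemma app1 q : app 1 q = q. Proof. by []. Qed.
Lemma appI f g q : app (f `&` g) q = app f q `&` app g q. Proof. by []. Qed.
Lemma appU f g q : app (f `|` g) q = app f q `|` app g q. Proof. by []. Qed.

Lemma app_mono f p q : p <= q -> app f p <= app f q.
Proof. exact: FZ_homo. Qed.

Lemma app_per f q : app f (q + n%:Z)%R = (app f q + n%:Z)%R.
Proof. exact: (FZ_periodicP n _).1 (valP f) q. Qed.

Lemma app_ladjP f p q : (app (ladj f) q <= p) = (q <= app f p).
Proof. exact: FZ_ladjP. Qed.

Lemma app_radjP f p q : (p <= app (radj f) q) = (app f p <= q).
Proof. exact: FZ_radjP. Qed.

Lemma app_ll f q : app (ll f) q = (app f (q - 1) + 1)%R.
Proof. exact: FZ_ll. Qed.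

Lemma app_perM f q (m : int) : app f (q + m * n%:Z)%R = (app f q + m * n%:Z)%R.
Proof. exact: per_mul (app_per f) m q. Qed.

(** A monotone n-periodic map is unbounded in both directions, so its fibres are
    finite. *)
Lemma Fn_ex (h : int -> int) : (0 < n)%N -> {homo h : p q / p <= q} ->
  (forall q, h (q + n%:Z)%R = (h q + n%:Z)%R) -> exists f, app f =1 h.
Proof.
move=> n_gt0 hh hp.
have hM := per_mul hp.
have above (q : int) : exists p, q <= h p.
  have [k qk] : exists k : nat, q <= (h q + k%:Z)%R by exists `|(q - h q)%R|%N; lia.
  by exists (q + k%:Z * n%:Z)%R; rewrite hM; have := leq_pmulr k n_gt0; lia.
have below (q : int) : exists p, h p <= q.
  have [k qk] : exists k : nat, (h q - k%:Z)%R <= q by exists `|(q - h q)%R|%N; lia.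
  by exists (q + (- k%:Z) * n%:Z)%R; rewrite hM; have := leq_pmulr k n_gt0; lia.
have fin := unbounded_fin hh above below.
pose F := MkFZ hh fin.
have Fp : F \in @periodic _ FZ n by apply/FZ_periodicP.
by exists (PeriodicSub Fp).
Qed.

Fact tr_homo (j : int) : {homo (fun q : int => (q + j)%R) : p q / p <= q}.
Proof. by move=> p q; lia. Qed.

Fact tr_fin (j q : int) :
  finite_set ((fun q : int => (q + j)%R) @^-1` [set q])%classic.
Proof.
apply: (unbounded_fin (tr_homo j)) => r; exists (r - j)%R; lia.
Qed.

Fact tr_per (j : int) : MkFZ (tr_homo j) (@tr_fin j) \in @periodic _ FZ n.
Proof. by apply/FZ_periodicP => q /=; lia. Qed.

Definition tr (j : int) : FnZ n := PeriodicSub (tr_per j).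

Lemma app_tr j q : app (tr j) q = (q + j)%R. Proof. by []. Qed.

Lemma tr0 : tr 0 = 1.
Proof. by apply: app_ext => q; rewrite app_tr app1 addr0. Qed.

Lemma trM i j : tr i * tr j = tr (i + j).
Proof. by apply: app_ext => q; rewrite appM !app_tr; lia. Qed.

Lemma tr_le i j : (tr i <= tr j) = (i <= j).
Proof.
apply/app_leP/idP => [/(_ 0%R)|ij q]; rewrite !app_tr; lia.
Qed.

Lemma tr_unit j : lp_unit (tr j).
Proof. by apply/unit_ll/app_ext => q; rewrite app_ll !app_tr; lia. Qed.

Lemma unit_tr f : lp_unit f -> exists j, f = tr j.
Proof.
move=> /unit_ll fu.
have s q : app f q = (app f (q - 1) + 1)%R by rewrite -{1}fu app_ll.
exists (app f 0%R); apply: app_ext => q; rewrite app_tr.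
have up (k : nat) : app f (k%:Z)%R = (app f 0 + k%:Z)%R.
  elim: k => [|k IH]; first by rewrite addr0.
  by rewrite s (_ : (k.+1%:Z - 1 = k%:Z)%R) ?IH; lia.
have down (k : nat) : app f (- k%:Z)%R = (app f 0 - k%:Z)%R.
  elim: k => [|k IH]; first by rewrite subr0.
  by have := s (- k%:Z)%R; rewrite IH (_ : (- k%:Z - 1)%R = (- k.+1%:Z)%R); lia.
case: (leP 0%R q) => q0.
  by have := up `|q|%N; rewrite (_ : `|q|%N%:Z = q)%R; lia.
by have := down `|q|%N; rewrite (_ : - `|q|%N%:Z = q)%R; lia.
Qed.

Lemma ladj_tr j : ladj (tr j) = tr (- j).
Proof.
apply/esym/ladj_uniq; rewrite trM -tr0 tr_le; lia.
Qed.

Lemma pw_tr j i : pw (tr j) i = tr (j * i%:Z).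
Proof.
elim: i => [|i IH]; first by rewrite pw0 mulr0 tr0.
by rewrite pwS IH trM; congr tr; lia.
Qed.

Lemma app_mul_tr f j q : app (f * tr j) q = app f (q + j)%R.
Proof. by rewrite appM app_tr. Qed.

Lemma app_tr_mul f j q : app (tr j * f) q = (app f q + j)%R.
Proof. by rewrite appM app_tr. Qed.

Lemma Fn_period f : iter n ll f = f.
Proof.
have h m (x : FnZ n) q : app (iter m ll x) q = (app x (q - m%:Z) + m%:Z)%R.
  elim: m q => [|m IH] q; first by rewrite subr0 addr0.
  rewrite iterS app_ll IH; have -> : (q - 1 - m%:Z)%R = (q - m.+1%:Z)%R by lia.
  by lia.
by apply: app_ext => q; rewrite h -app_per; congr app; lia.
Qed.

Lemma Fn_tr1_conj f : tr 1 * f = ll f * tr 1.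
Proof.
by apply: app_ext => q; rewrite app_tr_mul app_mul_tr app_ll addrK.
Qed.

Hypothesis n_gt0 : (0 < n)%N.

Lemma Fn_hullP f : exists j, [/\ hull n f = tr j,
   (forall q, app f q <= (q + j)%R) & exists q, app f q = (q + j)%R].
Proof.
have [j hj] := unit_tr (unit_hull n_gt0 Fn_period f).
have le q : app f q <= (q + j)%R.
  by have /app_leP/(_ q) := hull_ge n f; rewrite hj app_tr.
exists j; split=> //; apply/not_existsP => no.
have : f <= tr (j - 1).
  apply/app_leP => q; rewrite app_tr; have := le q; have := no q; lia.
by rewrite -(hull_leE n f (tr_unit _)) hj tr_le; lia.
Qed.

Lemma Fn_hull_le f j : (hull n f <= tr j) <-> (forall q, app f q <= (q + j)%R).
Proof.
rewrite (hull_leE n f (tr_unit j)); split=> [/app_leP h q|h].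
  by have := h q; rewrite app_tr.
by apply/app_leP => q; rewrite app_tr.
Qed.

Lemma Fn_le_hull f j : (tr j <= hull n f) <-> (exists q, (q + j)%R <= app f q).
Proof.
have [k [-> le [q eq]]] := Fn_hullP f; rewrite tr_le; split=> [jk|[r]].
  by exists q; rewrite eq; lia.
by have := le r; lia.
Qed.

(** The value of the meet at q + 1 is either that of f at q + 1, which is at
    least f q, or f q + 1; so the displacement of f at q exceeds that of the
    meet at q + 1 by at most 1. *)
Lemma Fn_hull_meet f : hull n f <= hull n (f `&` ll f) * tr 1.
Proof.
have [j [-> le _]] := Fn_hullP (f `&` ll f).
rewrite trM; apply/Fn_hull_le => q.
have := le (q + 1)%R; rewrite appI app_ll (_ : (q + 1 - 1)%R = q); last lia.
have := @app_mono f q (q + 1)%R; rewrite leIx; lia.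
Qed.

End FnFacts.

(** * Finitely subdirectly irreducible algebras *)

HB.instance Definition _ := gen_eqMixin lterm.

Definition tll t := LLadj (LLadj t).
Fixpoint thull m t := if m is m'.+1 then LJoin (thull m' t) (tll (thull m' t)) else t.
Definition tpw t i := iter i (LMul t) LOne.

(** Encodes the equality of two terms as the triviality of a unit above 1.  In
    this way joins of units express conjunctions of equalities and, when units
    form a chain, meets express disjunctions, so that an implication between
    equalities can be turned into one equation. *)
Definition tdist n (e : lterm * lterm) :=
  LJoin (LJoin (thull n (LMul (LLadj e.1) e.2)) (thull n (LMul (LLadj e.2) e.1))) LOne.
Definition tjoin n (P : seq (lterm * lterm)) :=
  foldr (fun e t => LJoin (tdist n e) t) LOne P.
Definition tmeet n e0 (Q : seq (lterm * lterm)) :=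
  foldr (fun e t => LMeet (tdist n e) t) (tdist n e0) Q.

Arguments leval : simpl never.

Section Terms.
Variables (d : Order.disp_t) (A : lpregroupType d) (v : nat -> A).

Lemma leval_var i : leval v (LVar i) = v i. Proof. by []. Qed.
Lemma leval_one : leval v LOne = 1. Proof. by []. Qed.
Lemma leval_meet t u : leval v (LMeet t u) = leval v t `&` leval v u.
Proof. by []. Qed.
Lemma leval_join t u : leval v (LJoin t u) = leval v t `|` leval v u.
Proof. by []. Qed.
Lemma leval_mul t u : leval v (LMul t u) = leval v t * leval v u.
Proof. by []. Qed.
Lemma leval_ladj t : leval v (LLadj t) = ladj (leval v t). Proof. by []. Qed.
Lemma leval_radj t : leval v (LRadj t) = radj (leval v t). Proof. by []. Qed.

Lemma leval_ll t : leval v (tll t) = ll (leval v t). Proof. by []. Qed.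

Lemma leval_hull m t : leval v (thull m t) = hull m (leval v t).
Proof. by elim: m => //= m <-. Qed.

Lemma leval_pw t i : leval v (tpw t i) = pw (leval v t) i.
Proof. by elim: i => [|i IH]; rewrite ?pw0 ?pwS //= leval_mul IH. Qed.

Lemma leval_iter_ll m t : leval v (iter m tll t) = iter m ll (leval v t).
Proof. by elim: m => //= m <-. Qed.

Definition levalE := (leval_var, leval_one, leval_meet, leval_join, leval_mul,
  leval_ladj, leval_radj, leval_ll, leval_hull, leval_pw, leval_iter_ll).

Variables (n : nat) (n_gt0 : (0 < n)%N).
Hypothesis per : forall x : A, iter n ll x = x.
Implicit Types (e : lterm * lterm) (P Q : seq (lterm * lterm)).

Definition eq_at e := leval v e.1 = leval v e.2.

Lemma dist_unit e : lp_unit (leval v (tdist n e)) /\ 1 <= leval v (tdist n e).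
Proof.
rewrite /tdist !levalE; split; last by rewrite leUr.
by do !apply: unitU; try exact: unit_hull; apply: unit1.
Qed.

Lemma dist_eq1 e : leval v (tdist n e) = 1 <-> eq_at e.
Proof.
have -> : leval v (tdist n e) = 1 <-> leval v (tdist n e) <= 1.
  split=> [->//|h]; apply: le_anti; rewrite h.
  by have [_ ->] := dist_unit e.
rewrite /tdist !levalE !leUx lexx andbT !(hull_leE _ _ (@unit1 d A)) !le_ladj1.
by rewrite /eq_at; split=> [h|->]; [apply: le_anti; rewrite andbC | rewrite lexx].
Qed.

Lemma tjoin_unit P : lp_unit (leval v (tjoin n P)) /\ 1 <= leval v (tjoin n P).
Proof.
elim: P => [|e P [IH1 IH2]]; first by split=> //; apply: unit1.
split; last by rewrite lexU2 ?IH2 ?orbT.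
by apply: unitU => //; case: (dist_unit e).
Qed.

Lemma tjoin_eq1 P : leval v (tjoin n P) = 1 <-> (forall e, e \in P -> eq_at e).
Proof.
elim: P => [|e P IH]; first by split.
rewrite -[leval v (tjoin n (e :: P))]/(leval v (tdist n e) `|` leval v (tjoin n P)).
have [_ d1] := dist_unit e; have [_ t1] := tjoin_unit P.
split=> [h e'|h].
  have e1 : leval v (tdist n e) = 1.
    by apply: le_anti; rewrite d1 -h leUl.
  have P1 : leval v (tjoin n P) = 1.
    by apply: le_anti; rewrite t1 -{1}h leUr.
  rewrite inE => /orP[/eqP->|]; first exact/dist_eq1.
  exact: IH.1.
have e1 : leval v (tdist n e) = 1 by apply/dist_eq1/h; rewrite inE eqxx.
have P1 : leval v (tjoin n P) = 1.
  by apply/IH => e' eP; apply: h; rewrite inE eP orbT.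
by rewrite e1 P1 joinxx.
Qed.

Lemma tmeet_unit e0 Q :
  lp_unit (leval v (tmeet n e0 Q)) /\ 1 <= leval v (tmeet n e0 Q).
Proof.
elim: Q => [|e P [IH1 IH2]]; first exact: dist_unit.
have [d1 d2] := dist_unit e.
by split; [apply: unitI | rewrite lexI IH2 andbT].
Qed.

Lemma tmeet_eq1 e0 Q e : e \in e0 :: Q -> eq_at e -> leval v (tmeet n e0 Q) = 1.
Proof.
move=> eQ /dist_eq1 e1; apply: le_anti; rewrite (tmeet_unit e0 Q).2 andbT -{}e1.
elim: Q eQ => [|e' Q IH]; first by rewrite inE => /eqP->; apply: lexx.
rewrite !inE; case/or3P => [ee0|/eqP->|eQ]; rewrite /= leval_meet.
- by rewrite leIx2 ?IH ?orbT // inE ee0.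
- exact: leIl.
- by rewrite leIx2 ?IH ?orbT // inE eQ orbT.
Qed.

Lemma tmeet_neq1 e0 Q :
  (forall g h : A, lp_unit g -> lp_unit h -> (g <= h) || (h <= g)) ->
  (forall e, e \in e0 :: Q -> ~ eq_at e) -> leval v (tmeet n e0 Q) <> 1.
Proof.
move=> tot; elim: Q => [|e Q IH] h; first by rewrite dist_eq1; apply: h; rewrite inE.
rewrite -[leval v _]/(leval v (tdist n e) `&` leval v (tmeet n e0 Q)).
have [d1 _] := dist_unit e; have [t1 _] := tmeet_unit e0 Q.
case/orP: (tot _ _ d1 t1) => [/meet_idPl->|/meet_idPr->].
  by rewrite dist_eq1; apply: h; rewrite !inE eqxx orbT.
apply: IH => e' e'Q; apply: h; move: e'Q; rewrite !inE.
by case/orP => ->; rewrite ?orbT.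
Qed.

End Terms.

Section Variety.
Variables (n : nat) (n_gt0 : (0 < n)%N).
Variables (d : Order.disp_t) (A : lpregroupType d).
Hypothesis var : in_variety_of A (FnZ n).
Implicit Types (x y z g h : A) (t u : lterm).

Lemma variety_eq t u : (forall v : nat -> FnZ n, leval v t = leval v u) ->
  forall v : nat -> A, leval v t = leval v u.
Proof.
move=> tu v; have sat : satisfies (FnZ n) [set (t, u)]%classic.
  by move=> e -> w; apply: tu.
exact: (var sat (e := (t, u)) erefl v).
Qed.

Lemma variety_period x : iter n ll x = x.
Proof.
have := @variety_eq (iter n tll (LVar 0)) (LVar 0) _ (fun _ => x).
by rewrite leval_iter_ll leval_var; apply=> v; rewrite leval_iter_ll Fn_period.
Qed.

Let per := variety_period.

Lemma variety_unit_pw_central g y : lp_unit g -> pw g n * y = y * pw g n.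
Proof.
move=> gu.
have := @variety_eq (LMul (tpw (thull n (LVar 0)) n) (LVar 1))
                    (LMul (LVar 1) (tpw (thull n (LVar 0)) n))
                    _ (fun i => if i is 0 then g else y).
rewrite !levalE !hull_unitE //; apply=> v; rewrite !levalE.
have [i ->] := unit_tr (unit_hull n_gt0 (@Fn_period n) (v 0%N)).
by apply: app_ext => q; rewrite pw_tr app_tr_mul app_mul_tr app_perM.
Qed.

(** Since a, b, c >= 1, the products a a, a c and b a lie above a, so the meet on
    the right lies below (a /\ b) (a /\ c) = 1. *)
Lemma meet_mul1 (a b c : A) : a `&` b = 1 -> a `&` c = 1 -> a `&` (b * c) = 1.
Proof.
move=> ab ac.
have a1 : 1 <= a by rewrite -ab leIl.
have b1 : 1 <= b by rewrite -ab leIr.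
have c1 : 1 <= c by rewrite -ac leIr.
apply: le_anti; rewrite lexI a1 -{2}[1]lp_mul1g le_mulg ?andbT //.
apply: (@le_trans _ _ ((a `&` b) * (a `&` c))); last by rewrite ab ac lp_mul1g.
have aa x : 1 <= x -> a <= a * x.
  by move=> x1; rewrite -{1}[a]lp_mulg1 le_mulg.
have le_a y : a <= y -> a `&` (b * c) <= y by apply: le_trans; apply: leIl.
rewrite lp_mulIg !lp_mulgI !lexI leIr andbT.
apply/andP; split; last by apply: le_a; rewrite -{1}[a]lp_mul1g le_mulg.
by apply/andP; split; apply/le_a/aa.
Qed.

Lemma meet_pw1 (a b : A) i j : a `&` b = 1 -> pw a i `&` pw b j = 1.
Proof.
have one (x y : A) m : x `&` y = 1 -> x `&` pw y m = 1.
  move=> xy; elim: m => [|m IH]; last by rewrite pwS; apply: meet_mul1.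
  by rewrite pw0 -xy meetA meetxx.
by move=> ab; apply: (one (pw a i) b); rewrite meetC; apply: (one b a); rewrite meetC.
Qed.

Section Order.
Variable g : A.
Hypotheses (gu : lp_unit g) (g1 : 1 <= g).

(** The congruence generated by g = 1; it is compatible with the operations
    because g^n is central. *)
Definition unit_cong x y := exists m, x <= y * pw (pw g n) m /\ y <= x * pw (pw g n) m.

Let c_central m y : pw (pw g n) m * y = y * pw (pw g n) m.
Proof. by apply: pw_comm; apply: variety_unit_pw_central. Qed.

Let c_mono i j : (i <= j)%N -> pw (pw g n) i <= pw (pw g n) j.
Proof. by apply/le_pw/pw_ge1. Qed.

Let up x y i j : (i <= j)%N -> x <= y * pw (pw g n) i -> x <= y * pw (pw g n) j.
Proof. by move=> ij /le_trans; apply; apply: le_mulg => //; apply: c_mono. Qed.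

Lemma unit_cong_congruence : congruence unit_cong.
Proof.
have adj x y m : x <= y * pw (pw g n) m -> ladj y <= ladj x * pw (pw g n) m.
  move/le_ladj; rewrite ladjM => h.
  rewrite -c_central le_mul_ladj.
  exact: h.
have adr x y m : x <= y * pw (pw g n) m -> radj y <= radj x * pw (pw g n) m.
  move/le_radj; rewrite radjM => h.
  have cu : lp_unit (pw (pw g n) m) by do 2!apply: unit_pw.
  by rewrite -c_central le_mul_ladj cu.
split; split.
- by move=> x; exists 0%N; rewrite pw0 lp_mulg1.
- by move=> x y [m [? ?]]; exists m.
- move=> x y z [i [xy yx]] [j [yz zy]]; exists (i + j)%N.
  split.
    rewrite addnC pwD lp_mulgA; apply: le_trans xy _; exact: le_mulg.
  by rewrite pwD lp_mulgA; apply: le_trans zy _; apply: le_mulg.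
- move=> x x' y y' [i [h1 h2]] [j [h3 h4]]; exists (maxn i j).
  by split; rewrite lp_mulIg; apply: leI2;
    first [exact: (up (leq_maxl i j)) | exact: (up (leq_maxr i j))].
- move=> x x' y y' [i [h1 h2]] [j [h3 h4]]; exists (maxn i j).
  by split; rewrite lp_mulUg; apply: leU2;
    first [exact: (up (leq_maxl i j)) | exact: (up (leq_maxr i j))].
- move=> x x' y y' [i [h1 h2]] [j [h3 h4]]; exists (i + j)%N.
  have swap a b : a * b * pw (pw g n) (i + j) =
                  a * pw (pw g n) i * (b * pw (pw g n) j).
    by rewrite pwD !lp_mulgA -[a * pw _ i * b]lp_mulgA c_central lp_mulgA.
  by rewrite !swap; split; apply: le_mulg.
- by move=> x y [m [? ?]]; exists m; split; apply: adj.
- by move=> x y [m [? ?]]; exists m; split; apply: adr.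
Qed.

End Order.

Hypothesis fsi : finitely_subdirectly_irreducible A.

(** The congruences generated by g = 1 and h = 1 intersect trivially: two
    related elements differ at most by a factor below powers of g and of h,
    whose meet is 1. *)
Lemma fsi_meet1 g h : lp_unit g -> lp_unit h -> g `&` h = 1 -> g = 1 \/ h = 1.
Proof.
move=> gu hu gh.
have g1 : 1 <= g by rewrite -gh leIl.
have h1 : 1 <= h by rewrite -gh leIr.
have rel k : lp_unit k -> 1 <= k -> unit_cong k = eq -> k = 1.
  move=> ku k1 e; have : unit_cong k k 1; last by rewrite e.
  exists 1%N; rewrite pw1 lp_mul1g; split.
    rewrite -{1}[k]pw1; exact: le_pw.
  by rewrite -{1}[1]lp_mul1g le_mulg ?pw_ge1.
have [|E|E] := fsi (unit_cong_congruence gu g1) (unit_cong_congruence hu h1).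
- apply/funext => x; apply/funext => y; apply/propext; split=> [|<-]; last first.
    by split; exists 0%N; rewrite pw0 lp_mulg1.
  case=> -[i [xy yx]] [j [xy' yx']].
  have e := meet_pw1 i j (meet_pw1 n n gh).
  by apply: le_anti; rewrite -[y in X in X && _]lp_mulg1 -[x in X in _ && X]lp_mulg1
    -e !lp_mulgI !lexI xy yx xy' yx'.
- by left; apply: rel.
- by right; apply: rel.
Qed.

Lemma fsi_total g h : lp_unit g -> lp_unit h -> (g <= h) || (h <= g).
Proof.
move=> gu hu; pose k := ladj (g `&` h).
have ku : lp_unit k by apply/unit_ladj/unitI.
have e : k * g `&` k * h = 1 by rewrite -lp_mulgI unit_mulVg //; apply: unitI.
have [E|E] := fsi_meet1 (unitM ku gu) (unitM ku hu) e.
- by rewrite -(unit_le2l g h ku) E -e leIr.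
- by rewrite -(unit_le2l h g ku) E -{1}e leIl orbT.
Qed.

End Variety.

(** * Local embeddings in F_n(Z) *)

(** A map that behaves on the finite set X like an embedding sending s to the
    shift; the values of operations on X need not belong to X. *)
Record partial_hom n d (A : lpregroupType d) (s : A) (X : seq A) (N : nat)
    (f : A -> FnZ n) : Prop := PartialHom {
  ph_le : {in X &, forall x y, (f x <= f y) = (x <= y)};
  ph_mul : {in X &, {morph f : x y / x * y}};
  ph_meet : {in X &, {morph f : x y / x `&` y}};
  ph_join : {in X &, {morph f : x y / x `|` y}};
  ph_ladj : {in X, {morph f : x / ladj x}};
  ph_radj : {in X, {morph f : x / radj x}};
  ph_hull : {in X, {morph f : x / hull n x}};
  ph_pw : {in X, forall x i, (i <= N)%N -> f (pw x i) = pw (f x) i};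
  ph_1 : f 1 = 1;
  ph_shift : f s = tr n 1
}.

(** Universal statements with s as a constant pass from F_n(Z), where s is the
    shift, to such algebras. *)
Definition locally_periodic n d (A : lpregroupType d) (s : A) :=
  forall X N, exists f : A -> FnZ n, partial_hom s X N f.

Section Local.
Variables (n : nat) (n_gt0 : (0 < n)%N).
Variables (d : Order.disp_t) (A : lpregroupType d).
Hypothesis var : in_variety_of A (FnZ n).
Hypothesis fsi : finitely_subdirectly_irreducible A.

Let per := variety_period var.
Let tot := fsi_total n_gt0 var fsi.

(** In the sequence a, a \/ ll a, ... of the joins that define the hull, the
    element before the first unit has the dual property; its right adjoint is
    the required x. *)
Lemma proper_gap : lp_proper A ->
  exists x : A, ~ lp_unit x /\ lp_unit (x `&` ll x).
Proof.
move=> /existsNP[a an].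
have ex : exists i, `[< lp_unit (hull i a) >].
  by exists n; apply/asboolP/unit_hull.
case: (ex_minnP ex) => [[|i]] /asboolP hu hmin; first by case: an.
pose z := hull i a.
have zn : ~ lp_unit z by move=> zu; have := hmin i (asboolT zu); lia.
exists (radj z); split=> [ru|].
  by apply: zn; rewrite -[z]radjK; apply: unit_ladj.
have -> : radj z `&` ll (radj z) = radj (z `|` ll z).
  by rewrite radjU /ll radjK ladjK.
have h : hull i.+1 a = z `|` ll z by [].
by rewrite -h -hu; apply: unit_ladj.
Qed.

Section Gap.
Variables (v : nat -> A) (tx : lterm).
Let tc := LMeet tx (tll tx).
Let ts := LMul (thull n tx) (LLadj tc).
Hypotheses (xn : ~ lp_unit (leval v tx)) (cu : lp_unit (leval v tc)).

(** Let U be the hull of x, c the meet of x and ll x, P the equalities of L that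
    hold in A together with ll c = c, Q those that fail together with x = c, and
    let p and q be the join and the meet of their encodings as units.  In F_n(Z)
    we have U <= (hull c) * shift.  If p <> 1, then p >= shift and
    U <= (hull c) p.  If p = 1, then c is a unit and U is c, in which case x = c
    and q = 1, or c * shift, in which case ts is the shift and, were the
    conclusion false, again q = 1.  So (1 \/ U ((hull c) p)^l) /\ q = 1 would be
    an equation of F_n(Z); but in A we have p = 1, while neither factor is 1. *)
Lemma local_terms (L : seq (lterm * lterm)) :
  exists2 v' : nat -> FnZ n, leval v' ts = tr n 1 &
    forall e, e \in L -> (eq_at v e <-> eq_at v' e).
Proof.
apply: contrapT => no.
pose P := (tll tc, tc) :: [seq e <- L | `[< eq_at v e >]].
pose Q := [seq e <- L | ~~ `[< eq_at v e >]].
pose p := tjoin n P; pose q := tmeet n (tx, tc) Q.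
pose big := LJoin (LMul (thull n tx) (LLadj (LMul (thull n tc) p))) LOne.
have Fper := @Fn_period n.
have bigE d' (B : lpregroupType d') (w : nat -> B) : leval w big =
    hull n (leval w tx) * ladj (hull n (leval w tc) * leval w p) `|` 1.
  by rewrite leval_join leval_mul leval_ladj leval_mul !leval_hull leval_one.
have FnZ_eq (v' : nat -> FnZ n) : leval v' (LMeet big q) = leval v' LOne.
  have [pu p1] := tjoin_unit v' n_gt0 Fper P.
  have [qu q1] := tmeet_unit v' n_gt0 Fper (tx, tc) Q.
  have [j pj] := unit_tr pu.
  have big1 : 1 <= leval v' big by rewrite /big leval_join leUr.
  rewrite leval_meet leval_one; apply: le_anti; rewrite lexI big1 q1 !andbT.
  have gap : hull n (leval v' tx) <= hull n (leval v' tc) * tr n 1.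
    exact: Fn_hull_meet.
  have [E|pn1] := eqVneq (leval v' p) 1; last first.
    apply: leIx2; apply/orP; left.
    have Wu := unitM (unit_hull n_gt0 Fper (leval v' tc)) pu.
    rewrite bigE leUx lexx andbT (unit_mulV_le1 _ Wu).
    apply: le_trans gap _; rewrite le_mulg //.
    rewrite /p pj -tr0 in p1 pn1 *; move: p1; rewrite !tr_le.
    have : j <> 0%R by move=> e; move: pn1; rewrite e eqxx.
    lia.
  apply: leIx2; apply/orP; right.
  move/(tjoin_eq1 v' n_gt0 Fper): E => E.
  have cu' : lp_unit (leval v' tc).
    by apply/unit_ll; apply: (E (tll tc, tc)); rewrite inE eqxx.
  suff [e eQ ee] : exists2 e, e \in (tx, tc) :: Q & eq_at v' e.
    by rewrite /q (tmeet_eq1 n_gt0 Fper eQ ee).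
  apply: contrapT => noQ; apply: no; exists v'.
    have [i ci] := unit_tr cu'.
    have [k [hk _ _]] := Fn_hullP n_gt0 (leval v' tx).
    have -> : leval v' ts = hull n (leval v' tx) * ladj (leval v' tc).
      by rewrite leval_mul leval_ladj leval_hull.
    move: gap; rewrite ci (hull_unitE n (tr_unit n i)) hk.
    rewrite ladj_tr !trM tr_le => ki.
    have [ik|ik] : (k = i + 1)%R \/ k <= i by lia.
      by rewrite ik; congr tr; lia.
    case: noQ; exists (tx, tc); first by rewrite inE eqxx.
    rewrite /eq_at -[(tx, tc).1]/tx -[(tx, tc).2]/tc.
    apply: le_anti; apply/andP; split; last exact: leIl.
    rewrite ci.
    by apply: le_trans (hull_ge n _) _; rewrite hk tr_le.
  move=> e eL; split=> ee.
    by apply: E; rewrite inE mem_filter eL andbT; apply/orP; right; apply/asboolP.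
  apply: contrapT => en; apply: noQ; exists e => //.
  by rewrite inE mem_filter eL andbT; apply/orP; right; apply/asboolPn.
have := variety_eq var FnZ_eq v; rewrite leval_meet leval_one.
have p1 : leval v p = 1.
  apply/(tjoin_eq1 v n_gt0 per) => e; rewrite inE => /orP[/eqP->|].
    exact/unit_ll.
  by rewrite mem_filter => /andP[/asboolP].
have qn1 : leval v q <> 1.
  apply: (tmeet_neq1 n_gt0 per tot) => e; rewrite inE => /orP[/eqP->|].
    by rewrite /eq_at /= => e1; apply: xn; rewrite e1.
  by rewrite mem_filter => /andP[/asboolP].
have [qu q1] := tmeet_unit v n_gt0 per (tx, tc) Q.
have bu : lp_unit (leval v big).
  rewrite bigE; apply: unitU; last exact: unit1.
  apply: unitM; first exact: (unit_hull n_gt0 per).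
  apply: unit_ladj; apply: unitM; first exact: (unit_hull n_gt0 per).
  by case: (tjoin_unit v n_gt0 per P).
have bn1 : leval v big <> 1.
  rewrite bigE p1 lp_mulg1 (hull_unitE n cu) => h.
  have : hull n (leval v tx) * ladj (leval v tc) <= 1 by rewrite -h leUl.
  rewrite (unit_mulV_le1 _ cu) => h2; apply: xn.
  suff -> : leval v tx = leval v tc by [].
  apply: le_anti; rewrite (le_trans (hull_ge n _) h2) /=.
  exact: leIl.
by case/orP: (tot bu qu) => [/meet_idPl->|/meet_idPr->].
Qed.

End Gap.

Lemma proper_fsi_local : lp_proper A -> finitely_generated A ->
  exists s : A, locally_periodic n s.
Proof.
move=> /proper_gap[x [xn cu]] [gs gen].
pose v i := nth 1 gs i.
have tau a : {t : lterm | leval v t = a}.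
  apply/cid/(gen [set a | exists t, leval v t = a]%classic); last first.
    by move=> y ygs; exists (LVar (index y gs)); rewrite leval_var /v nth_index.
  split; first split.
  - by move=> _ _ [t <-] [u <-]; exists (LMeet t u).
  - by move=> _ _ [t <-] [u <-]; exists (LJoin t u).
  - by move=> _ _ [t <-] [u <-]; exists (LMul t u).
  - by exists LOne.
  - by split=> _ [t <-]; [exists (LLadj t) | exists (LRadj t)].
pose T a := sval (tau a); have TE a : leval v (T a) = a := svalP (tau a).
pose tx := T x.
pose ts := LMul (thull n tx) (LLadj (LMeet tx (tll tx))).
exists (leval v ts) => X N.
pose L2 y z := [:: (LMeet (T y) (T z), T y); (T (y * z), LMul (T y) (T z));
  (T (y `&` z), LMeet (T y) (T z)); (T (y `|` z), LJoin (T y) (T z))].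
pose L1 y := [:: (T (ladj y), LLadj (T y)), (T (radj y), LRadj (T y)),
  (T (hull n y), thull n (T y)) & [seq (T (pw y i), tpw (T y) i) | i <- iota 0 N.+1]].
pose L := [:: (T 1, LOne), (T (leval v ts), ts) &
  flatten [seq L2 y z | y <- X, z <- X] ++ flatten [seq L1 y | y <- X]].
have [||v' vs vL] := @local_terms v tx _ _ L; rewrite ?leval_meet ?leval_ll ?TE //.
have in2 y z e : y \in X -> z \in X -> e \in L2 y z -> e \in L.
  move=> yX zX eL; rewrite !inE mem_cat; apply/orP; right; apply/orP; right.
  by apply/orP; left; apply/flattenP; exists (L2 y z) => //; apply: allpairs_f.
have in1 y e : y \in X -> e \in L1 y -> e \in L.
  move=> yX eL; rewrite !inE mem_cat; apply/orP; right; apply/orP; right.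
  by apply/orP; right; apply/flattenP; exists (L1 y) => //; apply: map_f.
have vE t u : (t, u) \in L -> leval v t = leval v u -> leval v' t = leval v' u.
  by move=> /vL[h _]; apply: h.
exists (fun a => leval v' (T a)); split.
- move=> y z yX zX.
  have /vL h : (LMeet (T y) (T z), T y) \in L.
    by apply: (in2 y z) => //; rewrite inE eqxx.
  move: h; rewrite /eq_at /= !leval_meet !TE => h.
  by apply/idP/idP => /meet_idPl/h/meet_idPl.
- move=> y z yX zX; rewrite -leval_mul; apply: vE; last by rewrite leval_mul !TE.
  by apply: (in2 y z) => //; rewrite !inE eqxx ?orbT.
- move=> y z yX zX; rewrite -leval_meet; apply: vE; last by rewrite leval_meet !TE.
  by apply: (in2 y z) => //; rewrite !inE eqxx ?orbT.
- move=> y z yX zX; rewrite -leval_join; apply: vE; last by rewrite leval_join !TE.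
  by apply: (in2 y z) => //; rewrite !inE eqxx ?orbT.
- move=> y yX; rewrite -leval_ladj; apply: vE; last by rewrite leval_ladj !TE.
  by apply: (in1 y) => //; rewrite !inE eqxx ?orbT.
- move=> y yX; rewrite -leval_radj; apply: vE; last by rewrite leval_radj !TE.
  by apply: (in1 y) => //; rewrite !inE eqxx ?orbT.
- move=> y yX; rewrite -leval_hull; apply: vE; last by rewrite leval_hull !TE.
  by apply: (in1 y) => //; rewrite !inE eqxx ?orbT.
- move=> y yX i iN; rewrite -leval_pw; apply: vE; last by rewrite leval_pw !TE.
  apply: (in1 y) => //; rewrite /L1 3!in_cons; do 3!(apply/orP; right).
  by apply: (map_f (fun i => (T (pw y i), tpw (T y) i))); rewrite mem_iota.
- rewrite -(leval_one v'); apply: vE; last by rewrite TE.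
  by rewrite inE eqxx.
- rewrite -vs; apply: vE; last by rewrite TE.
  by rewrite !inE eqxx orbT.
Qed.

End Local.

(** * Rounding to a coset of kZ *)

Section FnCeil.
Variables (n : nat) (n_gt0 : (0 < n)%N).
Implicit Types (f g e : FnZ n) (p q x : int).

Lemma app_pw f i x : app (pw f i) x = iter i (app f) x.
Proof. by elim: i => [|i IH]; rewrite ?pw0 ?pwS //= appM IH. Qed.

(** An iterate that is not yet fixed moves up by at least 1, and no iterate of g
    passes a fixed point; as the fixed points are n-periodic, n iterations reach
    the least one above x. *)
Lemma Fn_fixpoint g x0 : (forall x, x <= app g x) -> app g x0 = x0 ->
  forall x, [/\ x <= app (pw g n) x, app g (app (pw g n) x) = app (pw g n) x,
    app (pw g n) x <= (x + n%:Z - 1)%R, app g x <= app (pw g n) x &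
    forall z, x <= z -> app g z = z -> app (pw g n) x <= z].
Proof.
move=> g1 gx0 x; rewrite app_pw.
have low i : app g x <= iter i.+1 (app g) x.
  by elim: i => //= i IH; apply: le_trans (g1 _).
have above z i : x <= z -> app g z = z -> iter i (app g) x <= z.
  by move=> xz gz; elim: i => //= i IH; rewrite -gz app_mono.
have [m [m1 m2]] := @int_ceil n x0 x n_gt0.
have gy : app g (x0 + m * n%:Z)%R = (x0 + m * n%:Z)%R by rewrite app_perM gx0.
have up := above _ n m2 gy.
have grow i : app g (iter i (app g) x) = iter i (app g) x \/
              (x + i%:Z)%R < app g (iter i (app g) x).
  elim: i => [|i IH] /=; first by have := g1 x; lia.
  case: IH => [e|lt]; first by left; rewrite !e.
  by have := g1 (app g (iter i (app g) x)); lia.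
have fixn : app g (iter n (app g) x) = iter n (app g) x.
  case: (grow n) => // lt.
  by have := above _ n.+1 m2 gy; rewrite iterS; lia.
have := low n.-1; rewrite prednK // => lown.
split=> //.
- exact: le_trans (g1 x) _.
- by apply: le_trans up _; lia.
- by move=> z xz gz; apply: above.
Qed.

(** Rounding up to the next point of p + kZ, said without integer division *)
Definition is_ceil (k : nat) (p : int) f := forall (m x : int),
  (p + (m - 1) * k%:Z < x)%R -> (x <= p + m * k%:Z)%R -> app f x = (p + m * k%:Z)%R.

(** The fixed points of e include p + kZ, so a jump by k - 1 has to start right
    after such a point, and covers the whole gap. *)
Lemma Fn_ceil (k : nat) e p : (0 < k)%N -> (forall x, x <= app e x) ->
  app e p = p -> (forall x, (app e x + k%:Z)%R <= app e (x + k%:Z)%R) ->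
  (exists q, (q + k%:Z - 1)%R <= app e q) -> exists p', is_ceil k p' e.
Proof.
move=> k0 e1 ep ek [q eq]; exists p.
have ekE x : app e (x + k%:Z)%R = (app e x + k%:Z)%R.
  have up (i : nat) y : (app e y + i%:Z * k%:Z)%R <= app e (y + i%:Z * k%:Z)%R.
    elim: i => [|i IH]; first by rewrite mul0r !addr0.
    have -> : (y + i.+1%:Z * k%:Z = (y + i%:Z * k%:Z) + k%:Z)%R by lia.
    by apply: le_trans (ek _); lia.
  apply: le_anti; rewrite ek andbT.
  have := up n.-1 (x + k%:Z)%R.
  have -> : (x + k%:Z + n.-1%:Z * k%:Z = x + k%:Z * n%:Z)%R by nia.
  by rewrite app_perM; nia.
have eM := per_mul ekE.
have [m [m1 m2]] := @int_ceil k p q k0.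
have epm (j : int) : app e (p + j * k%:Z)%R = (p + j * k%:Z)%R by rewrite eM ep.
have eq_le : app e q <= (p + m * k%:Z)%R by rewrite -epm app_mono.
have qE : q = (p + (m - 1) * k%:Z + 1)%R by lia.
move=> j x jx xj; apply: le_anti; rewrite -{1}epm app_mono //=.
have -> : (p + j * k%:Z = p + m * k%:Z + (j - m) * k%:Z)%R by lia.
have -> : x = (x - (j - m) * k%:Z + (j - m) * k%:Z)%R by lia.
rewrite eM; suff : (p + m * k%:Z)%R <= app e (x - (j - m) * k%:Z)%R by lia.
apply: (@le_trans _ _ (app e q)); first by lia.
by apply: app_mono; nia.
Qed.

Section Ceil.
Variables (k : nat) (p : int) (e : FnZ n).
Hypotheses (k_gt0 : (0 < k)%N) (ce : is_ceil k p e).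

Lemma ceil_fix (m : int) : app e (p + m * k%:Z)%R = (p + m * k%:Z)%R.
Proof. by apply: ce; lia. Qed.

Lemma ceil_dvd : exists l : nat, n = (l * k)%N.
Proof.
have [m [m1 m2]] := @int_ceil k p (p + n%:Z)%R k_gt0.
have := ce m1 m2; rewrite app_per.
have := ceil_fix 0; rewrite mul0r addr0 => -> h.
exists `|m|%N; nia.
Qed.

(** The right adjoint of rounding up is rounding down. *)
Lemma ceil_floor (m x : int) : (p + m * k%:Z <= x)%R -> (x < p + (m + 1) * k%:Z)%R ->
  app (radj e) x = (p + m * k%:Z)%R.
Proof.
move=> h1 h2; apply: le_anti; apply/andP; split; last first.
  by rewrite app_radjP ceil_fix.
rewrite leNgt; apply/negP => lt.
have : (p + m * k%:Z + 1)%R <= app (radj e) x by lia.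
by rewrite app_radjP (@ce (m + 1)%R); lia.
Qed.

(** The range of y consists of the values of a on p + i + kZ, and c rounds up to
    it.  The hypothesis says that its gaps are at most k; as a gains n over n/k
    steps of length k, each gap is exactly k. *)
Lemma Fn_range_gap (a : FnZ n) (i : int) (y := a * tr n i * radj e)
    (c := y * ladj y) : (forall x, app (pw c n) x <= (x + k%:Z - 1)%R) ->
  forall m : int, app a (p + i + (m + 1) * k%:Z)%R = (app a (p + i + m * k%:Z) + k%:Z)%R.
Proof.
move=> cn.
pose r (m : int) := app a (p + i + m * k%:Z)%R.
have yE (m x : int) : (p + m * k%:Z <= x)%R -> (x < p + (m + 1) * k%:Z)%R -> app y x = r m.
  move=> h1 h2; rewrite /y !appM (ceil_floor h1 h2) app_tr /r.
  by congr (app a _); lia.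
have rE m : app y (p + m * k%:Z)%R = r m by apply: yE; lia.
have c1 x : x <= app c x by rewrite /c appM -app_ladjP.
have cy x : app c (app y x) = app y x.
  apply: le_anti; rewrite c1 andbT /c appM app_mono // app_ladjP.
  exact: lexx.
have step m : r (m + 1)%R <= (r m + k%:Z)%R.
  have [_ _ _ le_c _] := Fn_fixpoint c1 (cy p) (r m + 1)%R.
  have := le_trans le_c (cn _).
  rewrite {1}/c appM.
  have [m' [h1 h2]] := @int_floor k p (app (ladj y) (r m + 1)%R) k_gt0.
  have := c1 (r m + 1)%R; rewrite {1}/c appM (yE m') // => h3 h4.
  have mm : (m + 1 <= m')%R.
    rewrite leNgt; apply/negP => lt.
    have : r m' <= r m by apply: app_mono; nia.
    by lia.
  apply: (@le_trans _ _ (r m')); last by lia.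
  by apply: app_mono; nia.
have [l nl] := ceil_dvd.
have l0 : (0 < l)%N by case: l nl n_gt0 => // ->.
have steps m (j : nat) : r (m + j%:Z)%R <= (r m + j%:Z * k%:Z)%R.
  elim: j => [|j IH]; first by rewrite mul0r !addr0.
  have -> : (m + j.+1%:Z = m + j%:Z + 1)%R by lia.
  by apply: le_trans (step _) _; lia.
move=> m; rewrite -/(r m) -/(r (m + 1)%R); apply: le_anti; rewrite step /=.
have := steps (m + 1)%R l.-1.
have -> : (m + 1 + l.-1%:Z = m + l%:Z)%R by lia.
have -> : r (m + l%:Z)%R = (r m + n%:Z)%R.
  by rewrite /r -app_per; congr (app a _); nia.
by nia.
Qed.

End Ceil.

(** Let e move q by k1.  The least fixed point of g above q - 1 is at most
    q - 1 + k1, while g moves every point from q to q + k1 - 1; so it is q - 1,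
    which thus is fixed by e.  In the same way the least fixed point above q + i
    is q + i + k1, where the conclusion on the next translate of e is that e
    fixes q - 1. *)
Lemma Fn_common_fixpoint (k1 : nat) (i : int) e g x0 :
  (forall x, x <= app g x) -> app g x0 = x0 ->
  (forall x, app (pw g n) x <= (x + k1%:Z)%R) ->
  (exists q, (q + k1%:Z)%R <= app e q) ->
  (forall x, app e x <= app g x) ->
  (forall x, (app e (x - i) + i)%R <= app g x) ->
  exists2 x, app g x = x & (app e (x - (i + k1%:Z + 1)) + (i + k1%:Z + 1))%R <= x.
Proof.
move=> g1 gx0 gk [q eq] eg eig.
have [a1 a2 _ _ _] := Fn_fixpoint g1 gx0 (q - 1)%R.
have a3 := gk (q - 1)%R.
have [b1 b2 _ b4 _] := Fn_fixpoint g1 gx0 (q + i)%R.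
have b3 := gk (q + i)%R.
have fix1 : app (pw g n) (q - 1)%R = (q - 1)%R.
  apply: le_anti; rewrite a1 andbT leNgt; apply/negP => lt.
  have : app g q <= app g (app (pw g n) (q - 1)%R) by apply: app_mono; lia.
  by have := eg q; lia.
have e1 : app e (q - 1)%R <= (q - 1)%R by rewrite -{2}fix1 -a2 fix1.
exists (q + i + k1%:Z)%R.
  have <- : app (pw g n) (q + i)%R = (q + i + k1%:Z)%R; last by [].
  have := eig (q + i)%R; rewrite (_ : q + i - i = q)%R; last by lia.
  by lia.
have -> : (q + i + k1%:Z - (i + k1%:Z + 1) = q - 1)%R by lia.
by lia.
Qed.

End FnCeil.

(** * Rounding elements in locally embeddable algebras *)

(** As [locally_periodic], where moreover e becomes the rounding to a coset of
    kZ and all the elements become k-periodic *)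
Definition locally_rounding n d (A : lpregroupType d) (s e : A) k := forall X N,
  exists (f : A -> FnZ n) (p : int), [/\ partial_hom s X N f, is_ceil k p (f e) &
    {in X, forall x (q : int), app (f x) (q + k%:Z)%R = (app (f x) q + k%:Z)%R}].

Ltac inlist := by rewrite ?inE ?mem_cat ?inE ?eqxx ?orbT.

Section LocallyPeriodic.
Variables (n : nat) (n_gt0 : (0 < n)%N).
Variables (d : Order.disp_t) (A : lpregroupType d) (s : A).
Hypothesis per : forall x : A, iter n ll x = x.
Hypothesis loc : locally_periodic n s.
Implicit Types (a b x y z g h : A).

Section PartialHom.
Variables (X : seq A) (N : nat) (f : A -> FnZ n).
Hypothesis F : partial_hom s X N f.

Lemma ph_inj : {in X &, injective f}.
Proof.
move=> x y xX yX e; apply: le_anti.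
by rewrite -(ph_le F xX yX) -(ph_le F yX xX) e lexx.
Qed.

Lemma ph_unit g : g \in X -> lp_unit g -> exists j, f g = tr n j.
Proof.
move=> gX gu; apply: unit_tr.
by rewrite /lp_unit -(ph_ladj F gX) -(ph_radj F gX) gu.
Qed.

Lemma ph_unitV g j : ladj g \in X -> radj g \in X -> g \in X ->
  f g = tr n j -> lp_unit g.
Proof.
move=> lX rX gX e; apply: ph_inj => //.
by rewrite (ph_ladj F gX) (ph_radj F gX) e; apply: tr_unit.
Qed.

Lemma ph_pw_s i : s \in X -> (i <= N)%N -> f (pw s i) = tr n i%:Z.
Proof. by move=> sX iN; rewrite (ph_pw F sX iN) (ph_shift F) pw_tr mul1r. Qed.

Lemma ph_ladj_tr g j : g \in X -> f g = tr n j -> f (ladj g) = tr n (- j).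
Proof. by move=> gX e; rewrite (ph_ladj F gX) e ladj_tr. Qed.

Lemma ph_appM x y q : x \in X -> y \in X -> app (f (x * y)) q = app (f x) (app (f y) q).
Proof. by move=> xX yX; rewrite (ph_mul F xX yX) appM. Qed.

Lemma ph_ge1 x : x \in X -> 1 \in X -> 1 <= x -> forall q, q <= app (f x) q.
Proof.
move=> xX oX; rewrite -(ph_le F oX xX) (ph_1 F) => /app_leP h q.
exact: h.
Qed.

Lemma ph_appW x y q : x \in X -> y \in X -> x <= y -> app (f x) q <= app (f y) q.
Proof. by move=> xX yX; rewrite -(ph_le F xX yX) => /app_leP. Qed.

(** So an inflationary map with a fixed point is described by two inequalities. *)
Lemma ph_fixed x : x \in X -> 1 \in X -> s \in X -> 1 <= x ->
  ~~ (s <= x) <-> exists q, app (f x) q = q.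
Proof.
move=> xX oX sX x1; have f1 := ph_ge1 xX oX x1.
rewrite -(ph_le F sX xX) (ph_shift F); split=> [/app_leP no|[q fq]].
  apply: contrapT => /forallNP no2; apply: no => q.
  by rewrite app_tr; have := f1 q; have := no2 q; lia.
by apply/negP => /app_leP/(_ q); rewrite app_tr fq; lia.
Qed.

End PartialHom.

Lemma s_unit : lp_unit s.
Proof.
have [f F] := loc [:: s; ladj s; radj s] 0.
by apply: (ph_unitV F (j := 1%R)); [inlist | inlist | inlist | apply: (ph_shift F)].
Qed.

Lemma s_conj a : s * a = ll a * s.
Proof.
have [f F] := loc [:: s; a; ladj a; ll a; s * a; ll a * s] 0.
apply: (ph_inj F); [inlist | inlist |].
rewrite (ph_mul F); [| inlist | inlist].
rewrite (ph_mul F); [| inlist | inlist].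
rewrite {1}/ll (ph_ladj F); last inlist.
rewrite (ph_ladj F); last inlist.
by rewrite (ph_shift F) Fn_tr1_conj /ll.
Qed.

Lemma lp_unit_comm g h : lp_unit g -> lp_unit h -> g * h = h * g.
Proof.
move=> gu hu; have [f F] := loc [:: g; h; g * h; h * g] 0.
have [|i gi] := ph_unit F _ gu; first by inlist.
have [|j hj] := ph_unit F _ hu; first by inlist.
apply: (ph_inj F); [inlist | inlist |].
rewrite (ph_mul F); [| inlist | inlist].
rewrite (ph_mul F); [| inlist | inlist].
by rewrite gi hj !trM addrC.
Qed.

Lemma lp_unit_total g h : lp_unit g -> lp_unit h -> (g <= h) || (h <= g).
Proof.
move=> gu hu; have [f F] := loc [:: g; h] 0.
have [|i gi] := ph_unit F _ gu; first by inlist.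
have [|j hj] := ph_unit F _ hu; first by inlist.
rewrite -(ph_le F); [|inlist|inlist].
rewrite -(ph_le F); [|inlist|inlist].
by rewrite gi hj !tr_le; lia.
Qed.

Lemma lp_unit_succ g h : lp_unit g -> lp_unit h -> ~~ (h <= g) -> s * g <= h.
Proof.
move=> gu hu; have [f F] := loc [:: g; h; s; s * g] 0.
have [|i gi] := ph_unit F _ gu; first by inlist.
have [|j hj] := ph_unit F _ hu; first by inlist.
rewrite -(ph_le F); [|inlist|inlist].
rewrite -(ph_le F); [|inlist|inlist].
rewrite (ph_mul F); [| inlist | inlist].
by rewrite gi hj (ph_shift F) trM !tr_le; lia.
Qed.

Lemma s_not_le1 : ~~ (s <= 1).
Proof.
have [f F] := loc [:: s; 1] 0.
rewrite -(ph_le F); [|inlist|inlist].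
by rewrite (ph_1 F) (ph_shift F) -tr0 tr_le.
Qed.

Lemma s_ge1 : 1 <= s.
Proof. by have := lp_unit_total s_unit (@unit1 d A); rewrite (negPf s_not_le1). Qed.

Lemma pw_s_n_central a : pw s n * a = a * pw s n.
Proof.
have [f F] := loc [:: s; a; pw s n; pw s n * a; a * pw s n] n.
apply: (ph_inj F); [inlist | inlist |].
rewrite (ph_mul F); [| inlist | inlist].
rewrite (ph_mul F); [| inlist | inlist].
rewrite (ph_pw_s F) //; last inlist.
by apply: app_ext => q; rewrite app_tr_mul app_mul_tr app_per.
Qed.

(** Here pw x n is the closure onto the fixed points of x, which are n-periodic:
    it moves no point by n or more, so the largest displacement exists. *)
Lemma max_gap : exists k1 : nat,
  (exists x, [/\ 1 <= x, ~~ (s <= x) & pw s k1 <= hull n (pw x n)]) /\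
  (forall x, 1 <= x -> ~~ (s <= x) -> hull n (pw x n) <= pw s k1).
Proof.
pose P j := `[< exists x, [/\ 1 <= x, ~~ (s <= x) & pw s j <= hull n (pw x n)] >].
have P0 : exists j, P j.
  exists 0%N; apply/asboolP; exists 1; split; rewrite ?s_not_le1 //.
  have -> : pw (1 : A) n = 1 by elim: (n) => [|m IH]; rewrite ?pw0 ?pwS ?IH ?lp_mulg1.
  by rewrite pw0 hull_ge.
have Pn j : P j -> (j <= n)%N.
  move=> /asboolP[x [x1 sx jx]].
  have [f F] := loc [:: 1; x; s; pw x n; hull n (pw x n); pw s j] (maxn n j).
  have [|||q0 fq0] := (ph_fixed F _ _ _ x1).1 sx; [inlist|inlist|inlist|].
  have f1 : forall q, q <= app (f x) q by apply: (ph_ge1 F) => //; inlist.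
  move: jx; rewrite -(ph_le F); [|inlist|inlist].
  rewrite (ph_pw_s F) ?leq_maxr //; last inlist.
  rewrite (ph_hull F); last inlist.
  rewrite (ph_pw F) ?leq_maxl //; last inlist.
  move=> /(Fn_le_hull n_gt0)[q].
  by have [_ _ + _ _] := Fn_fixpoint n_gt0 f1 fq0 q; lia.
case: (ex_maxnP P0 Pn) => k1 /asboolP Pk max; exists k1; split=> // x x1 sx.
have [//|no] := boolP (hull n (pw x n) <= pw s k1).
have /max : P k1.+1; last by rewrite ltnn.
apply/asboolP; exists x; split=> //; rewrite pwS.
by apply: lp_unit_succ => //; [apply: unit_pw s_unit | apply: (unit_hull n_gt0 per)].
Qed.

Section Ceiling.
Variable k1 : nat.
Let k := k1.+1.
Hypothesis gap_le : forall x, 1 <= x -> ~~ (s <= x) -> hull n (pw x n) <= pw s k1.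

(** From a closure e0 of maximal displacement k1 to rounding to a coset of kZ: the
    join of the translates of e0 by the multiples of k dominates this rounding,
    and it is equal to it provided that it still has a fixed point. *)
Section Construction.
Variable e0 : A.
Hypotheses (e01 : 1 <= e0) (se0 : ~~ (s <= e0)) (ge0 : pw s k1 <= hull n e0).

Definition translate i := pw s i * e0 * ladj (pw s i).

Fixpoint translates m :=
  if m is m'.+1 then translates m' `|` translate (m * k) else e0.

Let sp i : lp_unit (pw s i) := unit_pw i s_unit.

Lemma translate0 : translate 0 = e0.
Proof. by rewrite /translate pw0 ladj1 lp_mul1g lp_mulg1. Qed.

Lemma translateD i j : pw s i * translate j * ladj (pw s i) = translate (i + j).
Proof. by rewrite /translate pwD ladjM !lp_mulgA. Qed.

Lemma translate_le m j : (j <= m)%N -> translate (j * k) <= translates m.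
Proof.
elim: m => [|m IH]; first by rewrite leqn0 => /eqP->; rewrite mul0n translate0.
rewrite leq_eqVlt ltnS => /orP[/eqP->|jm] /=; first exact: leUr.
by rewrite lexU2 // IH.
Qed.

Lemma translates_ge1 m : 1 <= translates m.
Proof.
by apply: le_trans e01 _; rewrite -translate0 -(mul0n k) translate_le.
Qed.

(** The maximality of k1 bounds the closures of all these joins, so that
    [Fn_common_fixpoint] provides a fixed point of the next join. *)
Lemma translates_fixed m : ~~ (s <= translates m).
Proof.
elim: m => [//|m IH].
pose u := pw s (m * k); pose w := pw s (m.+1 * k).
pose E := translates m; pose E' := translates m.+1.
have [f F] := loc ([:: 1; s; e0; E; E'; pw E n; hull n (pw E n); hull n e0; pw s k1]
  ++ [:: u; ladj u; u * e0; translate (m * k)]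
  ++ [:: w; ladj w; w * e0; translate (m.+1 * k)]) (maxn n (maxn (m.+1 * k) k1)).
have [|||x0 fx0] := (ph_fixed F _ _ _ (translates_ge1 m)).1 IH; [inlist|inlist|inlist|].
have gf : forall x : int, app (f (pw E n)) x <= (x + k1%:Z)%R.
  apply/Fn_hull_le.
  have := gap_le (translates_ge1 m) IH; rewrite -(ph_le F); [|inlist|inlist].
  rewrite (ph_pw_s F); [|inlist|lia].
  by rewrite (ph_hull F); last inlist.
have tE i : (i = m * k \/ i = m.+1 * k)%N -> forall x : int,
    app (f (translate i)) x = (app (f e0) (x - i%:Z) + i%:Z)%R.
  have iN : (i = m * k \/ i = m.+1 * k)%N -> (i <= maxn n (maxn (m.+1 * k) k1))%N by lia.
  move=> im x; have {}iN := iN im; rewrite /translate.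
  rewrite (ph_appM F); [|by case: im => ->; inlist|by case: im => ->; inlist].
  rewrite (ph_appM F); [|by case: im => ->; inlist|inlist].
  rewrite (ph_pw_s F _ iN); last inlist.
  rewrite (ph_ladj_tr F _ (ph_pw_s F _ iN)); [|by case: im => ->; inlist|inlist].
  by rewrite !app_tr.
have [||||||x fx ex] := @Fn_common_fixpoint n n_gt0 k1 (m * k)%N%:Z (f e0) (f E) x0.
- by apply: (ph_ge1 F); [inlist|inlist|apply: translates_ge1].
- exact: fx0.
- by rewrite -(ph_pw F) ?leq_maxl //; inlist.
- apply/(Fn_le_hull n_gt0); rewrite -(ph_hull F); last inlist.
  rewrite -(ph_pw_s F (i := k1)); [|inlist|lia].
  by rewrite (ph_le F) //; inlist.
- move=> x; apply: (ph_appW F); [inlist|inlist|].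
  by rewrite -translate0 -(mul0n k) translate_le.
- move=> x; rewrite -tE; last by left.
  by apply: (ph_appW F); [inlist|inlist|apply: translate_le].
have [|||_ ->//] := ph_fixed F _ _ _ (translates_ge1 m.+1); [inlist|inlist|inlist|].
exists x; rewrite /= (ph_join F); [|inlist|inlist].
rewrite appU fx tE; last by right.
apply/join_idPl.
have -> : ((m.+1 * k)%N%:Z = (m * k)%N%:Z + k1%:Z + 1)%R by lia.
exact: ex.
Qed.

(** Conjugation by s^k maps each translate to the next, and the translate by nk
    is e0 again because s^n is central. *)
Lemma translates_shift : pw s k * translates n <= translates n * pw s k.
Proof.
have kn : translate (n.+1 * k) = translate k.
  have -> : (n.+1 * k = k + n * k)%N by lia.
  rewrite -translateD; congr (_ * _ * _).
  rewrite /translate mulnC mulnC pwM (pw_comm _ (pw_s_n_central e0)) unit_mulgK //.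
  exact: unit_pw.
have conj m : pw s k * translates m * ladj (pw s k) <= translates m.+1.
  elim: m => [|m IH].
    have -> : translates 0 = translate 0 by rewrite translate0.
    rewrite translateD addn0 -[X in translate X]mul1n.
    exact: translate_le.
  rewrite [translates m.+1]/= lp_mulgU lp_mulUg translateD -mulSn leUx.
  rewrite [translates m.+2]/= (le_trans IH) ?leUl //=.
  by rewrite leUr.
have := conj n; rewrite [translates n.+1]/= kn.
rewrite (join_idPl _) => [h|]; last by rewrite -[X in translate X]mul1n translate_le.
by rewrite -(unit_mulgKV (pw s k * _) (sp k)) le_mulg.
Qed.

Lemma hull_translates : pw s k1 <= hull n (translates n).
Proof.
apply: le_trans ge0 _; apply: hull_mono.
by rewrite -translate0 -(mul0n k) translate_le.
Qed.

End Construction.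

(** The inequalities by which [Fn_ceil] recognizes rounding to a coset of kZ *)
Definition ceiling e := [/\ 1 <= e, ~~ (s <= e),
  pw s k * e <= e * pw s k & pw s k1 <= hull n e].

Section Period.
Variable e : A.
Hypothesis ce : ceiling e.

Lemma ph_ceiling X N (f : A -> FnZ n) : partial_hom s X N f -> (k <= N)%N ->
  {subset [:: 1; s; e; pw s k; pw s k * e; e * pw s k; pw s k1; hull n e] <= X} ->
  exists p, is_ceil k p (f e).
Proof.
move=> F kN sub; have [e1 se ke he] := ce.
have [|||p fp] := (ph_fixed F _ _ _ e1).1 se; [apply: sub; inlist..|].
apply: (@Fn_ceil n n_gt0 k (f e) p).
- by [].
- by apply: (ph_ge1 F) => //; apply: sub; inlist.
- exact: fp.
- move=> x; move: ke; rewrite -(ph_le F); [|apply: sub; inlist|apply: sub; inlist].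
  rewrite (ph_mul F); [|apply: sub; inlist|apply: sub; inlist].
  rewrite (ph_mul F); [|apply: sub; inlist|apply: sub; inlist].
  rewrite (ph_pw_s F _ kN); last by apply: sub; inlist.
  by move/app_leP/(_ x); rewrite app_tr_mul app_mul_tr.
- move: he; rewrite -(ph_le F); [|apply: sub; inlist|apply: sub; inlist].
  rewrite (ph_hull F); last by apply: sub; inlist.
  rewrite (ph_pw_s F); [|by apply: sub; inlist|lia].
  move=> /(Fn_le_hull n_gt0)[q h]; exists q; apply: le_trans h.
  by rewrite /k; lia.
Qed.

(** For each i the map c i rounds up to the range of a on a coset of kZ.  It has
    fixed points, hence moves no point by k or more, and [Fn_range_gap] applies. *)
Lemma period_comm a : pw s k * a = a * pw s k.
Proof.
pose y i := a * pw s i * radj e; pose c i := y i * ladj (y i).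
pose Y i := [:: pw s i; a * pw s i; y i; ladj (y i); c i; pw (c i) n; hull n (pw (c i) n)].
pose X := [:: 1; s; e; pw s k; pw s k * e; e * pw s k; pw s k1; hull n e] ++
  [:: a; pw s k * a; a * pw s k; radj e] ++ flatten [seq Y i | i <- iota 0 k].
have [f F] := loc X (maxn n k).
have [||p cp] := ph_ceiling F; first by rewrite leq_maxr.
  by move=> x xX; rewrite mem_cat xX.
have YX i : (i < k)%N -> {subset Y i <= X}.
  move=> ik x xY; rewrite /X 2!mem_cat; apply/orP; right; apply/orP; right.
  by apply/flattenP; exists (Y i) => //; apply: map_f; rewrite mem_iota.
have gap i : (i < k)%N -> forall m : int,
    app (f a) (p + i%:Z + (m + 1) * k%:Z)%R = (app (f a) (p + i%:Z + m * k%:Z) + k%:Z)%R.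
  move=> ik; have {}YX := YX i ik.
  have c1 : 1 <= c i by apply: mulg_ladj_ge1.
  have fy : f (y i) = f a * tr n i%:Z * radj (f e).
    rewrite /y (ph_mul F); [|apply: YX; inlist|inlist].
    rewrite (ph_mul F); [|inlist|apply: YX; inlist].
    rewrite (ph_radj F); last inlist.
    by rewrite (ph_pw_s F) //; [inlist|lia].
  have fc : f (c i) = f (y i) * ladj (f (y i)).
    rewrite /c (ph_mul F); [|apply: YX; inlist|apply: YX; inlist].
    by rewrite (ph_ladj F) //; apply: YX; inlist.
  (* c i lies above 1 and is fixed on the range of y i, so it does not lie
     above s. *)
  have sc : ~~ (s <= c i).
    apply/negP; rewrite -(ph_le F); [|inlist|apply: YX; inlist].
    rewrite (ph_shift F) => /app_leP/(_ (app (f (y i)) 0)); rewrite app_tr fc.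
    rewrite appM; suff : app (ladj (f (y i))) (app (f (y i)) 0%R) <= 0%R.
      by move/(app_mono (f (y i))); lia.
    by rewrite app_ladjP.
  have := gap_le c1 sc; rewrite -(ph_le F); [|apply: YX; inlist|inlist].
  rewrite (ph_hull F); last by apply: YX; inlist.
  rewrite (ph_pw F) ?leq_maxl //; last by apply: YX; inlist.
  rewrite (ph_pw_s F); [|inlist|lia].
  move=> /Fn_hull_le h.
  apply: (Fn_range_gap n_gt0 (ltn0Sn k1) cp) => x; rewrite -fy -fc.
  by apply: le_trans (h x) _; rewrite /k; lia.
apply: (ph_inj F); [inlist|inlist|].
rewrite (ph_mul F); [|inlist|inlist].
rewrite (ph_mul F); [|inlist|inlist].
rewrite (ph_pw_s F); [|inlist|by rewrite leq_maxr].
apply: app_ext => q; rewrite app_tr_mul app_mul_tr.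
have [m [m1 m2]] := @int_floor k p q (ltn0Sn k1).
have [i [ik qE]] : exists i : nat, (i < k)%N /\ (q = p + i%:Z + m * k%:Z)%R.
  by exists `|(q - p - m * k%:Z)%R|%N; lia.
rewrite qE -gap //; congr (app _ _); lia.
Qed.

Lemma ceiling_local : locally_rounding n s e k.
Proof.
move=> X N; pose Z := [:: 1; s; e; pw s k; pw s k * e; e * pw s k; pw s k1; hull n e].
have [f F] := loc (X ++ Z ++ [seq pw s k * x | x <- X] ++ [seq x * pw s k | x <- X]) (maxn N k).
have XX x : x \in X -> x \in (X ++ Z ++ [seq pw s k * x | x <- X] ++ [seq x * pw s k | x <- X]).
  by move=> xX; rewrite mem_cat xX.
have [||p cp] := ph_ceiling F; first by rewrite leq_maxr.
  by move=> x xZ; rewrite !mem_cat xZ !orbT.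
exists f, p; split=> //.
- case: F => F1 F2 F3 F4 F5 F6 F7 F8 F9 F10; split=> //.
  + by move=> x y xX yX; apply: F1; apply: XX.
  + by move=> x y xX yX; apply: F2; apply: XX.
  + by move=> x y xX yX; apply: F3; apply: XX.
  + by move=> x y xX yX; apply: F4; apply: XX.
  + by move=> x xX; apply: F5; apply: XX.
  + by move=> x xX; apply: F6; apply: XX.
  + by move=> x xX; apply: F7; apply: XX.
  + by move=> x xX i iN; apply: F8; rewrite ?XX // leq_max iN.
- move=> x xX q; rewrite -!(app_tr n k%:Z) -(ph_pw_s F (i := k)); last first.
  + by rewrite leq_maxr.
  + by rewrite !mem_cat !inE eqxx !orbT.
  have sX : pw s k \in (X ++ Z ++ [seq pw s k * x | x <- X] ++ [seq x * pw s k | x <- X]).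
    by rewrite !mem_cat !inE eqxx !orbT.
  by rewrite -!appM -!(ph_mul F) ?sX ?XX // period_comm.
Qed.

End Period.

Lemma ceiling_ex : (exists x, [/\ 1 <= x, ~~ (s <= x) & pw s k1 <= hull n (pw x n)]) ->
  exists e, ceiling e.
Proof.
move=> [x [x1 sx hx]]; exists (translates (pw x n) n).
have p1 : 1 <= pw x n by apply: pw_ge1.
have sp : ~~ (s <= pw x n).
  have [f F] := loc [:: 1; x; s; pw x n] n.
  have [|||q0 fq0] := (ph_fixed F _ _ _ x1).1 sx; [inlist|inlist|inlist|].
  have [|||_ ->//] := ph_fixed F _ _ _ p1; [inlist|inlist|inlist|].
  exists q0; rewrite (ph_pw F) ?leqnn //; last inlist.
  have it m : iter m (app (f x)) q0 = q0 by elim: m => //= m ->.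
  by rewrite app_pw it.
split.
- exact: translates_ge1.
- exact: translates_fixed.
- exact: translates_shift.
- exact: hull_translates.
Qed.

End Ceiling.

End LocallyPeriodic.

(** * The action on the chain of units *)

(** The map under the hull sends all of [p + mk, p + (m + 1)k) to
    a (p + j) + mk, so its displacement is largest at p + mk. *)
Lemma Fn_hull_floor n (n_gt0 : (0 < n)%N) (k : nat) (k_gt0 : (0 < k)%N) (p j : int)
    (a e : FnZ n) : is_ceil k p e ->
  (forall q : int, app a (q + k%:Z)%R = (app a q + k%:Z)%R) ->
  hull n (a * tr n j * radj e) = tr n (app a (p + j) - p).
Proof.
move=> ce ak.
have yE (m x : int) : (p + m * k%:Z <= x)%R -> (x < p + (m + 1) * k%:Z)%R ->
    app (a * tr n j * radj e) x = (app a (p + j) + m * k%:Z)%R.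
  move=> h1 h2; rewrite !appM (ceil_floor n_gt0 k_gt0 ce h1 h2) app_tr -(per_mul ak).
  by congr (app a _); lia.
apply: le_anti; apply/andP; split.
  apply/Fn_hull_le => q; have [m [m1 m2]] := @int_floor k p q k_gt0.
  by rewrite (yE m) //; lia.
by apply/Fn_le_hull => //; exists p; rewrite (yE 0%R) //; lia.
Qed.

Ltac insub := by move=> ?; rewrite ?mem_cat => ->; rewrite ?orbT.

Section Action.
Variables (n : nat) (n_gt0 : (0 < n)%N).
Variables (d : Order.disp_t) (A : lpregroupType d) (s e : A) (k : nat).
Hypothesis k_gt0 : (0 < k)%N.
Hypothesis per : forall x : A, iter n ll x = x.
Hypothesis loc : locally_rounding n s e k.
Implicit Types (a b g h : A).

(** The image of the point g of the chain of units under a: if g is the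
    translation by j and e rounds up to p + kZ, this is the translation by
    a (p + j) - p. *)
Definition act a g := hull n (a * g * radj e).

(** What a partial homomorphism has to respect in order to respect act a g *)
Definition act_support a g := [:: a; g; e; radj e; a * g; a * g * radj e; act a g].

Lemma ph_act X N (f : A -> FnZ n) p a g j : partial_hom s X N f -> is_ceil k p (f e) ->
  {in X, forall x (q : int), app (f x) (q + k%:Z)%R = (app (f x) q + k%:Z)%R} ->
  {subset act_support a g <= X} -> f g = tr n j ->
  f (act a g) = tr n (app (f a) (p + j) - p).
Proof.
move=> F ce fk sub fg.
have {}sub x : x \in act_support a g -> x \in X by apply: sub.
rewrite /act (ph_hull F); last by apply: sub; inlist.
rewrite (ph_mul F); [|apply: sub; inlist|apply: sub; inlist].
rewrite (ph_mul F); [|apply: sub; inlist|apply: sub; inlist].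
rewrite (ph_radj F) ?fg; last by apply: sub; inlist.
by apply: (Fn_hull_floor n_gt0 k_gt0 _ ce); apply: (fk a); apply: sub; inlist.
Qed.

Lemma act_unit a g : lp_unit (act a g).
Proof. exact: unit_hull. Qed.

Lemma le_act a b g h : a <= b -> g <= h -> act a g <= act b h.
Proof. by move=> ab gh; apply: hull_mono; do !apply: le_mulg. Qed.

Lemma act_mul a b g : lp_unit g -> act (a * b) g = act a (act b g).
Proof.
move=> gu.
have [f [p [F ce fk]]] :=
  loc (act_support (a * b) g ++ act_support a (act b g) ++ act_support b g) 0.
have [|j fg] := ph_unit F _ gu; first by inlist.
apply: (ph_inj F); [inlist|inlist|].
rewrite (ph_act F ce fk _ fg); last insub.
have fbg : f (act b g) = tr n (app (f b) (p + j) - p).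
  by rewrite (ph_act F ce fk _ fg) //; insub.
rewrite (ph_act F ce fk _ fbg); last insub.
rewrite (ph_appM F); [|inlist|inlist].
by congr (tr _ (app _ _ - _)); lia.
Qed.

Lemma act_meet a b g : lp_unit g -> act (a `&` b) g = act a g `&` act b g.
Proof.
move=> gu.
have [f [p [F ce fk]]] := loc (act_support (a `&` b) g ++ act_support a g ++
  act_support b g ++ [:: act a g `&` act b g]) 0.
have [|j fg] := ph_unit F _ gu; first by inlist.
apply: (ph_inj F); [inlist|inlist|].
rewrite (ph_act F ce fk _ fg); last insub.
rewrite (ph_meet F); [|inlist|inlist].
rewrite (ph_meet F); [|inlist|inlist].
rewrite (ph_act F ce fk _ fg); last insub.
rewrite (ph_act F ce fk _ fg); last insub.
by apply: app_ext => q; rewrite app_tr !appI !app_tr !meetEtotal; lia.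
Qed.

Lemma act_join a b g : lp_unit g -> act (a `|` b) g = act a g `|` act b g.
Proof.
move=> gu.
have [f [p [F ce fk]]] := loc (act_support (a `|` b) g ++ act_support a g ++
  act_support b g ++ [:: act a g `|` act b g]) 0.
have [|j fg] := ph_unit F _ gu; first by inlist.
apply: (ph_inj F); [inlist|inlist|].
rewrite (ph_act F ce fk _ fg); last insub.
rewrite (ph_join F); [|inlist|inlist].
rewrite (ph_join F); [|inlist|inlist].
rewrite (ph_act F ce fk _ fg); last insub.
rewrite (ph_act F ce fk _ fg); last insub.
by apply: app_ext => q; rewrite app_tr !appU !app_tr !joinEtotal; lia.
Qed.

Lemma act_translation h g : lp_unit h -> lp_unit g -> act h g = h * g.
Proof.
move=> hu gu.
have [f [p [F ce fk]]] := loc (act_support h g) 0.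
have [|j fg] := ph_unit F _ gu; first by inlist.
have [|i fh] := ph_unit F _ hu; first by inlist.
apply: (ph_inj F); [inlist|inlist|].
rewrite (ph_act F ce fk _ fg); last by move=> ?.
rewrite (ph_mul F); [|inlist|inlist].
by rewrite fh fg trM app_tr; congr tr; lia.
Qed.

Lemma act1 g : lp_unit g -> act 1 g = g.
Proof. by move=> gu; rewrite act_translation ?lp_mul1g //; apply: unit1. Qed.

Lemma tr_commutes_ceil p i (x : FnZ n) : is_ceil k p x ->
  tr n i * x = x * tr n i <-> exists m : int, i = (m * k%:Z)%R.
Proof.
move=> cx; split=> [h|[m ->]].
  have := congr1 (fun y => app y p) h; rewrite app_tr_mul app_mul_tr.
  have := ceil_fix n_gt0 k_gt0 cx 0; rewrite mul0r addr0 => ->.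
  have [m [m1 m2]] := @int_ceil k p (p + i)%R k_gt0.
  by rewrite (cx _ _ m1 m2) => h2; exists m; lia.
apply: app_ext => q; rewrite app_tr_mul app_mul_tr.
have [j [j1 j2]] := @int_ceil k p q k_gt0.
by rewrite (cx j) // (cx (j + m)%R); lia.
Qed.

Lemma act_mulr a g h : lp_unit g -> lp_unit h -> h * e = e * h ->
  act a (g * h) = act a g * h.
Proof.
move=> gu hu he.
have [f [p [F ce fk]]] := loc (act_support a (g * h) ++ act_support a g ++
  [:: h; h * e; e * h; act a g * h]) 0.
have [|j fg] := ph_unit F _ gu; first by inlist.
have [|i fh] := ph_unit F _ hu; first by inlist.
have : tr n i * f e = f e * tr n i.
  by rewrite -fh -(ph_mul F) ?he ?(ph_mul F) //; inlist.
move=> /(tr_commutes_ceil i ce)[m im].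
apply: (ph_inj F); [inlist|inlist|].
have fgh : f (g * h) = tr n (j + i) by rewrite (ph_mul F) ?fg ?fh ?trM //; inlist.
rewrite (ph_act F ce fk _ fgh); last insub.
rewrite (ph_mul F); [|inlist|inlist].
rewrite (ph_act F ce fk _ fg) ?fh ?trM; last insub.
have fka := fk a; rewrite im addrA (per_mul (h := app (f a))). by rewrite addrAC.
by apply: fka; inlist.
Qed.

(** A k-periodic map is determined by its values at p, ..., p + k - 1. *)
Lemma act_faithful a b :
  (forall i, (i < k)%N -> act a (pw s i) <= act b (pw s i)) -> a <= b.
Proof.
move=> h.
pose Y i := act_support a (pw s i) ++ act_support b (pw s i).
have [f [p [F ce fk]]] := loc ([:: s; a; b] ++ flatten [seq Y i | i <- iota 0 k]) k.
set X := (X in partial_hom s X) in F fk.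
have YX i : (i < k)%N -> {subset Y i <= X}.
  move=> ik x xY; rewrite /X mem_cat; apply/orP; right.
  by apply/flattenP; exists (Y i) => //; apply: map_f; rewrite mem_iota.
rewrite -(ph_le F); [|inlist|inlist].
have val i : (i < k)%N -> app (f a) (p + i%:Z)%R <= app (f b) (p + i%:Z)%R.
  move=> ik; have fs := ph_pw_s F _ (ltnW ik).
  have aX : {subset act_support a (pw s i) <= X} by move=> x xY; apply: (YX i); rewrite // mem_cat xY.
  have bX : {subset act_support b (pw s i) <= X}.
    by move=> x xY; apply: (YX i); rewrite // mem_cat xY orbT.
  have := h i ik; rewrite -(ph_le F); [|apply: aX; inlist|apply: bX; inlist].
  rewrite (ph_act F ce fk aX (fs _)); last by inlist.
  rewrite (ph_act F ce fk bX (fs _)); last by inlist.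
  by rewrite tr_le; lia.
apply/app_leP => q.
have [m [m1 m2]] := @int_floor k p q k_gt0.
have [i [ik qE]] : exists i : nat, (i < k)%N /\ (q = p + i%:Z + m * k%:Z)%R.
  by exists `|(q - p - m * k%:Z)%R|%N; lia.
have fka : forall r : int, _ := fk a _; have fkb : forall r : int, _ := fk b _.
rewrite qE (per_mul (h := app (f a))); last by apply: fka; inlist.
rewrite (per_mul (h := app (f b))); last by apply: fkb; inlist.
by have := val i ik; lia.
Qed.

Lemma unit_shift_commutes g : lp_unit g ->
  exists2 i, (i < k)%N & (g * pw s i) * e = e * (g * pw s i).
Proof.
move=> gu.
pose Y i := [:: pw s i; g * pw s i; (g * pw s i) * e; e * (g * pw s i)].
have [f [p [F ce fk]]] := loc ([:: s; e; g] ++ flatten [seq Y i | i <- iota 0 k]) k.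
set X := (X in partial_hom s X) in F fk.
have [|j fg] := ph_unit F _ gu; first by inlist.
have [m [m1 m2]] := @int_ceil k 0%R j k_gt0.
have [i [ik jE]] : exists i : nat, (i < k)%N /\ (j + i%:Z = m * k%:Z)%R.
  by exists `|(m * k%:Z - j)%R|%N; lia.
have YX : {subset Y i <= X}.
  move=> x xY; rewrite /X mem_cat; apply/orP; right.
  by apply/flattenP; exists (Y i) => //; apply: map_f; rewrite mem_iota.
have fgs : f (g * pw s i) = tr n (j + i%:Z).
  rewrite (ph_mul F); [|inlist|apply: YX; inlist].
  by rewrite fg (ph_pw_s F) ?trM //; [inlist | exact: ltnW].
exists i => //; apply: (ph_inj F); [apply: YX; inlist|apply: YX; inlist|].
rewrite (ph_mul F) ?fgs; [|apply: YX; inlist|inlist].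
rewrite (ph_mul F) ?fgs; [|inlist|apply: YX; inlist].
by apply/(tr_commutes_ceil _ ce); exists m.
Qed.

Lemma act_ceiling (i j : nat) (m : int) : ((m - 1) * k%:Z < i%:Z)%R ->
  (i%:Z <= m * k%:Z)%R -> (j%:Z = m * k%:Z)%R -> act e (pw s i) = pw s j.
Proof.
move=> h1 h2 jE.
have [f [p [F ce fk]]] := loc (act_support e (pw s i) ++ [:: s; pw s j]) (maxn i j).
have fs := ph_pw_s F (i := i).
apply: (ph_inj F); [inlist|inlist|].
rewrite (ph_act F ce fk _ (fs _ _)); [|insub|inlist|exact: leq_maxl].
rewrite (ph_pw_s F); [|inlist|exact: leq_maxr].
by rewrite (ce m); [congr tr; lia|lia|lia].
Qed.

End Action.

(** * Splitting a cyclic factor off a commutative group *)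

Section Splitting.
Local Open Scope ring_scope.
Variables (G : zmodType) (s : G).

Definition comb r (h : 'I_r -> G) (c : 'I_r -> int) : G := \sum_(i < r) h i *~ c i.

Definition spans r (h : 'I_r -> G) := forall g, exists j c, g = s *~ j + comb h c.

Definition generated_by (gs : seq G) := forall P : G -> Prop,
  P s -> (forall g, g \in gs -> P g) -> (forall x y, P x -> P y -> P (x - y)) ->
  forall g, P g.

Lemma generated_spans gs : generated_by gs -> exists r, exists h : 'I_r -> G, spans h.
Proof.
move=> gen; exists (size gs), (fun i => nth 0 gs i); apply: gen.
- by exists 1, (fun=> 0%R); rewrite mulr1z /comb big1 ?addr0.
- move=> g ggs; exists 0, (fun i => if nth 0 gs i == g then (i == index g gs :> nat)%:Z else 0).
  rewrite mulr0z add0r /comb.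
  have ig : (index g gs < size gs)%N by rewrite index_mem.
  rewrite (bigD1 (Ordinal ig)) //= nth_index // !eqxx mulr1z big1 ?addr0 // => i ni.
  case: eqP => _; last by rewrite mulr0z.
  by have /negPf-> : (i != index g gs :> nat); rewrite ?mulr0z // -(inj_eq val_inj) in ni *.
- move=> _ _ [j1 [c1 ->]] [j2 [c2 ->]].
  exists (j1 - j2), (fun i => c1 i - c2 i).
  rewrite mulrzBr /comb opprD addrACA -sumrB; congr (_ + _).
  by apply: eq_bigr => i _; rewrite mulrzBr.
Qed.

(** The step of the Euclidean algorithm: adding a multiple of one generator to
    another lowers a coefficient of a relation. *)
Lemma comb_elementary r (h : 'I_r -> G) (c : 'I_r -> int) (i j : 'I_r) (t : int) :
  i != j ->
  comb h c = comb (fun l => if l == j then h j + h i *~ t else h l)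
                  (fun l => if l == i then c i - c j * t else c l).
Proof.
move=> ij; rewrite /comb (bigD1 i) //= (bigD1 j) /= 1?eq_sym //.
rewrite [RHS](bigD1 i) //= [in RHS](bigD1 j) /= 1?eq_sym //.
rewrite !eqxx ?(negPf ij) [j == i]eq_sym ?(negPf ij) !addrA; congr (_ + _).
  by rewrite mulrzBr mulrzDl -mulrzA [t * _]mulrC; rewrite addrA addrAC subrK.
by apply: eq_bigr => l /andP[/negPf-> /negPf->].
Qed.

Hypothesis torsion_free : forall (m : int) g, m != 0 ->
  (exists j, g *~ m = s *~ j) -> exists j, g = s *~ j.

Lemma spans_drop r (h : 'I_r.+1 -> G) i : spans h -> (exists j, h i = s *~ j) ->
  spans (fun l => h (lift i l)).
Proof.
move=> sp [j0 hi] g; have [j [c ->]] := sp g.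
exists (j + j0 * c i), (fun l => c (lift i l)).
by rewrite /comb (bigD1_ord i) //= hi -mulrzA mulrzDr addrA.
Qed.

(** The Euclidean algorithm reduces a nontrivial relation to a multiple of one
    generator, which by torsion-freeness lies in the span of s and is redundant. *)
Lemma minimal_spans_free r (h : 'I_r -> G) : spans h ->
  (forall r' (h' : 'I_r' -> G), spans h' -> (r <= r')%N) ->
  forall j c, s *~ j + comb h c = 0 -> forall i, c i = 0.
Proof.
move=> sp min j c; have [w] := ubnP (\sum_(i < r) `|c i|%N)%N.
elim: w => // w IH in h sp j c * => cw rel.
apply: contrapT => /existsNP[i0 ci0].
have {}ci0 : c i0 != 0 by apply/eqP.
have [[i1 [ci1 i01]]|only] := pselect (exists i1, c i1 != 0 /\ i1 != i0); last first.
  have hi0 : exists j', h i0 = s *~ j'.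
    apply: (torsion_free ci0); exists (- j); rewrite mulrNz.
    move: rel; rewrite /comb (bigD1 i0) //= big1 ?addr0 => [/eqP|i ni].
      by rewrite addrC addr_eq0 => /eqP.
    have [->|cn] := eqVneq (c i) 0; first by rewrite mulr0z.
    by case: only; exists i.
  case: r => [|r] in h c sp min i0 ci0 hi0 {IH cw rel only} *; first by case: (i0).
  by have := min _ _ (spans_drop sp hi0); rewrite ltnn.
wlog : i0 i1 ci0 ci1 i01 / (`|c i1|%N <= `|c i0|%N)%N => [H|le].
  case: (leqP `|c i1|%N `|c i0|%N) => [le|/ltnW le]; first exact: (H i0 i1).
  by apply: (H i1 i0) => //; rewrite eq_sym.
(* t = 1 or t = - 1 brings c i0 closer to 0, c i1 being the smaller one. *)
have [t tP] : exists t : int, (`|(c i0 - c i1 * t)%R|%N < `|c i0|%N)%N.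
  case: (leP 0 (c i0 * c i1)) => sg; [exists 1|exists (-1)]; nia.
pose h' l := if l == i1 then h i1 + h i0 *~ t else h l.
pose c' l := if l == i0 then c i0 - c i1 * t else c l.
have i01' : i0 != i1 by rewrite eq_sym.
have sp' : spans h'.
  move=> g; have [j' [b ->]] := sp g.
  by exists j', (fun l => if l == i0 then b i0 - b i1 * t else b l); rewrite -comb_elementary.
have := IH h' sp' j c'; rewrite -comb_elementary // => /(_ _ rel) H.
have : c' i1 = 0.
  apply: H; rewrite (bigD1 i0) //= /c' eqxx.
  move: cw; rewrite (bigD1 i0) //= => cw.
  rewrite (eq_bigr (fun i => `|c i|%N)) => [|i /negPf-> //].
  by move: tP cw; lia.
by rewrite /c' (negPf i01) => /eqP; rewrite (negPf ci1).
Qed.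

Lemma free_complement gs : generated_by gs -> exists r, exists2 h : 'I_r -> G,
  spans h & forall j c, s *~ j + comb h c = 0 -> forall i, c i = 0.
Proof.
move=> gen; have [r0 [h0 sp0]] := generated_spans gen.
have ex : exists r, `[< exists h : 'I_r -> G, spans h >].
  by exists r0; apply/asboolP; exists h0.
case: (ex_minnP ex) => r /asboolP[h sp] min; exists r, h => //.
by apply: (minimal_spans_free sp) => r' h' sp'; apply: min; apply/asboolP; exists h'.
Qed.

End Splitting.

(** * Groups of units as ordered groups *)

Definition units_commute d (A : lpregroupType d) :=
  forall g h : A, lp_unit g -> lp_unit h -> g * h = h * g.

(** Indexed by the proof of commutativity so as to carry a zmodType structure,
    which gives access to integer multiples and finite sums *)
Record unit_group d (A : lpregroupType d) (comm : units_commute A) := UnitGroup {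
  unit_val :> A;
  _ : ladj unit_val == radj unit_val
}.

HB.instance Definition _ d (A : lpregroupType d) (comm : units_commute A) :=
  [isSub for @unit_val d A comm].
HB.instance Definition _ d (A : lpregroupType d) (comm : units_commute A) :=
  [Choice of @unit_group d A comm by <:].

Section UnitGroup.
Variables (d : Order.disp_t) (A : lpregroupType d) (comm : units_commute A).
Local Notation U := (unit_group comm).
Implicit Types x y z : U.

Lemma unit_valP x : lp_unit (unit_val x).
Proof. exact/eqP/(valP x). Qed.

Definition to_unit (g : A) (gu : lp_unit g) : U :=
  @UnitGroup d A comm g (introT eqP gu).

Lemma unit_val_inj : injective (@unit_val d A comm).
Proof. exact: val_inj. Qed.

Definition unit_add x y := to_unit (unitM (unit_valP x) (unit_valP y)).
Definition unit_zero := to_unit (@unit1 d A).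
Definition unit_opp x := to_unit (unit_ladj (unit_valP x)).

Fact unit_addA : associative unit_add.
Proof. by move=> x y z; apply: val_inj; rewrite /= lp_mulgA. Qed.
Fact unit_addC : commutative unit_add.
Proof. by move=> x y; apply: val_inj; apply: comm; apply: unit_valP. Qed.
Fact unit_add0 : left_id unit_zero unit_add.
Proof. by move=> x; apply: val_inj; rewrite /= lp_mul1g. Qed.
Fact unit_addN : left_inverse unit_zero unit_opp unit_add.
Proof. by move=> x; apply: val_inj; rewrite /= unit_mulVg //; apply: unit_valP. Qed.

HB.instance Definition _ := GRing.isZmodule.Build U
  unit_addA unit_addC unit_add0 unit_addN.

Lemma unit_valD x y : unit_val (x + y)%R = unit_val x * unit_val y.
Proof. by []. Qed.
Lemma unit_val0 : unit_val (0%R : U) = 1.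
Proof. by []. Qed.
Lemma unit_valN x : unit_val (- x)%R = ladj (unit_val x).
Proof. by []. Qed.

Lemma unit_valMn x i : unit_val (x *+ i)%R = pw (unit_val x) i.
Proof. by elim: i => [|i IH]; rewrite ?pw0 // mulrS unit_valD pwS IH. Qed.

End UnitGroup.

(** The order and the l-group structure of [chain_of] are pulled back along such a
    map. *)
Record chain_embedding (M : zmodType) d (A : lpregroupType d) := ChainEmbedding {
  chain_map :> M -> A;
  chain_map_inj : injective chain_map;
  chain_map0 : chain_map 0%R = 1;
  chain_mapD : forall x y, chain_map (x + y)%R = chain_map x * chain_map y;
  chain_map_total : forall x y, (chain_map x <= chain_map y) || (chain_map y <= chain_map x)
}.

Definition chain_of (M : zmodType) d (A : lpregroupType d) (u : chain_embedding M A) : Type := M.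

Section ChainOf.
Variables (M : zmodType) (d : Order.disp_t) (A : lpregroupType d) (u : chain_embedding M A).
Local Notation C := (chain_of u).
Implicit Types x y z t : C.

HB.instance Definition _ := Choice.copy C M.

Definition chain_le x y := u x <= u y.

Fact chain_le_refl : reflexive chain_le.
Proof. by move=> x; apply: lexx. Qed.
Fact chain_le_anti : antisymmetric chain_le.
Proof. by move=> x y /le_anti/chain_map_inj. Qed.
Fact chain_le_trans : transitive chain_le.
Proof. by move=> y x z; apply: le_trans. Qed.
Fact chain_le_total : total chain_le.
Proof. by move=> x y; apply: chain_map_total. Qed.

HB.instance Definition _ := Order.Le_isPOrder.Build d C
  chain_le_refl chain_le_anti chain_le_trans.
HB.instance Definition _ := Order.POrder_isTotal.Build d C chain_le_total.

Lemma chain_leE x y : (x <= y) = (u x <= u y).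
Proof. by []. Qed.

Definition chain_add x y : C := (x + y : M)%R.
Definition chain_zero : C := (0 : M)%R.
Definition chain_opp x : C := (- x : M)%R.

Fact chain_addA : associative chain_add.
Proof. exact: addrA. Qed.
Fact chain_add0 : left_id chain_zero chain_add.
Proof. exact: add0r. Qed.
Fact chain_addr0 : right_id chain_zero chain_add.
Proof. exact: addr0. Qed.

HB.instance Definition _ := isMonoid.Build C chain_addA chain_add0 chain_addr0.

Fact chain_le_mulg x y z t : x <= y -> z <= t -> x * z <= y * t.
Proof. by rewrite !chain_leE !(chain_mapD u) => xy zt; apply: le_mulg. Qed.

Fact chain_addN x : chain_opp x * x = 1.
Proof. exact: addNr. Qed.
Fact chain_addrN x : x * chain_opp x = 1.
Proof. exact: addrN. Qed.

Fact chain_opp_le1 x : chain_opp x * x <= (1 : C).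
Proof. by rewrite chain_addN. Qed.
Fact chain_opp_ge1 x : (1 : C) <= x * chain_opp x.
Proof. by rewrite chain_addrN. Qed.
Fact chain_ropp_le1 x : x * chain_opp x <= (1 : C).
Proof. by rewrite chain_addrN. Qed.
Fact chain_ropp_ge1 x : (1 : C) <= chain_opp x * x.
Proof. by rewrite chain_addN. Qed.

HB.instance Definition _ := isLpregroup.Build d C
  chain_le_mulg chain_opp_le1 chain_opp_ge1 chain_ropp_le1 chain_ropp_ge1.

Fact chain_ladjE x : ladj x = radj x.
Proof. by []. Qed.

HB.instance Definition _ := Lpregroup_isLgroup.Build d C chain_ladjE.

Lemma chain_abelian : abelian_lgroup C.
Proof. by move=> x y; apply: addrC. Qed.

End ChainOf.

(** * Generators of F_k(Z) and of the lexicographic products *)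

Section Generation.
Variables (k : nat) (k_gt0 : (0 < k)%N).

Lemma ceil_ex : exists c : FnZ k, is_ceil k 0 c.
Proof.
have ex (q : int) : exists r : int, exists m : int,
    [/\ ((m - 1) * k%:Z < q)%R, (q <= m * k%:Z)%R & (r = m * k%:Z)%R].
  have [m [m1 m2]] := @int_ceil k 0%R q k_gt0.
  by exists (m * k%:Z)%R, m; split=> //; lia.
pose h q := sval (cid (ex q)).
have hP q : exists m : int, [/\ ((m - 1) * k%:Z < q)%R, (q <= m * k%:Z)%R & (h q = m * k%:Z)%R].
  exact: svalP (cid (ex q)).
have hE (m q : int) : ((m - 1) * k%:Z < q)%R -> (q <= m * k%:Z)%R -> (h q = m * k%:Z)%R.
  move=> m1 m2; have [j [j1 j2 ->]] := hP q.
  by have -> : j = m by nia.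
have hh : {homo h : p q / p <= q}.
  move=> p q; rewrite -[p]/(p : int) -[q]/(q : int) => pq; have [m [m1 m2 ->]] := hP p; have [j [j1 j2 ->]] := hP q.
  have mj : (m <= j)%R by rewrite leNgt; apply/negP => lt; nia.
  by nia.
have hper q : h (q + k%:Z)%R = (h q + k%:Z)%R.
  have [m [m1 m2 ->]] := hP q; rewrite (hE (m + 1)%R) //; lia.
have [c cE] := Fn_ex k_gt0 hh hper.
by exists c => m x m1 m2; rewrite cE (hE m); lia.
Qed.

(** f is the meet of the maps tr (f i) * c * tr (- i) for i < k, each of which
    lies above f and agrees with f on the class of i modulo k. *)
Lemma Fn_generated (c : FnZ k) (S : set (FnZ k)) : is_ceil k 0 c ->
  subuniverse S -> S (tr k 1) -> S c -> forall f, S f.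
Proof.
move=> cc [[SI _ SM S1] [Sl _]] St Sc f.
have Str (j : int) : S (tr k j).
  have nat_case (i : nat) : S (tr k i%:Z).
    elim: i => [|i IH]; first by rewrite tr0.
    have -> : (i.+1%:Z = 1 + i%:Z)%R by lia.
    by rewrite -trM; apply: SM.
  case: (leP 0%R j) => j0.
    by have -> : (j = `|j|%N%:Z)%R by lia.
  have -> : (j = - `|j|%N%:Z)%R by lia.
  by rewrite -ladj_tr; apply: Sl.
pose g (i : nat) := tr k (app f i%:Z) * c * tr k (- i%:Z).
have Sg i : S (g i) by apply: (SM) => //; apply: (SM).
have gE (i : nat) (m q : int) : (i%:Z + (m - 1) * k%:Z < q)%R ->
    (q <= i%:Z + m * k%:Z)%R -> app (g i) q = (app f (i%:Z + m * k%:Z))%R.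
  move=> h1 h2; rewrite /g !appM !app_tr (cc m); [|lia|lia].
  by rewrite app_perM; lia.
have fg i : f <= g i.
  apply/app_leP => q; have [m [m1 m2]] := @int_ceil k i%:Z q k_gt0.
  by rewrite (gE i m) // app_mono.
pose G := fix G m := if m is m'.+1 then G m' `&` g m else g 0%N.
have SG m : S (G m) by elim: m => [|m IH] /=; [apply: Sg | apply: SI].
have Gf m (i : nat) (j : int) : (i <= m)%N ->
    app (G m) (i%:Z + j * k%:Z)%R <= app f (i%:Z + j * k%:Z)%R.
  have self (l : nat) : app (g l) (l%:Z + j * k%:Z)%R = app f (l%:Z + j * k%:Z)%R.
    by apply: gE; lia.
  elim: m => [|m IH]; first by rewrite leqn0 => /eqP->; rewrite self.
  rewrite leq_eqVlt ltnS => /orP[/eqP->|im]; rewrite appI.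
    by rewrite leIx self lexx orbT.
  by rewrite leIx IH.
have fG m : f <= G m by elim: m => [|m IH] //=; rewrite lexI IH fg.
suff -> : f = G k.-1 by apply: SG.
apply: le_anti; rewrite fG /=; apply/app_leP => q.
have [m [m1 m2]] := @int_floor k 0%R q k_gt0.
have [i [ik ->]] : exists i : nat, (i < k)%N /\ (q = i%:Z + m * k%:Z)%R.
  by exists `|(q - m * k%:Z)%R|%N; lia.
by apply: Gf; lia.
Qed.

Variables (dH : Order.disp_t) (H : orderedLgroupType dH).
Local Notation L := (lexprod H (FnZ k)).

Lemma lexprod_meetE (x y : L) : x `&` y =
  if x.1 < y.1 then x else if y.1 < x.1 then y else (x.1, x.2 `&` y.2).
Proof. by []. Qed.

Lemma lexprod_joinE (x y : L) : x `|` y =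
  if x.1 < y.1 then y else if y.1 < x.1 then x else (x.1, x.2 `|` y.2).
Proof. by []. Qed.

Lemma lexprod_generated (c : FnZ k) (S : set L) : is_ceil k 0 c ->
  subuniverse S -> (forall h : H, S (h, 1)) -> S (1, tr k 1) -> S (1, c) ->
  forall x, S x.
Proof.
move=> cc [[SI SU SM S1] [Sl Sr]] Sh St Sc [h f].
have -> : (h, f) = ((h, 1) : L) * ((1, f) : L) :> L.
  by congr (_, _); rewrite ?lp_mul1g ?lp_mulg1.
apply: (SM); first exact: Sh.
apply: (@Fn_generated c [set f | S (1, f)]%classic) => //.
split; first split=> //.
- move=> x y Sx Sy; have := SI _ _ Sx Sy.
  by rewrite lexprod_meetE /= ltxx.
- move=> x y Sx Sy; have := SU _ _ Sx Sy.
  by rewrite lexprod_joinE /= ltxx.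
- move=> x y Sx Sy; have := SM _ _ Sx Sy.
  by rewrite -[_ * _]/(lexprod_mul _ _) /lexprod_mul /= lp_mul1g.
- split=> x Sx.
    by have := Sl _ Sx; rewrite -[ladj _]/(lexprod_ladj _) /lexprod_ladj /= ladj1.
  by have := Sr _ Sx; rewrite -[radj _]/(lexprod_radj _) /lexprod_radj /= radj1.
Qed.

Lemma lexprod_fg : finitely_generated H -> finitely_generated L.
Proof.
move=> [hs gen]; have [c cc] := ceil_ex.
exists ([:: (1, tr k 1); (1, c)] ++ [seq (h, 1) | h <- hs]) => S Ssub Sgen.
have [[SI SU SM S1] [Sl Sr]] := Ssub.
apply: (lexprod_generated cc Ssub).
- apply: (gen [set h | S (h, 1)]%classic).
    split; first split=> //.
    + move=> x y Sx Sy; have := SI _ _ Sx Sy; rewrite /= lexprod_meetE /= meetxx.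
      by case: (ltgtP x y) => [xy|yx|->]; rewrite ?meetxx.
    + move=> x y Sx Sy; have := SU _ _ Sx Sy; rewrite /= lexprod_joinE /= joinxx.
      by case: (ltgtP x y) => [xy|yx|->]; rewrite ?joinxx.
    + move=> x y Sx Sy; have := SM _ _ Sx Sy.
      by rewrite -[_ * _]/(lexprod_mul _ _) /lexprod_mul /= lp_mul1g.
    + split=> x Sx.
        by have := Sl _ Sx; rewrite -[ladj _]/(lexprod_ladj _) /lexprod_ladj /= ladj1.
      by have := Sr _ Sx; rewrite -[radj _]/(lexprod_radj _) /lexprod_radj /= radj1.
  by move=> h hhs; apply: Sgen; rewrite mem_cat map_f ?orbT.
- by apply: Sgen; rewrite mem_cat inE eqxx.
- by apply: Sgen; rewrite mem_cat !inE eqxx orbT.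
Qed.

End Generation.

(** * The coordinates of a locally embeddable algebra *)

Section Structure.
Variables (n : nat) (n_gt0 : (0 < n)%N).
Variables (d : Order.disp_t) (A : lpregroupType d) (s e : A) (k : nat).
Hypothesis k_gt0 : (0 < k)%N.
Hypothesis per : forall x : A, iter n ll x = x.
Hypothesis loc : locally_rounding n s e k.
Hypothesis sk_comm : pw s k * e = e * pw s k.

Lemma rounding_periodic : locally_periodic n s.
Proof. by move=> X N; have [f [p [F _ _]]] := loc X N; exists f. Qed.

Let loc1 := rounding_periodic.

Definition rounding_comm : units_commute A := @lp_unit_comm n d A s loc1.

Local Notation G := (unit_group rounding_comm).
Local Notation val := (@unit_val d A rounding_comm).
Implicit Types (a b : A) (x y z : G) (i j t : int).

Definition shift : G := to_unit rounding_comm (s_unit loc1).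

Definition actG a x : G := to_unit rounding_comm (act_unit n_gt0 e per a (val x)).

Let vu x : lp_unit (val x) := unit_valP x.

Lemma actGE a x : val (actG a x) = act n e a (val x). Proof. by []. Qed.

Lemma shiftMn (m : nat) : val (shift *+ m)%R = pw s m.
Proof. by rewrite unit_valMn. Qed.

Lemma val_le_total x y : (val x <= val y) || (val y <= val x).
Proof. exact: (lp_unit_total n_gt0 loc1). Qed.

Lemma val_leD2r x y z : (val (x + z)%R <= val (y + z)%R) = (val x <= val y).
Proof. by rewrite !unit_valD unit_le2r. Qed.

Lemma val_leD2l x y z : (val (z + x)%R <= val (z + y)%R) = (val x <= val y).
Proof. by rewrite !unit_valD unit_le2l. Qed.

Lemma shift_pos (m : nat) : val 0%R <= val (shift *+ m)%R.
Proof. by rewrite shiftMn pw_ge1 ?(s_ge1 n_gt0 loc1). Qed.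

Lemma shift_le i j : (val (shift *~ i)%R <= val (shift *~ j)%R) = (i <= j).
Proof.
apply/idP/idP => [h|ij].
  rewrite leNgt; apply/negP => lt.
  have [m iE] : exists m : nat, (i = j + m.+1%:Z)%R by exists `|(i - j - 1)%R|%N; lia.
  move: h; rewrite iE mulrzDr -[X in _ <= val X]addr0 val_leD2l.
  rewrite -pmulrn shiftMn pwSr => h.
  have := s_not_le1 loc1; rewrite (le_trans _ h) //.
  by rewrite -{1}[s]lp_mul1g le_mulg ?pw_ge1 ?(s_ge1 n_gt0 loc1).
have [m ->] : exists m : nat, (j = i + m%:Z)%R by exists `|(j - i)%R|%N; lia.
by rewrite mulrzDr -[X in val X <= _]addr0 val_leD2l -pmulrn shift_pos.
Qed.

Lemma shift_inj i j : (shift *~ i = shift *~ j)%R -> i = j.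
Proof. by move=> ij; apply: le_anti; rewrite -!shift_le ij lexx. Qed.

Lemma between_shift x y (m : nat) : val x <= val y -> val y <= val (x + shift *+ m)%R ->
  exists t, y = (x + shift *~ t)%R.
Proof.
move=> xy; elim: m => [|m IH] ym.
  exists 0%R; apply: unit_val_inj; apply: le_anti.
  by move: ym; rewrite mulr0n mulr0z addr0 xy => ->.
have [le|nle] := boolP (val y <= val (x + shift *+ m)%R); first exact: IH.
exists m.+1%:Z%R; apply: unit_val_inj; apply: le_anti.
rewrite -pmulrn ym andTb.
have := lp_unit_succ n_gt0 loc1 (vu _) (vu _) nle.
by have -> : (x + shift *+ m.+1 = shift + (x + shift *+ m))%R by rewrite mulrS addrCA.
Qed.

Definition central x := val x * e = e * val x.

Lemma actG_le a b x y : a <= b -> val x <= val y -> val (actG a x) <= val (actG b y).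
Proof. exact: le_act. Qed.

Lemma actGM a b x : actG (a * b) x = actG a (actG b x).
Proof. by apply: unit_val_inj; rewrite !actGE (act_mul n_gt0 k_gt0 loc). Qed.

Lemma actG1 x : actG 1 x = x.
Proof. by apply: unit_val_inj; rewrite actGE (act1 n_gt0 k_gt0 loc). Qed.

Lemma actG_translation x y : actG (val x) y = (x + y)%R.
Proof. by apply: unit_val_inj; rewrite actGE (act_translation n_gt0 k_gt0 loc). Qed.

Lemma actGD a x z : central z -> actG a (x + z)%R = (actG a x + z)%R.
Proof.
by move=> zc; apply: unit_val_inj; rewrite actGE unit_valD (act_mulr n_gt0 k_gt0 loc).
Qed.

Lemma actG_meet a b x : actG (a `&` b) x = actG a x \/ actG (a `&` b) x = actG b x.
Proof.
case/orP: (val_le_total (actG a x) (actG b x)) => [/meet_idPl h|/meet_idPr h];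
  [left|right]; apply: unit_val_inj; rewrite actGE (act_meet n_gt0 k_gt0 loc) //.
Qed.

Lemma actG_join a b x : actG (a `|` b) x = actG a x \/ actG (a `|` b) x = actG b x.
Proof.
case/orP: (val_le_total (actG a x) (actG b x)) => [/join_idPr h|/join_idPl h];
  [right|left]; apply: unit_val_inj; rewrite actGE (act_join n_gt0 k_gt0 loc) //.
Qed.

Lemma central0 : central 0%R.
Proof. by rewrite /central unit_val0 lp_mul1g lp_mulg1. Qed.

Lemma centralD x y : central x -> central y -> central (x + y)%R.
Proof.
by rewrite /central unit_valD => xc yc; rewrite -lp_mulgA yc lp_mulgA xc lp_mulgA.
Qed.

Lemma centralN x : central x -> central (- x)%R.
Proof.
rewrite /central unit_valN => xc.
by rewrite -{1}(unit_mulgK e (vu x)) -xc !lp_mulgA unit_mulVg ?lp_mul1g.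
Qed.

Lemma centralMz x t : central x -> central (x *~ t)%R.
Proof.
move=> xc; have nat_case (m : nat) : central (x *+ m)%R.
  by elim: m => [|m IH]; rewrite ?mulrS; [exact: central0 | exact: centralD].
case: t => m; first by rewrite -pmulrn.
by rewrite NegzE mulrNz -pmulrn; apply: centralN.
Qed.

Lemma central_shiftk : central (shift *+ k)%R.
Proof. by rewrite /central shiftMn. Qed.

(** The conjugates of e by the powers of s repeat with period k. *)
Lemma central_decomposition x : exists2 i : nat, (i < k)%N &
  exists2 z, central z & x = (shift *+ i + z)%R.
Proof.
have [i ik ic] := unit_shift_commutes n_gt0 k_gt0 loc (vu x).
have {}ic : central (x + shift *+ i)%R by rewrite /central unit_valD shiftMn.
case: i => [|i] in ik ic *.
  by exists 0%N => //; exists x; rewrite ?add0r // -[x]addr0.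
exists (k - i.+1)%N; first by lia.
exists (x + shift *+ i.+1 - shift *+ k)%R.
  by apply: centralD => //; apply: centralN central_shiftk.
by rewrite mulrnBr 1?addrC 1?addrA ?subrK ?addrK //; lia.
Qed.

Lemma not_addk_le x : ~~ (val (x + shift *+ k)%R <= val x).
Proof.
rewrite -[X in _ <= val X]addr0 val_leD2l pmulrn -(mulr0z shift) shift_le.
by rewrite -ltNge; lia.
Qed.

Section FinitelyGenerated.
Variable gs : seq A.
Hypothesis gen : forall S : set A,
  subuniverse S -> (forall a, a \in gs -> S a) -> forall a, S a.

(** The elements that map the subgroup P generated by these units to itself form
    a subuniverse, hence are all the elements; in particular P contains the
    image of 1 under each unit.  For the adjoints: a (ladj a x) exceeds x by at
    most s^k, so it is x times a power of s, and a (ladj a x) determines ladj a x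
    up to elements of P. *)
Lemma units_generated :
  generated_by shift [seq actG a (shift *+ i)%R | a : A <- gs, i : nat <- iota 0 k].
Proof.
move=> P Ps Pg PB.
have P0 : P 0%R by rewrite -(subrr shift); apply: PB.
have PN x : P x -> P (- x)%R by rewrite -sub0r; apply: PB.
have PD x y : P x -> P y -> P (x + y)%R.
  by move=> Px Py; rewrite -[y]opprK; apply: PB => //; apply: PN.
have PMn (m : nat) : P (shift *+ m)%R.
  by elim: m => [|m IH]; rewrite ?mulrS ?mulr0n //; apply: PD.
have PMz t : P (shift *~ t)%R.
  by case: t => m; rewrite ?NegzE ?mulrNz -pmulrn //; apply: PN.
have Pnear x y (m : nat) : val x <= val y -> val y <= val (x + shift *+ m)%R ->
    P x <-> P y.
  move=> h1 h2; have [t yE] := between_shift h1 h2.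
  by rewrite yE; split=> [Px|Pxt]; [apply: PD | rewrite -[x](addrK (shift *~ t)%R); apply: PB].
pose S a := forall x, P x -> P (actG a x).
have all_S a : S a.
  apply: (gen (S := S)) => [|{}a ags x Px]; last first.
    have [i ik [z zc xE]] := central_decomposition x.
    rewrite xE actGD //; apply: PD.
      apply: Pg; apply/allpairsP; exists (a, i); rewrite mem_iota add0n.
      by split.
    have -> : z = (x - shift *+ i)%R by rewrite xE addrAC subrr add0r.
    exact: PB.
  split; first split.
  - by move=> a1 a2 S1 S2 x Px; case: (actG_meet a1 a2 x) => ->; [apply: S1 | apply: S2].
  - by move=> a1 a2 S1 S2 x Px; case: (actG_join a1 a2 x) => ->; [apply: S1 | apply: S2].
  - by move=> a1 a2 S1 S2 x Px; rewrite actGM; apply/S1/S2.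
  - by move=> x Px; rewrite actG1.
  split=> {}a Sa x Px.
  - set y := actG (ladj a) x.
    have xy : val x <= val (actG a y).
      by rewrite -actGM -{1}[x]actG1 actG_le ?mulg_ladj_ge1.
    have ymin u : val x <= val (actG a u) -> val y <= val u.
      move=> xt; rewrite -[u]actG1.
      apply: (@le_trans _ _ (val (actG (ladj a * a) u))).
        by rewrite actGM actG_le.
      by rewrite actG_le ?ladj_mulg_le1.
    have [i ik [z zc yE]] := central_decomposition y.
    pose w := actG a (shift *+ i)%R.
    have Pw : P w by apply: Sa.
    have ayE : actG a y = (w + z)%R by rewrite yE actGD.
    have ayk : actG a (y - shift *+ k)%R = (w + z - shift *+ k)%R.
      by rewrite actGD ?ayE //; apply: centralN central_shiftk.
    have near : val (w + z)%R <= val (x + shift *+ k)%R.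
      case/orP: (val_le_total x (w + z - shift *+ k)%R) => [h|].
        have := ymin (y - shift *+ k)%R; rewrite ayk => /(_ h).
        by rewrite -{1}[y](subrK (shift *+ k)%R) (negPf (not_addk_le _)).
      by rewrite -(val_leD2r _ _ (shift *+ k)%R) subrK.
    rewrite ayE in xy; have Pwz := (Pnear _ _ _ xy near).1 Px.
    have -> : y = (shift *+ i + (w + z - w))%R by rewrite yE [(w + z - w)%R]addrAC subrr add0r.
    by apply: PD => //; apply: PB.
  - set y := actG (radj a) x.
    have yx : val (actG a y) <= val x.
      by rewrite -actGM -{2}[x]actG1 actG_le ?mulg_radj_le1.
    have ymax u : val (actG a u) <= val x -> val u <= val y.
      move=> tx; rewrite -{1}[u]actG1.
      apply: (@le_trans _ _ (val (actG (radj a * a) u))).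
        by rewrite actG_le ?radj_mulg_ge1.
      by rewrite actGM actG_le.
    have [i ik [z zc yE]] := central_decomposition y.
    pose w := actG a (shift *+ i)%R.
    have Pw : P w by apply: Sa.
    have ayE : actG a y = (w + z)%R by rewrite yE actGD.
    have ayk : actG a (y + shift *+ k)%R = (w + z + shift *+ k)%R.
      by rewrite actGD ?ayE //; apply: central_shiftk.
    have near : val x <= val (w + z + shift *+ k)%R.
      case/orP: (val_le_total x (w + z + shift *+ k)%R) => // h.
      have := ymax (y + shift *+ k)%R; rewrite ayk => /(_ h).
      by rewrite (negPf (not_addk_le _)).
    rewrite ayE in yx; have Pwz := (Pnear _ _ _ yx near).2 Px.
    have -> : y = (shift *+ i + (w + z - w))%R by rewrite yE [(w + z - w)%R]addrAC subrr add0r.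
    by apply: PD => //; apply: PB.
by move=> x; have := all_S (val x) 0%R P0; rewrite actG_translation addr0.
Qed.

End FinitelyGenerated.

(** If x >= 1 and x^m is a power of s, then x lies between 1 and a power of s;
    as s is the least unit above 1, x is a power of s too. *)
Lemma shift_torsion (m : int) x : (m != 0)%R ->
  (exists j, (x *~ m = shift *~ j)%R) -> exists j, x = (shift *~ j)%R.
Proof.
move=> m0 [j xm].
wlog x0 : x j xm / val 0%R <= val x => [H|].
  case/orP: (val_le_total 0%R x) => [|x0]; first exact: H xm.
  have [||t xt] := H (- x)%R (- j)%R.
  - by rewrite mulNrz xm mulrNz.
  - by rewrite -(val_leD2r _ _ x) addNr add0r.
  by exists (- t)%R; rewrite mulrNz -xt opprK.
wlog mp : m j m0 xm / (0 < m)%R => [H|].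
  case: (ltP 0%R m) => [|mn]; first exact: H xm.
  by apply: (H (- m)%R (- j)%R); rewrite ?mulrNz ?xm //; lia.
have {xm} xm : (x *+ `|m|.-1.+1 = shift *~ j)%R.
  by rewrite -xm pmulrn; congr (_ *~ _)%R; lia.
have pos (i : nat) : val 0%R <= val (x *+ i)%R.
  elim: i => [|i IH]; rewrite ?mulr0n ?lexx // mulrS.
  by apply: le_trans x0 _; rewrite -{1}[x]addr0 val_leD2l.
have [|t ->] := @between_shift 0%R x `|j|%N x0; last by exists t; rewrite add0r.
rewrite add0r pmulrn; apply: (@le_trans _ _ (val (shift *~ j)%R)); last first.
  by rewrite shift_le; lia.
by rewrite -xm mulrS -{1}[x]addr0 val_leD2l.
Qed.

(** A free complement of the powers of s can be moved by powers of s into the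
    units that commute with e. *)
Lemma central_complement (gs : seq A) :
  (forall S : set A, subuniverse S -> (forall a, a \in gs -> S a) -> forall a, S a) ->
  exists r, exists h : 'I_r -> G, [/\ spans shift h,
    forall j c, (shift *~ j + comb h c = 0)%R -> forall l, (c l = 0)%R &
    forall l, central (h l)].
Proof.
move=> gen.
have [r [h sp fr]] := free_complement shift_torsion (units_generated gen).
have ex l : exists t, central (h l - shift *~ t)%R.
  have [i _ [z zc ->]] := central_decomposition (h l).
  by exists i%:Z%R; rewrite -pmulrn addrAC subrr add0r.
pose T l := sval (cid (ex l)).
have TP l : central (h l - shift *~ T l)%R := svalP (cid (ex l)).
pose h' l := (h l - shift *~ T l)%R.
have combE c : (comb h c = comb h' c + shift *~ \sum_(l < r) T l * c l)%R.
  rewrite /comb mulrz_sumr -big_split /=; apply: eq_bigr => l _.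
  by rewrite mulrzBl -mulrzA subrK.
exists r, h'; split=> [x|j c rel|//].
  have [j [c ->]] := sp x.
  exists (j + \sum_(l < r) T l * c l)%R, c.
  by rewrite combE mulrzDr -addrA [(comb _ _ + _)%R]addrC.
apply: (fr (j - \sum_(l < r) T l * c l)%R).
by rewrite combE mulrzBr addrACA addNr addr0.
Qed.

Section Coordinates.
Variables (r : nat) (h : 'I_r -> G).
Hypotheses (sp : spans shift h)
  (fr : forall j c, (shift *~ j + comb h c = 0)%R -> forall l, (c l = 0)%R)
  (hc : forall l, central (h l)).

Local Notation M := {ffun 'I_r -> int}.
Implicit Types c : M.

Definition iota c : G := comb h c.

Lemma iotaD c c' : (iota (c + c') = iota c + iota c')%R.
Proof.
rewrite /iota /comb -big_split /=; apply: eq_bigr => l _.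
by rewrite ffunE mulrzDr.
Qed.

Lemma iota0 : iota 0%R = 0%R.
Proof. by apply: (@addIr _ (iota 0%R)); rewrite -iotaD !add0r. Qed.

Lemma iotaN c : iota (- c)%R = (- iota c)%R.
Proof. by apply: (@addIr _ (iota c)); rewrite -iotaD !addNr iota0. Qed.

Lemma iota_central c : central (iota c).
Proof.
rewrite /iota /comb; elim/big_ind: _ => [|x y|l _]; first exact: central0.
  exact: centralD.
exact: centralMz.
Qed.

Lemma coord_uniq i j c c' : (shift *~ i + iota c = shift *~ j + iota c')%R ->
  i = j /\ c = c'.
Proof.
move=> E.
have ijc : (shift *~ (i - j) + iota (c - c') = 0)%R.
  by rewrite mulrzBr iotaD iotaN addrACA E -opprD subrr.
have cc : c = c'.
  apply/ffunP => l; have := fr ijc l; rewrite !ffunE => /eqP.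
  by rewrite subr_eq0 => /eqP.
by split=> //; apply: shift_inj; move: E; rewrite cc => /addIr.
Qed.

Lemma coord_ex x : exists p : int * M, x = (shift *~ p.1 + iota p.2)%R.
Proof.
have [j [c ->]] := sp x; exists (j, [ffun l => c l]); congr (_ + _)%R.
by apply: eq_bigr => l _; rewrite ffunE.
Qed.

Definition phi x : int := (sval (cid (coord_ex x))).1.
Definition pi x : M := (sval (cid (coord_ex x))).2.

Lemma coordE x : x = (shift *~ phi x + iota (pi x))%R.
Proof. exact: svalP (cid (coord_ex x)). Qed.

Lemma coordK j c : phi (shift *~ j + iota c)%R = j /\ pi (shift *~ j + iota c)%R = c.
Proof.
by have [<- <-] := coord_uniq (coordE (shift *~ j + iota c)%R).
Qed.

Lemma pi_shift x t : pi (x + shift *~ t)%R = pi x.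
Proof.
rewrite {1}[x]coordE addrAC -mulrzDr.
by have [_ ->] := coordK (phi x + t)%R (pi x).
Qed.

Lemma phi_shift x t : phi (x + shift *~ t)%R = (phi x + t)%R.
Proof.
rewrite {1}[x]coordE addrAC -mulrzDr.
by have [-> _] := coordK (phi x + t)%R (pi x).
Qed.

Lemma coord_le_same i j c :
  (val (shift *~ i + iota c)%R <= val (shift *~ j + iota c)%R) = (i <= j).
Proof. by rewrite val_leD2r shift_le. Qed.

(** Distinct elements of the complement are further apart than any multiple of
    the shift, by [between_shift]; this makes the order lexicographic. *)
Lemma coord_le_diff i j c c' : c <> c' -> val (iota c) <= val (iota c') ->
  val (shift *~ i + iota c)%R <= val (shift *~ j + iota c')%R.
Proof.
move=> cc le; case/orP: (val_le_total (shift *~ i + iota c)%R (shift *~ j + iota c')%R) => // h2.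
have [|t E] := @between_shift (iota c) (iota c') `|(i - j)%R|%N le.
  apply: (@le_trans _ _ (val (iota c + shift *~ (i - j))%R)); last first.
    by rewrite val_leD2l pmulrn shift_le; lia.
  rewrite -(val_leD2l _ _ (shift *~ j)%R); apply: le_trans h2 _.
  by rewrite mulrzBr addrCA [(shift *~ j + _)%R]addrC subrK [(iota c + _)%R]addrC lexx.
case: cc; have := pi_shift (iota c) t; rewrite -E => e1.
have [_ p1] := coordK 0%R c; have [_ p2] := coordK 0%R c'.
by move: p1 p2; rewrite mulr0z !add0r => <- <-.
Qed.

Fact iota_inj : injective (fun c => val (iota c)).
Proof.
move=> c c' /unit_val_inj E.
have E' : (shift *~ 0 + iota c = shift *~ 0 + iota c')%R by rewrite E.
by have [_ ->] := coord_uniq E'.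
Qed.

Fact val_iota0 : val (iota 0%R) = 1. Proof. by rewrite iota0. Qed.
Fact val_iotaD c c' : val (iota (c + c')%R) = val (iota c) * val (iota c').
Proof. by rewrite iotaD. Qed.
Fact val_iota_total c c' :
  (val (iota c) <= val (iota c')) || (val (iota c') <= val (iota c)).
Proof. exact: val_le_total. Qed.

Definition complement : orderedLgroupType d :=
  chain_of (ChainEmbedding iota_inj val_iota0 val_iotaD val_iota_total).

Lemma complement_fg : finitely_generated complement.
Proof.
pose delta (l : 'I_r) : complement := [ffun l' => (l == l')%:R%R : int].
exists [seq delta l | l <- enum 'I_r] => S [[_ _ SM S1] [Sl _]] Sd x.
have Sn (l : 'I_r) (m : nat) : S (([ffun l' => (l == l')%:R%R : int] : M) *+ m)%R.
  elim: m => [|m IH]; first exact: S1.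
  by rewrite mulrS; apply: SM => //; apply: Sd; rewrite map_f ?mem_enum.
have Sz (l : 'I_r) (m : int) : S (([ffun l' => (l == l')%:R%R : int] : M) *~ m)%R.
  case: m => m; first by rewrite -pmulrn.
  by rewrite NegzE mulrNz -pmulrn; apply: Sl.
have mzE (y : M) (m : int) l : ((y *~ m) l = y l * m)%R.
  case: m => m; first by rewrite -pmulrn ffunMnE -mulrzz -pmulrn.
  by rewrite NegzE !mulrNz -pmulrn ffunE ffunMnE -mulrzz mulrNz -pmulrn.
have -> : x = (\sum_(l < r) ([ffun l' => (l == l')%:R%R : int] : M) *~ (x : M) l)%R :> M.
  apply/ffunP => l0; rewrite sum_ffunE (bigD1 l0) //= big1 ?addr0 => [|l ll0].
    by rewrite mzE ffunE eqxx mul1r.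
  by rewrite mzE ffunE (negPf ll0) mul0r.
by elim/big_ind: _ => [|y z Sy Sz'|l _]; [exact: S1 | exact: SM | exact: Sz].
Qed.

(** All the images under a of multiples of the shift lie within finitely many
    shifts of each other. *)
Lemma pi_act a i : pi (actG a (shift *~ i)%R) = pi (actG a 0%R).
Proof.
pose m := (k * `|i|)%N.
have mE : (shift *+ m = 0 + shift *+ k *+ `|i|)%R by rewrite add0r mulrnA.
have mN : (- (shift *+ m) = 0 + - (shift *+ k *+ `|i|))%R by rewrite add0r mulrnA.
have cm : central (shift *+ k *+ `|i|)%R.
  by rewrite pmulrn; apply: centralMz central_shiftk.
have im : (`|i| <= m)%N by apply: leq_pmull.
have lo : val (actG a 0 - shift *+ m)%R <= val (actG a (shift *~ i)%R).
  rewrite {1}/m mulrnA -actGD; last exact: centralN.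
  rewrite -mN; apply: actG_le => //.
  by rewrite pmulrn -mulrNz shift_le; lia.
have [|t ->] := @between_shift _ _ (m + m) lo.
  rewrite mulrnDr addrA subrK {1}/m mulrnA -actGD // -mE.
  by apply: actG_le => //; rewrite pmulrn shift_le; lia.
by rewrite pi_shift pmulrn -mulrNz pi_shift.
Qed.

Lemma actG_coord a i :
  actG a (shift *~ i)%R = (shift *~ phi (actG a (shift *~ i)) + iota (pi (actG a 0)))%R.
Proof. by rewrite {1}[actG a _]coordE pi_act. Qed.

Lemma local_part_ex a : exists f : FnZ k,
  forall i, app f i = phi (actG a (shift *~ i)%R).
Proof.
have [|i|f fE] := @Fn_ex k (fun i => phi (actG a (shift *~ i)%R)) k_gt0.
- move=> i j ij; rewrite -(coord_le_same _ _ (pi (actG a 0%R))) -!actG_coord.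
  by apply: actG_le => //; rewrite shift_le.
- rewrite mulrzDr -pmulrn (actGD _ _ central_shiftk) pmulrn.
  by rewrite phi_shift.
by exists f.
Qed.

(** How a acts on the multiples of the shift, up to the complement *)
Definition local_part a : FnZ k := sval (cid (local_part_ex a)).

Lemma local_partE a i : app (local_part a) i = phi (actG a (shift *~ i)%R).
Proof. exact: svalP (cid (local_part_ex a)) i. Qed.

Local Notation L := (lexprod complement (FnZ k)).

Definition decompose a : L := (pi (actG a 0%R) : complement, local_part a).

Lemma actG_decompose a i : actG a (shift *~ i)%R =
  (shift *~ app (decompose a).2 i + iota (decompose a).1)%R.
Proof. by rewrite local_partE -actG_coord. Qed.

Lemma complement_leE (c c' : complement) : (c <= c') = (val (iota c) <= val (iota c')).
Proof. by []. Qed.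

Lemma decompose_le a b : (decompose a <= decompose b) = (a <= b).
Proof.
rewrite lexprod_leE; apply/idP/idP.
- move=> hab; apply: (act_faithful n_gt0 k_gt0 loc) => i _.
  rewrite -shiftMn -!actGE pmulrn !actG_decompose.
  case/orP: hab => [|/andP[/eqP-> /app_leP hab]]; last by rewrite coord_le_same.
  rewrite lt_neqAle complement_leE => /andP[/eqP ne le].
  exact: coord_le_diff.
- move=> ab; have le i : val (actG a (shift *~ i)%R) <= val (actG b (shift *~ i)%R).
    exact: actG_le.
  have [E|/eqP ne] := eqVneq (decompose a).1 (decompose b).1.
    apply/orP; right; apply/app_leP => q.
    by have := le q; rewrite !actG_decompose E coord_le_same.
  apply/orP; left; rewrite lt_neqAle complement_leE.
  apply/andP; split; first exact/eqP.
  case/orP: (val_le_total (iota (decompose a).1) (iota (decompose b).1)) => // ge.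
  have ge' := coord_le_diff (app (decompose b).2 0%R) (app (decompose a).2 0%R)
    (fun E => ne (esym E)) ge.
  have E : actG a (shift *~ 0)%R = actG b (shift *~ 0)%R.
    apply: unit_val_inj; apply: le_anti; rewrite le andTb.
    by rewrite !actG_decompose.
  by case: ne; rewrite /decompose /= -(mulr0z shift) E.
Qed.

Lemma decompose_mul : {morph decompose : a b / a * b}.
Proof.
move=> a b.
have E i : actG (a * b) (shift *~ i)%R =
    (shift *~ app (decompose a).2 (app (decompose b).2 i) +
     iota ((decompose a).1 + (decompose b).1 : M)%R)%R.
  rewrite actGM [actG b _]actG_decompose actGD; last exact: iota_central.
  by rewrite actG_decompose iotaD addrA.
congr (_, _).
  by have := E 0%R; rewrite {1}mulr0z /= => ->; rewrite (coordK _ _).2.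
apply: app_ext => i; rewrite local_partE E.
by rewrite (coordK _ _).1.
Qed.

Lemma pi0 : pi 0%R = 0%R.
Proof. by have [_] := coordK 0%R 0%R; rewrite mulr0z iota0 addr0. Qed.

Lemma decompose1 : decompose 1 = 1.
Proof.
congr (_, _).
  by rewrite actG1 pi0.
apply: app_ext => i; rewrite local_partE actG1 app1.
by have [] := coordK i 0%R; rewrite iota0 addr0.
Qed.

Lemma decompose_inj : injective decompose.
Proof. by move=> a b E; apply: le_anti; rewrite -!decompose_le E lexx. Qed.

Lemma decompose_meet : {morph decompose : a b / a `&` b}.
Proof.
move=> a b; rewrite lexprod_meetE.
have low a' b' : (decompose a').1 < (decompose b').1 -> a' <= b'.
  by move=> lt; rewrite -decompose_le lexprod_leE lt.
case: (ltgtP (decompose a).1 (decompose b).1) => [/low ab|/low ba|E].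
- by rewrite (meet_idPl ab).
- by rewrite (meet_idPr ba).
have F i : actG (a `&` b) (shift *~ i)%R =
    (shift *~ (app (decompose a).2 i `&` app (decompose b).2 i)%O + iota (decompose a).1)%R.
  apply: unit_val_inj; rewrite actGE (act_meet n_gt0 k_gt0 loc) // -!actGE !actG_decompose -E.
  case: (leP (app (decompose a).2 i) (app (decompose b).2 i)) => le.
    by rewrite (meet_idPl _) // coord_le_same.
  by rewrite (meet_idPr _) // coord_le_same ltW.
congr (_, _).
  by have := F 0%R; rewrite {1}mulr0z => ->; rewrite (coordK _ _).2.
apply: app_ext => i; rewrite local_partE F appI.
by rewrite (coordK _ _).1.
Qed.

Lemma decompose_join : {morph decompose : a b / a `|` b}.
Proof.
move=> a b; rewrite lexprod_joinE.
have low a' b' : (decompose a').1 < (decompose b').1 -> a' <= b'.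
  by move=> lt; rewrite -decompose_le lexprod_leE lt.
case: (ltgtP (decompose a).1 (decompose b).1) => [/low ab|/low ba|E].
- by rewrite (join_idPr ab).
- by rewrite (join_idPl ba).
have F i : actG (a `|` b) (shift *~ i)%R =
    (shift *~ (app (decompose a).2 i `|` app (decompose b).2 i)%O + iota (decompose a).1)%R.
  apply: unit_val_inj; rewrite actGE (act_join n_gt0 k_gt0 loc) // -!actGE !actG_decompose -E.
  case: (leP (app (decompose a).2 i) (app (decompose b).2 i)) => le.
    by rewrite (join_idPr _) // coord_le_same.
  by rewrite (join_idPl _) // coord_le_same ltW.
congr (_, _).
  by have := F 0%R; rewrite {1}mulr0z => ->; rewrite (coordK _ _).2.
apply: app_ext => i; rewrite local_partE F appU.
by rewrite (coordK _ _).1.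
Qed.

Lemma decompose_morphism : lp_morphism decompose.
Proof.
split; first split; [exact: decompose_meet | exact: decompose_join
  | exact: decompose_mul | exact: decompose1 | split=> a].
- by apply: ladj_uniq; rewrite -decompose_mul -decompose1 decompose_le
    ?ladj_mulg_le1 ?mulg_ladj_ge1.
- by apply: radj_uniq; rewrite -decompose_mul -decompose1 decompose_le
    ?mulg_radj_le1 ?radj_mulg_ge1.
Qed.

Lemma decompose_unit x c i : x = (shift *~ i + iota c)%R ->
  decompose (val x) = (c : complement, tr k i).
Proof.
move=> xE; congr (_, _).
  by rewrite actG_translation addr0 xE; case: (coordK i c).
apply: app_ext => j; rewrite local_partE actG_translation xE app_tr.
by rewrite addrAC -mulrzDr (coordK _ _).1 addrC.
Qed.

Lemma decompose_e : (decompose e).1 = 1 /\ is_ceil k 0 (decompose e).2.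
Proof.
have act0 : actG e 0%R = 0%R.
  apply: unit_val_inj; rewrite actGE unit_val0 -(pw0 s).
  by apply: (act_ceiling n_gt0 k_gt0 loc (m := 0%R)); lia.
split.
  by rewrite /decompose act0 [LHS]pi0.
move=> m x h1 h2.
have [i [i1 ik xE]] : exists i : nat, [/\ (0 < i)%N, (i <= k)%N &
    (x = i%:Z + (m - 1) * k%:Z)%R].
  by exists `|(x - (m - 1) * k%:Z)%R|%N; split; lia.
rewrite xE app_perM local_partE.
have -> : actG e (shift *~ i%:Z)%R = (shift *~ k%:Z + iota 0)%R.
  apply: unit_val_inj; rewrite iota0 addr0 actGE -!pmulrn !shiftMn.
  by apply: (act_ceiling n_gt0 k_gt0 loc (m := 1%R)); lia.
by case: (coordK k%:Z%R 0%R) => -> _; lia.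
Qed.

(** The image contains the generators provided by [lexprod_generated]. *)
Lemma decompose_surj (y : L) : exists a, decompose a = y.
Proof.
have [[DI DU DM D1] [Dl Dr]] := decompose_morphism.
have [e1 e2] := decompose_e.
apply: (@lexprod_generated k k_gt0 _ complement (decompose e).2
  [set y | exists a, decompose a = y]%classic e2).
- split; first split.
  + by move=> _ _ [a <-] [b <-]; exists (a `&` b).
  + by move=> _ _ [a <-] [b <-]; exists (a `|` b).
  + by move=> _ _ [a <-] [b <-]; exists (a * b).
  + by exists 1.
  + by split=> _ [a <-]; [exists (ladj a) | exists (radj a)].
- move=> c; exists (val (iota c)); rewrite -tr0.
  by apply: decompose_unit; rewrite mulr0z add0r.
- exists (val shift); rewrite -[X in (X, _)]/(0%R : M).
  by apply: decompose_unit; rewrite iota0 addr0 mulr1z.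
- by exists e; rewrite -e1 -surjective_pairing.
Qed.

Lemma decompose_isomorphic : isomorphic A L.
Proof.
exists decompose; split; last exact: decompose_morphism.
pose g (y : L) := sval (cid (decompose_surj y)).
have gK : cancel g decompose by move=> y; apply: svalP (cid (decompose_surj y)).
by exists g => // a; apply: decompose_inj; rewrite gK.
Qed.

End Coordinates.

End Structure.

(** * Fourier-Motzkin elimination *)

Section Signs.
Local Open Scope ring_scope.
Import Num.Theory.

Definition vec := nat -> int.
HB.instance Definition _ := gen_eqMixin vec.
Implicit Types c : vec.

Definition lin (V : zmodType) m (h : nat -> V) c : V := \sum_(i < m) h i *~ c i.

Lemma lin_comb (V : zmodType) m (h : nat -> V) c c' (a b : int) :
  lin m h (fun i => c i * a - c' i * b) = lin m h c *~ a - lin m h c' *~ b.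
Proof.
rewrite /lin !mulrz_suml -sumrB; apply: eq_bigr => i _.
by rewrite mulrzBr !mulrzA.
Qed.

Lemma linS (V : zmodType) m (h : nat -> V) c :
  lin m.+1 h c = lin m h c + h m *~ c m.
Proof. exact: big_ord_recr. Qed.

Lemma ratio_lt (F : realFieldType) (x y a b : F) : 0 < a -> 0 < b ->
  (- x / a < - y / b) = (0 < x * b - y * a).
Proof.
move=> a0 b0; rewrite !mulNr ltrN2 ltr_pdivrMr // mulrAC ltr_pdivlMr //.
by rewrite subr_gt0.
Qed.

Lemma separate (us vs : seq rat) : (forall u v, u \in us -> v \in vs -> u < v) ->
  exists x, (forall u, u \in us -> u < x) /\ (forall v, v \in vs -> x < v).
Proof.
have above (u0 : rat) (ws : seq rat) : (forall v, v \in ws -> u0 < v) ->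
    exists2 x, u0 < x & forall v : rat, v \in ws -> x < v.
  elim: ws => [|v0 ws IH] h; first by exists (u0 + 1); rewrite // ltrDl.
  have [x ux xw] := IH (fun v vw => h v (mem_behead (s := v0 :: ws) vw)).
  have uv := h v0 (mem_head _ _).
  exists (Num.min x ((u0 + v0) / 2%:R)); first by rewrite lt_min ux /=; lra.
  move=> v; rewrite inE gt_min => /orP[/eqP->|/xw->//].
  by apply/orP; right; lra.
elim: us => [|u0 us IH] h.
  elim: vs {h} => [|v0 vs [x [_ xv]]]; first by exists 0.
  exists (Num.min x (v0 - 1)); split=> // v; rewrite inE gt_min => /orP[/eqP->|/xv->//].
  by apply/orP; right; lra.
have [x [xu xv]] := IH (fun u v uu => h u v (mem_behead (s := u0 :: us) uu)).
have [y uy yv] := above u0 vs (fun v => h u0 v (mem_head u0 us)).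
exists (Num.max x y); split=> [u|v vv]; last by rewrite gt_max xv ?yv.
by rewrite inE lt_max => /orP[/eqP->|/xu->//]; rewrite uy orbT.
Qed.

Variables (M : zmodType) (pos : pred M).
Hypotheses (pos0 : ~~ pos 0) (posD : forall x y, pos x -> pos y -> pos (x + y))
  (pos_total : forall x, x != 0 -> pos x || pos (- x)).

Lemma posN x : pos x -> ~~ pos (- x).
Proof. by move=> px; apply/negP => /(posD px); rewrite subrr; apply/negP. Qed.

Lemma pos_mulz x (a : int) : 0 < a -> pos (x *~ a) = pos x.
Proof.
have nat_case y (i : nat) : pos y -> pos (y *+ i.+1).
  by move=> py; elim: i => // i IH; rewrite mulrS posD.
move=> a0; have -> : a = `|a|.-1.+1%:Z by lia.
rewrite -pmulrn; apply/idP/idP => [px|]; last exact: nat_case.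
apply: contraLR px => npx.
have [->|/pos_total] := eqVneq x 0; first by rewrite mul0rn.
by rewrite (negPf npx) /= => /(nat_case _ `|a|.-1)/posN; rewrite mulNrn opprK.
Qed.

Definition same_sign x (q : rat) := pos x = (0 < q) /\ pos (- x) = (q < 0).

Lemma same_signN x q : same_sign x q -> same_sign (- x) (- q).
Proof. by case=> h1 h2; split; rewrite ?opprK ?oppr_gt0 ?oppr_lt0. Qed.

Lemma same_sign_eq0 x q : same_sign x q -> (x == 0) = (q == 0).
Proof.
case=> h1 h2; apply/eqP/eqP => [x0|q0].
  by move: h1 h2; rewrite x0 oppr0 (negPf pos0); lra.
apply/eqP; apply: contraFT (ltxx q) => /pos_total.
by rewrite h1 h2 q0 ltxx.
Qed.

Lemma same_sign_trichotomy x q : (pos x -> 0 < q) -> (pos (- x) -> q < 0) ->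
  (x = 0 -> q = 0) -> same_sign x q.
Proof.
move=> hp hn hz; have [x0|/pos_total] := eqVneq x 0.
  by rewrite /same_sign x0 oppr0 (negPf pos0) hz // ltxx.
case/orP=> px; split.
- by rewrite px hp.
- by rewrite (negPf (posN px)); have := hp px; lra.
- by rewrite -[x]opprK (negPf (posN px)); have := hn px; lra.
- by rewrite px hn.
Qed.

(** Once the coefficient of the last variable is made positive, each form bounds
    that variable from below, bounds it from above or fixes it.  The forms
    [elim2 c c'], which do not contain it, decide the order of these bounds, so
    a rational value that respects all of them exists as soon as the other
    variables respect the forms [elim2 c c']. *)
Lemma sign_match m (h : nat -> M) (L : seq vec) :
  exists z : nat -> rat, forall c, c \in L -> same_sign (lin m h c) (lin m z c).
Proof.
elim: m L => [|m IH] L.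
  by exists (fun=> 0) => c _; rewrite /lin !big_ord0; apply: same_sign_trichotomy;
    rewrite ?oppr0 ?(negPf pos0).
pose neg c : vec := fun i => - c i.
have linN (V : zmodType) l (g : nat -> V) c : lin l g (neg c) = - lin l g c.
  by rewrite /lin -sumrN; apply: eq_bigr => i _; rewrite mulrNz.
pose norm c := if c m < 0 then neg c else c.
pose L0 := [seq norm c | c <- L].
pose elim2 c c' : vec := fun i => c i * c' m - c' i * c m.
have [z zP] := IH (L0 ++ [seq elim2 c c' | c <- L0, c' <- L0]).
pose S c := lin m.+1 h c; pose e c := lin m z c.
pose Lp := [seq c <- L0 | 0 < c m].
pose r c := - e c / (c m)%:~R.
have cross c c' : c \in Lp -> c' \in Lp ->
    same_sign (S c *~ c' m - S c' *~ c m) (e c *~ c' m - e c' *~ c m).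
  rewrite !mem_filter => /andP[_ cL] /andP[_ cL'].
  have := zP (elim2 c c'); rewrite /elim2 !lin_comb /S /e !linS !mulrzDl -!mulrzA.
  rewrite [c m * _]mulrC opprD addrACA subrr addr0; apply.
  by rewrite mem_cat; apply/orP; right; apply: allpairs_f.
have rlt c c' : c \in Lp -> c' \in Lp ->
    (r c < r c') = (0 < e c *~ c' m - e c' *~ c m).
  rewrite !mem_filter => /andP[cp _] /andP[cp' _].
  have ca : 0 < (c m)%:~R :> rat by rewrite ltr0z.
  have ca' : 0 < (c' m)%:~R :> rat by rewrite ltr0z.
  by rewrite /r ratio_lt // !mulrzr.
have [x xP] : exists x : rat, forall c, c \in Lp ->
    [/\ pos (S c) -> r c < x, pos (- S c) -> x < r c & S c = 0 -> x = r c].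
  have [/hasP[c0 c0L /eqP S0]|/hasPn noZ] := boolP (has (fun c => S c == 0) Lp).
    exists (r c0) => c cL; have [h1 h2] := cross _ _ cL c0L.
    have [h3 h4] := cross _ _ c0L cL.
    have cp : 0 < c0 m by move: c0L; rewrite mem_filter => /andP[].
    rewrite S0 mul0rz ?subr0 ?sub0r in h1 h2 h3 h4.
    split=> [pc|nc|Sc].
    - by rewrite rlt // -h1 pos_mulz.
    - by rewrite rlt // -h3 -mulNrz pos_mulz.
    - apply: le_anti; rewrite !leNgt !rlt // -h1 -h3 Sc mul0rz oppr0.
      by rewrite (negPf pos0).
  have [u v|x [xu xv]] := @separate [seq r c | c <- Lp & pos (S c)]
                                    [seq r c | c <- Lp & pos (- S c)].
    case/mapP=> c; rewrite mem_filter => /andP[pc cL] ->.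
    case/mapP=> c'; rewrite mem_filter => /andP[pc' cL'] ->.
    have [h1 _] := cross _ _ cL cL'; rewrite rlt // -h1 -mulNrz posD ?pos_mulz //.
      by move: cL'; rewrite mem_filter => /andP[].
    by move: cL; rewrite mem_filter => /andP[].
  exists x => c cL; split=> [pc|nc|Sc].
  - by apply: xu; apply: map_f; rewrite mem_filter pc.
  - by apply: xv; apply: map_f; rewrite mem_filter nc.
  - by have := noZ c cL; rewrite Sc eqxx.
pose z' i := if i == m then x else z i.
have linz' c : lin m.+1 z' c = e c + x *~ c m.
  rewrite linS /z' eqxx; congr (_ + _); apply: eq_bigr => i _.
  by rewrite ltn_eqF.
have norm_ok c : c \in L0 -> 0 <= c m -> same_sign (lin m.+1 h c) (lin m.+1 z' c).
  move=> cL; rewrite le_eqVlt => /orP[/eqP c0|cp].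
    rewrite linz' linS -c0 !mulr0z !addr0; apply: zP.
    by rewrite mem_cat cL.
  have cLp : c \in Lp by rewrite mem_filter cp.
  have [h1 h2 h3] := xP c cLp.
  have ca : 0 < (c m)%:~R :> rat by rewrite ltr0z.
  have -> : lin m.+1 z' c = (c m)%:~R * (x - r c).
    rewrite linz' /r mulrBr mulNr mulrN opprK mulrCA mulfV ?lt0r_neq0 //.
    by rewrite mulr1 addrC mulrzl.
  apply: same_sign_trichotomy.
  - by move/h1 => rx; rewrite mulr_gt0 // subr_gt0.
  - by move/h2 => rx; rewrite pmulr_rlt0 // subr_lt0.
  - by move/h3 => ->; rewrite subrr mulr0.
exists z' => c cL.
have := norm_ok (norm c) (map_f _ cL).
rewrite /norm; case: ltP => [cn|cp]; last by apply.
rewrite {1}/neg oppr_ge0 ltW // => /(_ isT)/same_signN.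
by rewrite !linN !opprK.
Qed.

Lemma sign_match_int m (h : nat -> M) (L : seq vec) :
  exists z : nat -> int, forall c, c \in L ->
    pos (lin m h c) = (0 < lin m z c) /\ (lin m h c == 0) = (lin m z c == 0).
Proof.
have [z zP] := sign_match m h L.
have [D D0 [zi ziE]] : exists2 D : int, 0 < D &
    exists zi : nat -> int, forall i, (i < m)%N -> (zi i)%:~R = z i *~ D.
  elim: m {zP} => [|m [D D0 [zi ziE]]]; first by exists 1 => //; exists (fun=> 0).
  exists (D * denq (z m)); first by rewrite mulr_gt0 ?denq_gt0.
  exists (fun i => if i == m then numq (z m) * D else zi i * denq (z m)) => i im.
  have [->|ne] := eqVneq i m.
    by rewrite intrM numqE -[RHS]mulrzr intrM mulrAC -mulrA.
  by rewrite intrM ziE ?mulrzA ?mulrzr //; lia.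
exists zi => c cL.
have E : (lin m zi c)%:~R = lin m z c *~ D :> rat.
  rewrite /lin mulrz_suml rmorph_sum /=; apply: eq_bigr => i _.
  by rewrite mulrzAC -ziE // mulrzz intrM mulrzr.
have D0' : 0 < D%:~R :> rat by rewrite ltr0z.
have s := zP c cL; rewrite (same_sign_eq0 s); case: s => -> _.
rewrite -(ltr0z rat) -(intr_eq0 rat) E -mulrzr pmulr_lgt0 //.
by rewrite mulf_eq0 [D%:~R == 0]gt_eqF ?orbF.
Qed.

End Signs.

(** * The equations of the lexicographic products *)

Section Morphisms.
Variables (d : Order.disp_t) (A : lpregroupType d) (d' : Order.disp_t) (B : lpregroupType d').

Lemma leval_morphism (f : A -> B) v t : lp_morphism f ->
  f (leval v t) = leval (f \o v) t.
Proof.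
move=> [[fI fU fM f1] [fl fr]]; elim: t => [i||t IHt u IHu|t IHt u IHu|t IHt u IHu|t IH|t IH].
- by rewrite !leval_var.
- by rewrite !leval_one.
- by rewrite !leval_meet fI IHt IHu.
- by rewrite !leval_join fU IHt IHu.
- by rewrite !leval_mul fM IHt IHu.
- by rewrite !leval_ladj fl IH.
- by rewrite !leval_radj fr IH.
Qed.

Lemma satisfies_injective (f : A -> B) E : injective f -> lp_morphism f ->
  satisfies B E -> satisfies A E.
Proof.
by move=> fi fm sB e Ee v; apply: fi; rewrite !leval_morphism //; apply: sB.
Qed.

End Morphisms.

Lemma satisfies_dvd n k E : (0 < n)%N -> (k %| n)%N ->
  satisfies (FnZ n) E -> satisfies (FnZ k) E.
Proof.
move=> n0 /dvdnP[l nl].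
have ex (f : FnZ k) : periodic_val f \in @periodic _ FZ n.
  apply/FZ_periodicP => q; have -> : (n%:Z = l%:Z * k%:Z)%R by lia.
  exact: app_perM.
pose emb (f : FnZ k) : FnZ n := PeriodicSub (ex f).
apply: (@satisfies_injective _ _ _ _ emb).
  by move=> f g [fg]; apply: val_inj; rewrite /= fg.
by split; first split; try split; move=> *; apply: val_inj.
Qed.

Section LexVariety.
Variables (k : nat) (dH : Order.disp_t) (H : orderedLgroupType dH).
Hypothesis Hab : abelian_lgroup H.

Local Notation L := (lexprod H (FnZ k)).

Fact abelian_units_commute : units_commute H.
Proof. by move=> g h _ _; apply: Hab. Qed.

Local Notation G := (unit_group abelian_units_commute).

Definition to_group (h : H) : G := to_unit abelian_units_commute (ladjE h).
Definition gpos (x : G) : bool := 1 < unit_val x.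

Lemma to_groupM h h' : to_group (h * h') = (to_group h + to_group h')%R.
Proof. exact: unit_val_inj. Qed.
Lemma to_group1 : to_group 1 = 0%R.
Proof. exact: unit_val_inj. Qed.
Lemma to_groupV h : to_group (ladj h) = (- to_group h)%R.
Proof. exact: unit_val_inj. Qed.

Lemma gposB h h' : gpos (to_group h' - to_group h)%R = (h < h').
Proof.
rewrite /gpos -to_groupV -to_groupM /= !ltNge; congr (~~ _).
by rewrite unit_mulV_le1 //; apply: ladjE.
Qed.

Lemma to_group_eq h h' : (to_group h' - to_group h == 0)%R = (h' == h).
Proof. by rewrite subr_eq0 -(inj_eq (@unit_val_inj _ _ _)). Qed.

Lemma gpos0 : ~~ gpos 0%R.
Proof. by rewrite /gpos unit_val0 ltxx. Qed.

Lemma gposD x y : gpos x -> gpos y -> gpos (x + y)%R.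
Proof.
rewrite /gpos => px py; apply: lt_le_trans px _.
by rewrite unit_valD -{1}[unit_val x]lp_mulg1 le_mulg // ltW.
Qed.

Lemma gpos_total x : (x != 0)%R -> gpos x || gpos (- x)%R.
Proof.
rewrite -(inj_eq (@unit_val_inj _ _ _)) unit_val0 => x0.
rewrite /gpos unit_valN; case: (ltgtP 1 (unit_val x)) x0 => [//|x1 _|_ //].
rewrite lt_neqAle (le_trans _ (le_ladj (ltW x1))) ?ladj1 // andbT.
apply/eqP => e; have := congr1 (@radj _ _) e; rewrite ladjK radj1 => e1.
by move: x1; rewrite -e1 ltxx.
Qed.

Variable v : nat -> L.

Fixpoint bound (t : lterm) : nat := match t with
  | LVar i => i.+1
  | LOne => 0
  | LMeet t u | LJoin t u | LMul t u => maxn (bound t) (bound u)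
  | LLadj t | LRadj t => bound t
  end.

(** The coordinate in H of the value of t as an integer combination of those of
    the variables; a meet or a join takes the form of the argument chosen at the
    valuation v.  The shape of the other cases fits [lin_comb]. *)
Fixpoint form (t : lterm) : vec := match t with
  | LVar i => fun j => (j == i)%:Z%R
  | LOne => fun=> 0%R
  | LMeet t u => if (leval v t).1 <= (leval v u).1 then form t else form u
  | LJoin t u => if (leval v t).1 <= (leval v u).1 then form u else form t
  | LMul t u => fun j => (form t j * 1 - form u j * (- 1))%R
  | LLadj t | LRadj t => fun j => (0 * 0 - form t j * 1)%R
  end.

Definition form_diff t u : vec := fun j => (form t j * 1 - form u j * 1)%R.

(** The differences whose signs determine the choices made by [form] *)
Fixpoint forms (t : lterm) : seq vec := match t with
  | LVar _ | LOne => [::]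
  | LMeet t u | LJoin t u => [:: form_diff t u, form_diff u t & forms t ++ forms u]
  | LMul t u => forms t ++ forms u
  | LLadj t | LRadj t => forms t
  end.

Let hv i := to_group (v i).1.

Lemma leval_fst t m : (bound t <= m)%N -> to_group (leval v t).1 = lin m hv (form t).
Proof.
elim: t => [i||t IHt u IHu|t IHt u IHu|t IHt u IHu|t IH|t IH];
  rewrite [bound _]/= [form _]/=.
- move=> im; rewrite leval_var /lin (bigD1 (Ordinal im)) //= eqxx mulr1z.
  rewrite big1 ?addr0 // => j ji; have /negPf-> : (j != i :> nat).
    by apply: contra ji => /eqP ji; apply/eqP/val_inj.
  by rewrite mulr0z.
- by move=> _; rewrite leval_one to_group1 /lin big1.
- rewrite geq_max => /andP[tm um]; rewrite leval_meet lexprod_meetE.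
  by case: ltgtP => _; rewrite ?IHt ?IHu.
- rewrite geq_max => /andP[tm um]; rewrite leval_join lexprod_joinE.
  by case: (ltgtP (leval v t).1 (leval v u).1) => [_|_|E] /=; rewrite -?IHt -?IHu //= E.
- rewrite geq_max => /andP[tm um]; rewrite leval_mul to_groupM lin_comb IHt ?IHu //.
  by rewrite mulr1z mulrNz mulr1z opprK.
- move=> tm; rewrite leval_ladj to_groupV (lin_comb _ _ (fun=> 0%R)) mulr0z sub0r mulr1z.
  by rewrite IH.
- move=> tm; rewrite leval_radj.
  have -> : (@radj _ L (leval v t)).1 = ladj (leval v t).1 by rewrite ladjE.
  by rewrite to_groupV (lin_comb _ _ (fun=> 0%R)) mulr0z sub0r mulr1z IH.
Qed.

Lemma tr_k_central (j : int) (f : FnZ k) : tr k (j * k%:Z) * f = f * tr k (j * k%:Z).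
Proof. by apply: app_ext => q; rewrite app_tr_mul app_mul_tr app_perM. Qed.

Hypothesis k_gt0 : (0 < k)%N.

Lemma Fn_le_translate (f g : FnZ k) : exists N0 : nat, forall j : int,
  (N0%:Z <= j)%R -> f <= g * tr k (j * k%:Z).
Proof.
have [i [_ fi _]] := Fn_hullP k_gt0 f.
have [j [_ gj _]] := Fn_hullP k_gt0 (ladj g).
exists `|(i + j)%R|%N => l lN; apply/app_leP => q; rewrite app_mul_tr.
rewrite app_perM.
have : (app (ladj g) (q + i) <= q + i + j)%R := gj _.
rewrite app_ladjP => h; apply: le_trans (fi q) _.
have h2 : (app g (q + i + j) <= app g q + l * k%:Z)%R.
  rewrite -app_perM app_mono //; nia.
by apply: le_trans h h2.
Qed.

Section Approximation.
Variables (m : nat) (z : nat -> int).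

(** The coordinates in H are replaced by translations by multiples of Nk.  These
    are central, and for N large the order of two values with distinct
    coordinates in H is decided by these coordinates, as in the lexicographic
    order. *)
Definition approx (N : nat) i : FnZ k := (v i).2 * tr k (N%:Z * z i * k%:Z).

Definition matches c := gpos (lin m hv c) = (0 < lin m z c)%R /\
  (lin m hv c == 0)%R = (lin m z c == 0)%R.

Lemma form_diffE (V : zmodType) (h : nat -> V) t u :
  lin m h (form_diff t u) = (lin m h (form t) - lin m h (form u))%R.
Proof. by rewrite lin_comb !mulr1z. Qed.

Lemma form_lt t u : (bound t <= m)%N -> (bound u <= m)%N -> matches (form_diff u t) ->
  ((leval v t).1 < (leval v u).1) = (lin m z (form t) < lin m z (form u))%R.
Proof.
by move=> tm um [+ _]; rewrite !form_diffE -!leval_fst // gposB Num.Theory.subr_gt0.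
Qed.

Lemma form_eq t u : (bound t <= m)%N -> (bound u <= m)%N -> matches (form_diff u t) ->
  ((leval v u).1 == (leval v t).1) = (lin m z (form u) == lin m z (form t)).
Proof.
by move=> tm um [_]; rewrite !form_diffE -!leval_fst // to_group_eq subr_eq0.
Qed.

Definition approximates t (N : nat) :=
  leval (approx N) t = (leval v t).2 * tr k (N%:Z * lin m z (form t) * k%:Z).

Lemma approx_le t u : (bound t <= m)%N -> (bound u <= m)%N ->
  matches (form_diff u t) -> (leval v t).1 < (leval v u).1 ->
  exists N0, forall N, (N0 <= N)%N -> approximates t N -> approximates u N ->
    leval (approx N) t <= leval (approx N) u.
Proof.
move=> tm um mut; rewrite form_lt // => lt.
have [N0 N0P] := Fn_le_translate (leval v t).2 (leval v u).2.
exists N0 => N NN -> ->.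
have -> : (N%:Z * lin m z (form u) * k%:Z =
  (N%:Z * (lin m z (form u) - lin m z (form t))) * k%:Z + N%:Z * lin m z (form t) * k%:Z)%R.
  by ring.
by rewrite -trM lp_mulgA le_mulg // N0P //; nia.
Qed.

Lemma approx_ex t : (bound t <= m)%N -> (forall c, c \in forms t -> matches c) ->
  exists N0, forall N, (N0 <= N)%N -> approximates t N.
Proof.
have sub2 (L1 L2 : seq vec) c : c \in L1 \/ c \in L2 -> c \in L1 ++ L2.
  by rewrite mem_cat => -[->|->]; rewrite ?orbT.
elim: t => [i||t IHt u IHu|t IHt u IHu|t IHt u IHu|t IH|t IH];
  rewrite [bound _]/= [forms _]/=.
- move=> im _; exists 0%N => N _; rewrite /approximates !leval_var /approx.
  congr (_ * tr k (_ * _ * _)); rewrite /lin (bigD1 (Ordinal im)) //= eqxx mulr1z.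
  rewrite big1 ?addr0 // => j ji; have /negPf-> : (j != i :> nat).
    by apply: contra ji => /eqP ji; apply/eqP/val_inj.
  by rewrite mulr0z.
- move=> _ _; exists 0%N => N _; rewrite /approximates !leval_one /lin big1 //.
  by rewrite mulr0 mul0r tr0 lp_mulg1.
- rewrite geq_max => /andP[tm um] mt.
  have mtu : matches (form_diff t u) by apply: mt; rewrite inE eqxx.
  have mut : matches (form_diff u t) by apply: mt; rewrite !inE eqxx orbT.
  have mI c : c \in forms t \/ c \in forms u -> matches c.
    by move=> h; apply: mt; rewrite !inE sub2 ?orbT.
  have [Nt NtP] := IHt tm (fun c h => mI c (or_introl h)).
  have [Nu NuP] := IHu um (fun c h => mI c (or_intror h)).
  rewrite /approximates [form _]/= leval_meet lexprod_meetE.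
  case: (ltgtP (leval v t).1 (leval v u).1) => [lt|gt|E].
  + have [N1 N1P] := approx_le tm um mut lt.
    exists (maxn N1 (maxn Nt Nu)) => N NN; rewrite leval_meet.
    have at_ : approximates t N by apply: NtP; lia.
    have au : approximates u N by apply: NuP; lia.
    by rewrite (meet_idPl _) ?(N1P N) //; lia.
  + have [N1 N1P] := approx_le um tm mtu gt.
    exists (maxn N1 (maxn Nt Nu)) => N NN; rewrite leval_meet.
    have at_ : approximates t N by apply: NtP; lia.
    have au : approximates u N by apply: NuP; lia.
    by rewrite (meet_idPr _) ?(N1P N) //; lia.
  + exists (maxn Nt Nu) => N NN; rewrite leval_meet NtP ?NuP; [|lia|lia].
    have zE : lin m z (form u) = lin m z (form t).
      by apply/eqP; rewrite -(form_eq tm um mut) E.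
    rewrite zE.
    by rewrite -lp_mulIg.
- rewrite geq_max => /andP[tm um] mt.
  have mtu : matches (form_diff t u) by apply: mt; rewrite inE eqxx.
  have mut : matches (form_diff u t) by apply: mt; rewrite !inE eqxx orbT.
  have mI c : c \in forms t \/ c \in forms u -> matches c.
    by move=> h; apply: mt; rewrite !inE sub2 ?orbT.
  have [Nt NtP] := IHt tm (fun c h => mI c (or_introl h)).
  have [Nu NuP] := IHu um (fun c h => mI c (or_intror h)).
  rewrite /approximates [form _]/= leval_join lexprod_joinE.
  case: (ltgtP (leval v t).1 (leval v u).1) => [lt|gt|E].
  + have [N1 N1P] := approx_le tm um mut lt.
    exists (maxn N1 (maxn Nt Nu)) => N NN; rewrite leval_join.
    have at_ : approximates t N by apply: NtP; lia.
    have au : approximates u N by apply: NuP; lia.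
    by rewrite (join_idPr _) ?(N1P N) //; lia.
  + have [N1 N1P] := approx_le um tm mtu gt.
    exists (maxn N1 (maxn Nt Nu)) => N NN; rewrite leval_join.
    have at_ : approximates t N by apply: NtP; lia.
    have au : approximates u N by apply: NuP; lia.
    by rewrite (join_idPl _) ?(N1P N) //; lia.
  + exists (maxn Nt Nu) => N NN; rewrite leval_join NtP ?NuP; [|lia|lia].
    have zE : lin m z (form u) = lin m z (form t).
      by apply/eqP; rewrite -(form_eq tm um mut) E.
    rewrite zE.
    by rewrite -lp_mulUg.
- rewrite geq_max => /andP[tm um] mt.
  have [Nt NtP] := IHt tm (fun c h => mt c (sub2 _ _ _ (or_introl h))).
  have [Nu NuP] := IHu um (fun c h => mt c (sub2 _ _ _ (or_intror h))).
  exists (maxn Nt Nu) => N NN; rewrite /approximates leval_mul NtP ?NuP; [|lia|lia].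
  rewrite lin_comb mulrNz !mulr1z opprK.
  rewrite -lp_mulgA [tr _ _ * _]lp_mulgA tr_k_central !lp_mulgA -lp_mulgA trM.
  by congr (_ * tr k _); ring.
- move=> tm mt; have [Nt NtP] := IH tm mt.
  exists Nt => N NN; rewrite /approximates leval_ladj NtP // ladjM ladj_tr.
  have -> : (- (N%:Z * lin m z (form t) * k%:Z) = - (N%:Z * lin m z (form t)) * k%:Z)%R by ring.
  rewrite tr_k_central; congr (_ * tr k (_ * _)).
  by rewrite (lin_comb _ _ (fun=> 0%R)) mulr0z sub0r mulr1z; ring.
- move=> tm mt; have [Nt NtP] := IH tm mt.
  exists Nt => N NN; rewrite /approximates leval_radj NtP // radjM -(tr_unit k _) ladj_tr.
  have -> : (- (N%:Z * lin m z (form t) * k%:Z) = - (N%:Z * lin m z (form t)) * k%:Z)%R by ring.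
  rewrite tr_k_central; congr (_ * tr k (_ * _)).
  by rewrite (lin_comb _ _ (fun=> 0%R)) mulr0z sub0r mulr1z; ring.
Qed.

End Approximation.

(** The two values of t and u under the approximation agree for all large N, so
    the linear parts in N and the constant parts agree separately. *)
Lemma lexprod_equation t u : (forall w : nat -> FnZ k, leval w t = leval w u) ->
  leval v t = leval v u.
Proof.
move=> tu; pose m := maxn (bound t) (bound u).
have tm : (bound t <= m)%N by apply: leq_maxl.
have um : (bound u <= m)%N by apply: leq_maxr.
have [z zP] := sign_match_int gpos0 gposD gpos_total m hv
  ([:: form_diff t u; form_diff u t] ++ forms t ++ forms u).
have [|Nt NtP] := @approx_ex m z t tm.
  by move=> c ct; apply: zP; rewrite !mem_cat ct orbT.
have [|Nu NuP] := @approx_ex m z u um.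
  by move=> c cu; apply: zP; rewrite !mem_cat cu !orbT.
have mut : matches m z (form_diff u t) by apply: zP; rewrite !inE eqxx orbT.
have E (N : nat) : (Nt <= N)%N -> (Nu <= N)%N ->
    (leval v t).2 * tr k (N%:Z * lin m z (form t) * k%:Z) =
    (leval v u).2 * tr k (N%:Z * lin m z (form u) * k%:Z).
  by move=> h1 h2; rewrite -NtP // -NuP // tu.
pose N := maxn Nt Nu.
have EN (N' : nat) q : (N <= N')%N ->
    (app (leval v t).2 q + N'%:Z * lin m z (form t) * k%:Z =
     app (leval v u).2 q + N'%:Z * lin m z (form u) * k%:Z)%R.
  by move=> NN; rewrite -!app_perM -!app_mul_tr E //; rewrite /N in NN; lia.
have zeq : lin m z (form u) = lin m z (form t).
  have := EN N 0%R (leqnn N); have := EN N.+1 0%R (leqnSn N).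
  move: (app _ _) (app _ _) => a b; rewrite (_ : N.+1%:Z = N%:Z + 1)%R; last lia.
  by nia.
have := form_eq tm um mut; rewrite zeq eqxx => /eqP E1.
rewrite [leval v t]surjective_pairing [leval v u]surjective_pairing E1; congr (_, _).
by apply: app_ext => q; have := EN N q (leqnn N); rewrite zeq => /addIr.
Qed.

End LexVariety.

(** * Subdirect irreducibility *)

Section Irreducible.
Variables (d : Order.disp_t) (A : lpregroupType d).

Lemma si_fsi : subdirectly_irreducible A -> finitely_subdirectly_irreducible A.
Proof.
move=> si R1 R2 c1 c2 R12.
have : [set R1; R2]%classic eq; last by case=> <-; [left | right].
apply: si => [R [->|->] //|]; rewrite -R12.
apply/funext => x; apply/funext => y; apply/propext; split=> [h|[h1 h2] R [->|->]] //.
by split; apply: h; [left | right].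
Qed.

Variables (n : nat) (n_gt0 : (0 < n)%N).
Hypothesis per : forall x : A, iter n ll x = x.
Variable s : A.
Hypotheses (s1 : 1 <= s) (s_neq1 : s <> 1)
  (s_least : forall g : A, lp_unit g -> ~~ (g <= 1) -> s <= g).

(** If x and y are identified and y does not lie below x, then the least units
    above x^l y and x^l x are identified; the former lies above s, the latter
    below 1, so that s and 1 are identified. *)
Lemma congruence_least (R : A -> A -> Prop) : congruence R -> R <> eq -> R s 1.
Proof.
move=> [[Rr Rs Rt] [RI RU RM Rl _]] Rneq.
have [x [y [xy yx]]] : exists x y, R x y /\ ~~ (y <= x).
  apply: contrapT => no; apply: Rneq.
  apply/funext => x; apply/funext => y; apply/propext; split=> [xy|->//].
  apply: le_anti; apply/andP; split; apply/negP => /negP h; apply: no.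
    by exists y, x; split=> //; apply: Rs.
  by exists x, y.
have Rhull m u w : R u w -> R (hull m u) (hull m w).
  move=> uw; elim: m => //= m IH; apply: RU => //.
  by rewrite /ll; apply/Rl/Rl.
have Rpq := Rhull n _ _ (RM _ _ _ _ (Rr (ladj x)) (Rs _ _ xy)).
have p1 : s <= hull n (ladj x * y).
  apply: s_least; first exact: (unit_hull n_gt0 per).
  by rewrite (hull_leE n _ (@unit1 d A)) le_ladj1.
have q1 : hull n (ladj x * x) <= 1.
  by rewrite (hull_leE n _ (@unit1 d A)) le_ladj1.
have := RI _ _ _ _ (RU _ _ _ _ Rpq (Rr 1)) (Rr s).
rewrite (join_idPr q1) (meet_idPl s1) (join_idPl (le_trans s1 p1)).
by rewrite (meet_idPr p1).
Qed.

Lemma least_si : subdirectly_irreducible A.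
Proof.
move=> C Ccong Ceq; apply: contrapT => nC; apply: s_neq1.
rewrite -Ceq => R CR; apply: congruence_least; first exact: Ccong.
by move=> E; apply: nC; rewrite -E.
Qed.

End Irreducible.

Section Isomorphism.
Variables (d : Order.disp_t) (A : lpregroupType d) (d' : Order.disp_t) (B : lpregroupType d').

Lemma isomorphic_inverse : isomorphic A B -> exists (f : A -> B) (g : B -> A),
  [/\ cancel f g, cancel g f, lp_morphism f & lp_morphism g].
Proof.
move=> [f [[g fK gK] fm]]; exists f, g; split=> //.
have [[fI fU fM f1] [fl fr]] := fm.
have fi := can_inj fK.
split; first split; [move=> x y|move=> x y|move=> x y| |split=> x];
  by apply: fi; rewrite ?fI ?fU ?fM ?f1 ?fl ?fr !gK.
Qed.

Lemma morphism_le (f : A -> B) : lp_morphism f -> {homo f : x y / x <= y}.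
Proof. by move=> [[fI _ _ _] _] x y /meet_idPl xy; apply/meet_idPl; rewrite -fI xy. Qed.

Lemma morphism_unit (f : A -> B) x : lp_morphism f -> lp_unit x -> lp_unit (f x).
Proof. by move=> [_ [fl fr]]; rewrite /lp_unit -fl -fr => ->. Qed.

Lemma isomorphic_fg : isomorphic A B -> finitely_generated B -> finitely_generated A.
Proof.
move=> /isomorphic_inverse[f [g [fK gK _ [[gI gU gM g1] [gl gr]]]]] [bs gen].
exists [seq g b | b <- bs] => S [[SI SU SM S1] [Sl Sr]] Sg x.
rewrite -(fK x); apply: (gen [set b | S (g b)]%classic); last first.
  by move=> b bbs; apply: Sg; apply: map_f.
split; first split; [move=> y z Sy Sz..| |split=> y Sy]; rewrite /= ?gI ?gU ?gM ?g1 ?gl ?gr.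
- exact: SI.
- exact: SU.
- exact: SM.
- exact: S1.
- exact: Sl.
- exact: Sr.
Qed.

End Isomorphism.

Lemma lexprod_converse n k d (A : lpregroupType d) dH (H : orderedLgroupType dH) :
  (0 < n)%N -> (k %| n)%N -> (1 < k)%N -> abelian_lgroup H -> finitely_generated H ->
  isomorphic A (lexprod H (FnZ k)) ->
  [/\ lp_proper A, finitely_generated A, subdirectly_irreducible A & in_variety_of A (FnZ n)].
Proof.
move=> n0 kn k1 Hab Hfg iso; have k0 := ltnW k1.
have [f [g [fK gK fm gm]]] := isomorphic_inverse iso.
have var : in_variety_of A (FnZ n).
  move=> E nE; apply: (satisfies_injective (can_inj fK) fm) => e Ee v.
  by apply: lexprod_equation => // w; apply: (satisfies_dvd n0 kn nE).
split=> //.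
- move=> allu; have [c cc] := ceil_ex k0.
  have cu : lp_unit c.
    have := morphism_unit fm (allu (g ((1, c) : lexprod H (FnZ k)))).
    by rewrite gK => E; exact: (congr1 (@snd H (FnZ k)) E).
  have := congr1 (fun x => app x 0%R) ((unit_ll _).1 cu).
  by rewrite app_ll (cc 0%R) ?(cc 0%R) //; lia.
- exact: isomorphic_fg iso (lexprod_fg k0 Hfg).
- have fi := can_inj fK.
  pose s0 : lexprod H (FnZ k) := (1, tr k 1).
  have [[_ _ _ f1] _] := fm; have [[_ _ _ g1] _] := gm.
  have s0_le1 : ~~ (s0 <= 1).
    by rewrite lexprod_leE /= ltxx eqxx /= -tr0 tr_le.
  apply: (@least_si _ _ n n0 (variety_period var) (g s0)).
  + rewrite -g1; apply: (morphism_le gm).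
    by rewrite lexprod_leE /= ltxx eqxx /= -tr0 tr_le.
  + by move=> E; move: s0_le1; rewrite -(gK s0) E f1 lexx.
  + move=> x xu xn1; rewrite -(fK x); apply: (morphism_le gm).
    have fxn1 : ~~ (f x <= 1).
      by apply: contra xn1 => h; rewrite -(fK x) -g1; apply: (morphism_le gm h).
    have := morphism_unit fm xu; move: fxn1; case: (f x) => h p fxn1 E.
    have pu : lp_unit p := congr1 (@snd H (FnZ k)) E.
    have [j pj] := unit_tr pu; move: fxn1; rewrite !lexprod_leE /= pj.
    case: (ltgtP h 1) => //= _.
    by rewrite -tr0 !tr_le; lia.
Qed.

Lemma proper_fsi_structure n d (A : lpregroupType d) : (0 < n)%N ->
  lp_proper A -> finitely_generated A -> finitely_subdirectly_irreducible A ->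
  in_variety_of A (FnZ n) ->
  exists (k : nat) (dH : Order.disp_t) (H : orderedLgroupType dH),
     [/\ (k %| n)%N, (1 < k)%N, abelian_lgroup H, finitely_generated H
       & isomorphic A (lexprod H (FnZ k))].
Proof.
move=> n0 proper fg fsi var.
have per := variety_period var.
have [s loc] := proper_fsi_local n0 var fsi proper fg.
have [k1 [ex gap]] := max_gap n0 per loc.
have [e ce] := ceiling_ex n0 loc gap ex.
have rnd := ceiling_local n0 loc gap ce.
have comm := period_comm n0 loc gap ce.
have [gs gen] := fg.
have [r [h [sp fr hc]]] := central_complement n0 (ltn0Sn k1) per rnd (comm e) gen.
have [f [p [_ cp _]]] := rnd [::] 0.
have [l nl] := ceil_dvd n0 (ltn0Sn k1) cp.
exists k1.+1, d, (complement n0 (ltn0Sn k1) fr); split.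
- by rewrite nl dvdn_mull.
- rewrite ltnS lt0n; apply/eqP => k0; apply: proper => x.
  apply/unit_ll; have sx := s_conj loc x.
  have := comm x; rewrite k0 pw1 sx => E.
  by rewrite -(unit_mulgK (ll x) (s_unit loc)) E unit_mulgK //; apply: s_unit loc.
- exact: chain_abelian.
- exact: complement_fg.
- exact: decompose_isomorphic.
Qed.

(* The divisor k = 1 is left out because F_1(Z) consists of the translations of
   Z, so that H x F_1(Z) is an l-group and hence not proper. *)
Theorem corollary6p13 (n : nat) (n_gt0 : (0 < n)%N)
    (d : Order.disp_t) (A : lpregroupType d) :
  ([/\ lp_proper A, finitely_generated A, subdirectly_irreducible A
      & in_variety_of A (FnZ n)] <->
   exists (k : nat) (dH : Order.disp_t) (H : orderedLgroupType dH),
     [/\ (k %| n)%N, (1 < k)%N, abelian_lgroup H, finitely_generated H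
       & isomorphic A (lexprod H (FnZ k))]) /\
  ([/\ lp_proper A, finitely_generated A, finitely_subdirectly_irreducible A
      & in_variety_of A (FnZ n)] <->
   [/\ lp_proper A, finitely_generated A, subdirectly_irreducible A
      & in_variety_of A (FnZ n)]).
Proof.
have fwd : lp_proper A -> finitely_generated A ->
    finitely_subdirectly_irreducible A -> in_variety_of A (FnZ n) ->
    exists (k : nat) (dH : Order.disp_t) (H : orderedLgroupType dH),
     [/\ (k %| n)%N, (1 < k)%N, abelian_lgroup H, finitely_generated H
       & isomorphic A (lexprod H (FnZ k))].
  exact: proper_fsi_structure.
split; split.
- by case=> proper fg /si_fsi fsi var; apply: fwd.
- by case=> k [dH [H [kn k1 Hab Hfg iso]]]; apply: (lexprod_converse n_gt0 kn k1 Hab Hfg iso).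
- case=> proper fg fsi var.
  have [k [dH [H [kn k1 Hab Hfg iso]]]] := fwd proper fg fsi var.
  exact: (lexprod_converse n_gt0 kn k1 Hab Hfg iso).
- by case=> proper fg /si_fsi fsi var.
Qed.
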